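(* Let $n\geq 2$ and $1/2\leq\sigma<1$. Let $\Omega\subset\mathbb{R}^n$ be a bounded open set with $C^1$ boundary and assume that $$0<S_{n,\sigma}(\Omega)<S_{n,\sigma}(\mathbb{R}^n_+).$$ Then any minimizing sequence $(u_k)\subset\mathring H^\sigma(\Omega)$ for $S_{n,\sigma}(\Omega)$ with $I_{n,\sigma,\Omega}[u_k]=1$ for all $k$ is relatively compact in $\mathring H^\sigma(\Omega)$. In particular, the infimum $S_{n,\sigma}(\Omega)$ is attained.
   Context: $\mathbb{R}^n_+=\{(x',x_n)\in\mathbb{R}^{n-1}\times\mathbb{R}:x_n>0\}$. For an open set $\Omega\subset\mathbb{R}^n$ let $I_{n,\sigma,\Omega}[u]=\iint_{\Omega\times\Omega}\frac{(u(x)-u(y))^2}{|x-y|^{n+2\sigma}}\,dx\,dy$, let $\mathring H^\sigma(\Omega)$ be the completion of $C^1_c(\Omega)$ with respect to $I_{n,\sigma,\Omega}$, and $S_{n,\sigma}(\Omega)=\inf_{0\not\equiv u\in C^1_c(\Omega)} I_{n,\sigma,\Omega}[u]\big/\big(\int_\Omega|u|^{\frac{2n}{n-2\sigma}}dx\big)^{\frac{n-2\sigma}{n}}$. When $S_{n,\sigma}(\Omega)>0$, $\mathring H^\sigma(\Omega)$ is a space of functions embedded in $L^{\frac{2n}{n-2\sigma}}(\Omega)$ and the infimum may equivalently be taken over nonzero $u\in\mathring H^\sigma(\Omega)$. A minimizing sequence is a sequence of nonzero elements along which the quotient tends to $S_{n,\sigma}(\Omega)$. *)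

(* Defs.v *)
From HB Require Import structures.
From mathcomp Require Import all_boot all_order all_algebra.
From mathcomp Require Import all_classical all_reals all_analysis.
Set Implicit Arguments. Unset Strict Implicit. Unset Printing Implicit Defensive.
Import Order.TTheory GRing.Theory Num.Theory.
Import numFieldNormedType.Exports.
Local Open Scope classical_set_scope.
Local Open Scope ring_scope.

(* Points of R^n are row vectors 'rV[R]_n (topology of 'rV = Euclidean topology). *)

Section FracSobolev.
Context {R : realType}.

Definition enorm (n : nat) (x : 'rV[R]_n) : R :=
  Num.sqrt (\sum_(i < n) x ord0 i ^+ 2).

Definition evec (n : nat) (i : 'I_n) : 'rV[R]_n := delta_mx ord0 i.

(** n-dimensional Lebesgue integral of a NONNEGATIVE function, defined as the
    iterated one-dimensional Lebesgue integral (Tonelli: for nonnegative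
    measurable functions this is the integral w.r.t. n-dim Lebesgue measure). *)
Fixpoint tuple_int (n : nat) : (n.-tuple R -> \bar R) -> \bar R :=
  match n with
  | 0 => fun f => f [tuple]
  | m.+1 => fun f =>
      (\int[@lebesgue_measure R]_x tuple_int (fun t : m.-tuple R => f (cons_tuple x t)))%E
  end.

Definition rv_of_tuple (n : nat) (t : n.-tuple R) : 'rV[R]_n := \row_i tnth t i.

Definition Rn_int (n : nat) (f : 'rV[R]_n -> \bar R) : \bar R :=
  tuple_int (f \o @rv_of_tuple n).

Definition Rn_measurable (n : nat) (u : 'rV[R]_n -> R) : Prop :=
  measurable_fun setT (u \o @rv_of_tuple n).

Definition Igag (n : nat) (sigma : R) (Om : set 'rV[R]_n) (u : 'rV[R]_n -> R)
  : \bar R :=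
  Rn_int (fun x => Rn_int (fun y =>
    ((\1_Om x * \1_Om y) *
     ((u x - u y) ^+ 2 / (enorm (x - y)) `^ (n%:R + 2 * sigma)))%:E)).

Definition pstar (n : nat) (sigma : R) : R := 2 * n%:R / (n%:R - 2 * sigma).

Definition Lint (n : nat) (sigma : R) (Om : set 'rV[R]_n) (u : 'rV[R]_n -> R)
  : \bar R :=
  Rn_int (fun x => (\1_Om x * `|u x| `^ pstar n sigma)%:E).

(** The quotient I[u] / (int |u|^{2*})^{(n-2sigma)/n} (used only for u with
    both quantities finite). *)
Definition Rquot (n : nat) (sigma : R) (Om : set 'rV[R]_n) (u : 'rV[R]_n -> R)
  : R :=
  fine (Igag sigma Om u) / (fine (Lint sigma Om u)) `^ ((n%:R - 2 * sigma) / n%:R).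

Definition C1 (n : nat) (u : 'rV[R]_n -> R) : Prop :=
  forall i : 'I_n,
    (forall x, derivable u x (evec i)) /\ continuous (fun x => 'D_(evec i) u x).

Definition C1c (n : nat) (Om : set 'rV[R]_n) (u : 'rV[R]_n -> R) : Prop :=
  C1 u /\ exists K : set 'rV[R]_n, [/\ compact K, K `<=` Om & forall x, ~ K x -> u x = 0].

Definition Sconst (n : nat) (sigma : R) (Om : set 'rV[R]_n) : \bar R :=
  ereal_inf [set (Rquot sigma Om u)%:E |
             u in [set u | C1c Om u /\ exists x, u x != 0]].

(** The completion \mathring H^sigma(Omega), realized (when S > 0) inside
    L^{2n/(n-2sigma)}(Omega): (measurable representatives of) the limits of
    sequences in C^1_c(Omega) w.r.t. both I and the L^{2*} norm. *)
Definition H0 (n : nat) (sigma : R) (Om : set 'rV[R]_n) (u : 'rV[R]_n -> R) : Prop :=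
  Rn_measurable u /\
  exists phi : nat -> 'rV[R]_n -> R,
    [/\ forall k, C1c Om (phi k),
        (fun k => Igag sigma Om (phi k - u)) @ \oo --> 0%E &
        (fun k => Lint sigma Om (phi k - u)) @ \oo --> 0%E].

Definition H0_nonzero (n : nat) (sigma : R) (Om : set 'rV[R]_n) (u : 'rV[R]_n -> R) : Prop :=
  (0 < Lint sigma Om u)%E.

Definition halfspace (n : nat) : set 'rV[R]_n :=
  [set x | forall i : 'I_n, i.+1 = n -> 0 < x ord0 i].

Definition bounded_Rn (n : nat) (Om : set 'rV[R]_n) : Prop :=
  exists M : R, forall x, Om x -> enorm x <= M.

(** C^1 boundary: near each boundary point p, after a rigid change of
    coordinates y = (x - p) Q (Q orthogonal), Omega is the supergraph
    {y_i > g(y')} of a C^1 function g of the remaining coordinates. *)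
Definition C1_boundary (n : nat) (Om : set 'rV[R]_n) : Prop :=
  forall p, closure Om p -> ~ Om p ->
  exists r : R, 0 < r /\
  exists Q : 'M[R]_n, Q *m Q^T = 1%:M /\
  exists i : 'I_n, exists g : 'rV[R]_n -> R,
    [/\ C1 g,
        (forall y (t : R), g (y + t *: evec i) = g y) &
        forall x, enorm (x - p) < r ->
          (Om x <-> g ((x - p) *m Q) < ((x - p) *m Q) ord0 i)].

End FracSobolev.

(* Main.v *)
(* Write I for the Gagliardo energy, L for the integral of |u|^p with p = 2n/(n-2s), and S, S+ for the
   constants of the domain and of the half-space.

   Near an interior point the domain is a translate of a piece of the half-space, and near a boundary
   point it is, after a rotation and a shear (which preserve volume), a (1 + e)-Lipschitz image of such a
   piece.  Localizing with a partition of unity of squares summing to 1 costs only a multiple of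
   |u|_2^2, because min(1, |w|^2) / |w|^(n+2s) is integrable.  Hence for every S2 < S+
   [S2 L(u)^(2/p) <= I(u) + C |u|_2^2] on the domain.

   A minimizing sequence with I = 1 is bounded, and totally bounded in L^2: on a cube a function of small
   energy is nearly constant, and near the boundary the L^p bound controls the L^2 mass.  A subsequence
   converges in L^2 and almost everywhere to some v, and the Brezis-Lieb lemma splits I and L along
   u_k = v + g_k.  Picking terms along which these splittings are almost exact, averages of the u_k
   converge strongly to v (a Banach-Saks argument), so v belongs to the space.  If B is the limit of
   L(g_k), the inequality above with S < S2 < S+ gives
   [S2 B^(2/p) <= 1 - I(v) <= 1 - S L(v)^(2/p) <= S B^(2/p)], so B = 0 and I(v) = 1. *)

Require Import Defs.
From HB Require Import structures.
From mathcomp Require Import all_boot all_order all_algebra.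
From mathcomp Require Import all_classical all_reals all_analysis.
From mathcomp Require Import measurable_realfun ring lra zify.
Set Implicit Arguments. Unset Strict Implicit. Unset Printing Implicit Defensive.
Import Order.TTheory GRing.Theory Num.Theory.
Import numFieldNormedType.Exports.
Local Open Scope classical_set_scope.
Local Open Scope ring_scope.

(** * Lebesgue measure on row vectors *)

(** The integrals of the statement are iterated one-dimensional ones, so a measure on row vectors is
    built first and shown to be invariant under translations, shears and rotations, the only maps
    from which charts are composed. [C1] is stated by partial derivatives but has to survive
    composition with charts, hence the detour through strict differentiability. A steep boundary
    still has charts with Lipschitz constant K near 1: an orthogonal map first moves its tangent
    plane onto that of the half-space, and only the remainder, whose gradient vanishes at the point,
    is sheared away. Such a chart costs a factor K^(n+2s) in I, and K is chosen so that this factor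
    is S1/S2 for some S2 < S1 <= S+. I is a squared L^2 norm on the product space, so one
    Brezis-Lieb lemma, fed by almost everywhere convergence, splits both I and L. In the closing
    chain, the last inequality is the subadditivity of t^(2/p), where 2/p < 1, applied to L(v) + B =
    S^(-p/2). *)

Section ProductSigmaFinite.
Context d1 d2 (T1 : measurableType d1) (T2 : measurableType d2) (R : realType).
Variable m1 : {sigma_finite_measure set T1 -> \bar R}.
Variable m2 : {sigma_finite_measure set T2 -> \bar R}.
Local Open Scope ereal_scope.

Lemma product_sigma_finite : sigma_finite setT (m1 \x m2).
Proof.
have /sigma_finiteP[F [TF ndF Foo]] := sigma_finiteT m1.
have /sigma_finiteP[G [TG ndG Goo]] := sigma_finiteT m2.
exists (fun k => F k `*` G k) => [|k]; last first.
  have [mF Fk] := Foo k; have [mG Gk] := Goo k; split; first exact: measurableX.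
  by rewrite product_measure1E// lte_mul_pinfty// ge0_fin_numE.
apply/seteqP; split=> // -[x y] _.
have [i _ Fx] : (\bigcup_k F k) x by rewrite -TF.
have [j _ Gy] : (\bigcup_k G k) y by rewrite -TG.
exists (maxn i j) => //; split => /=.
- by move: x Fx; exact/subsetPset/ndF/leq_maxl.
- by move: y Gy; exact/subsetPset/ndG/leq_maxr.
Qed.

End ProductSigmaFinite.

Section LebesgueTranslation.
Context {R : realType}.
Local Open Scope ereal_scope.
Local Notation leb1 := (@lebesgue_measure R).

Let translate (c : R) (x : measurableTypeR R) : measurableTypeR R := (x + c)%R.

Let measurable_translate (c : R) : measurable_fun setT (translate c).
Proof. exact: measurable_funD. Qed.

Lemma lebesgue_measure_translate (c : R) (A : set (measurableTypeR R)) :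
  measurable A -> pushforward leb1 (translate c) A = leb1 A.
Proof.
move=> mA; have mf := measurable_translate c.
apply/esym/(@lebesgue_measure_unique R (pushforward leb1 (translate c))) => //.
move=> _ [[a b]] _ <-; rewrite /pushforward/=.
transitivity (leb1 `]a - c, b - c]%classic%R); last first.
  congr (leb1 _); apply/seteqP; split => x /=; rewrite !in_itv/= /translate; lra.
rewrite !lebesgue_measure_itv/= !lte_fin ltrD2r.
by case: ifP => // _; congr (_%:E); lra.
Qed.

Lemma integral_translate (c : R) (f : measurableTypeR R -> \bar R) :
  measurable_fun setT f -> (forall x, 0 <= f x) ->
  \int[leb1]_x f (x + c)%R = \int[leb1]_x f x.
Proof.
move=> mf f0; transitivity (\int[pushforward leb1 (translate c)]_x f x).
  by rewrite (ge0_integral_pushforward (measurable_translate c)).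
apply: eq_measure_integral => A mA _; exact: lebesgue_measure_translate.
Qed.

End LebesgueTranslation.

(** The left inverse [g] pulls the exhausting sets back, which keeps the image measure sigma-finite.
    Only the change of variables formula is exported, so that later proofs never unfold the packing
    of the structure. *)
Lemma sigma_finite_pushforward d1 d2 (T1 : measurableType d1)
    (T2 : measurableType d2) (R : realType)
    (mu : {measure set T1 -> \bar R}) (f : T1 -> T2) (g : T2 -> T1) :
  sigma_finite setT mu -> measurable_fun setT f -> measurable_fun setT g ->
  cancel f g ->
  {nu : {sigma_finite_measure set T2 -> \bar R} |
   forall h, measurable_fun setT h -> (forall x, 0 <= h x)%E ->
     (\int[nu]_x h x = \int[mu]_x h (f x))%E}.
Proof.
move=> muT mf mg fK.
pose nu : {measure set T2 -> \bar R} :=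
  measure_function_pushforward__canonical__measure_function_Measure mu mf.
have nuT : sigma_finite setT nu.
  have [F TF mF] := muT.
  exists (fun k => g @^-1` F k); first by rewrite -preimage_bigcup -TF.
  move=> k; have [mFk Fk] := mF k; split.
    by rewrite -[X in measurable X]setTI; apply: mg.
  rewrite /= /pushforward -comp_preimage (_ : g \o f = id) ?preimage_id//.
  by apply/funext => x /=; rewrite fK.
have [nu' nuE] : {nu' : {sigma_finite_measure set T2 -> \bar R} |
    forall A, nu' A = nu A}.
  move: nu nuT => nu nuT.
  pose nu' : {sigma_finite_measure set T2 -> \bar R} := HB.pack
    (Measure.sort nu)
    (isSFinite.Build _ _ _ (Measure.sort nu) (sfinite_measure_sigma_finite nuT))
    (isSigmaFinite.Build _ _ _ (Measure.sort nu) nuT).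
  by exists nu'.
exists nu' => h mh h0.
rewrite -[RHS]/(\int[mu]_(x in f @^-1` setT) (h \o f) x)%E.
rewrite -(ge0_integral_pushforward mf)//; apply: eq_measure_integral => A mA _.
exact: nuE.
Qed.

Section TupleMeasure.
Context {R : realType}.
Local Open Scope ereal_scope.
Local Notation leb1 := (@lebesgue_measure R).

Let cons_pair m (xt : measurableTypeR R * m.-tuple R) : m.+1.-tuple R :=
  cons_tuple xt.1 xt.2.

Let measurable_cons_pair m : measurable_fun setT (@cons_pair m).
Proof. exact: measurable_cons. Qed.

Let uncons_pair m (t : m.+1.-tuple R) : measurableTypeR R * m.-tuple R :=
  (thead t, [tuple of behead t]).

Let measurable_uncons_pair m : measurable_fun setT (@uncons_pair m).
Proof.
apply: measurable_fun_pair; last exact: measurable_behead.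
exact: (@measurable_tnth _ R _ ord0).
Qed.

Let cons_pairK m : cancel (@cons_pair m) (@uncons_pair m).
Proof.
by case=> x t; rewrite /uncons_pair /cons_pair/=; congr pair; apply: val_inj.
Qed.

(** By induction: the measure in dimension [m.+1] is the image under [cons] of the product of
    one-dimensional Lebesgue measure with the previous one, and Tonelli turns it into one more layer
    of [tuple_int]. With a genuine measure, the convergence theorems apply to the integrals of the
    statement. *)
Lemma tuple_measure_exists n :
  {mu : {sigma_finite_measure set (n.-tuple R) -> \bar R} |
   forall f, measurable_fun setT f -> (forall t, 0 <= f t) ->
     \int[mu]_t f t = tuple_int f}.
Proof.
elim: n => [|m [mu IH]].
  exists (\d_[tuple] : {sigma_finite_measure set (0.-tuple R) -> \bar R}).
  by move=> f mf f0; rewrite integral_dirac// diracT mul1e.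
have [nu nuE] := sigma_finite_pushforward (product_sigma_finite leb1 mu)
  (@measurable_cons_pair m) (@measurable_uncons_pair m) (@cons_pairK m).
exists nu => f mf f0; rewrite nuE//.
have mfc : measurable_fun setT (f \o @cons_pair m) by exact: (measurableT_comp mf (@measurable_cons_pair _)).
rewrite (fubini_tonelli1 (f \o @cons_pair m))//=.
apply: eq_integral => x _; rewrite -IH//.
exact: (measurableT_comp mfc (pair1_measurable x)).
Qed.

Definition tleb n : {sigma_finite_measure set (n.-tuple R) -> \bar R} :=
  sval (tuple_measure_exists n).

Lemma tlebE n (f : n.-tuple R -> \bar R) :
  measurable_fun setT f -> (forall t, 0 <= f t) ->
  \int[tleb n]_t f t = tuple_int f.
Proof. exact: (svalP (tuple_measure_exists n)). Qed.

Lemma integral_tleb_cons n (f : n.+1.-tuple R -> \bar R) :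
  measurable_fun setT f -> (forall t, 0 <= f t) ->
  [/\ \int[tleb n.+1]_t f t = \int[leb1]_x \int[tleb n]_t f (cons_tuple x t),
      \int[tleb n.+1]_t f t = \int[tleb n]_t \int[leb1]_x f (cons_tuple (x : R) t),
      forall x, measurable_fun setT (fun t => f (cons_tuple x t)) &
      forall t, measurable_fun setT (fun x : measurableTypeR R => f (cons_tuple (x : R) t))].
Proof.
move=> mf f0.
have mfc : measurable_fun setT (f \o @cons_pair n) by exact: (measurableT_comp mf (@measurable_cons_pair _)).
have mf1 x : measurable_fun setT (fun t => f (cons_tuple x t)).
  exact: (measurableT_comp mfc (pair1_measurable x)).
have mf2 t : measurable_fun setT (fun x : measurableTypeR R => f (cons_tuple (x : R) t)).
  exact: (measurableT_comp mfc (pair2_measurable t)).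
have E : \int[tleb n.+1]_t f t = \int[leb1]_x \int[tleb n]_t f (cons_tuple x t).
  by rewrite tlebE//=; apply: eq_integral => x _; rewrite tlebE.
split=> //; rewrite E.
by have := @fubini_tonelli _ _ _ _ _ leb1 (tleb n) (f \o @cons_pair n) mfc (fun=> f0 _).
Qed.

End TupleMeasure.

(** Opaque on purpose: row vectors get a display of their own, which unification cannot confuse with
    the default one. *)
Definition rv_display : measure_display -> measure_display.
Proof. exact. Qed.

Section RvMeasurable.
Context {R : realType} (n : nat).

Definition rv_measurable : set (set 'rV[R]_n) :=
  [set A | measurable (@rv_of_tuple R n @^-1` A)].

Let rv_measurable0 : rv_measurable set0.
Proof. by rewrite /rv_measurable/= preimage_set0. Qed.

Let rv_measurableC A : rv_measurable A -> rv_measurable (~` A).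
Proof. by move=> mA; rewrite /rv_measurable/= preimage_setC; exact: measurableC. Qed.

Let rv_measurable_bigcup (F : (set 'rV[R]_n)^nat) :
  (forall i, rv_measurable (F i)) -> rv_measurable (\bigcup_i F i).
Proof.
by move=> mF; rewrite /rv_measurable/= preimage_bigcup; exact: bigcupT_measurable.
Qed.

HB.instance Definition _ := @isMeasurable.Build (rv_display default_measure_display)
  'rV[R]_n rv_measurable rv_measurable0 rv_measurableC rv_measurable_bigcup.

Definition tuple_of_rv (x : 'rV[R]_n) : n.-tuple R := [tuple x ord0 i | i < n].

Lemma rv_of_tupleK : cancel (@rv_of_tuple R n) tuple_of_rv.
Proof. by move=> t; apply: eq_from_tnth => i; rewrite tnth_mktuple mxE. Qed.

Lemma tuple_of_rvK : cancel tuple_of_rv (@rv_of_tuple R n).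
Proof. by move=> x; apply/rowP => i; rewrite mxE tnth_mktuple. Qed.

Lemma measurable_rv_of_tuple : measurable_fun setT (@rv_of_tuple R n).
Proof. by move=> _ A mA; rewrite setTI. Qed.

Lemma measurable_tuple_of_rv : measurable_fun setT tuple_of_rv.
Proof.
move=> _ A mA; rewrite setTI.
rewrite /measurable/= /rv_measurable/= -comp_preimage.
rewrite (_ : _ \o _ = id) ?preimage_id//.
by apply/funext => t /=; rewrite rv_of_tupleK.
Qed.

Lemma measurable_coord (i : 'I_n) : measurable_fun setT (fun x : 'rV[R]_n => x ord0 i).
Proof.
rewrite (_ : (fun _ => _) = (fun t => tnth t i) \o tuple_of_rv); last first.
  by apply/funext => x /=; rewrite tnth_mktuple.
exact: (measurableT_comp (measurable_tnth i) measurable_tuple_of_rv).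
Qed.

Lemma measurable_rv d (T : measurableType d) (f : T -> 'rV[R]_n) :
  (forall i, measurable_fun setT (fun x => f x ord0 i)) -> measurable_fun setT f.
Proof.
move=> mf; rewrite (_ : f = @rv_of_tuple R n \o (tuple_of_rv \o f)); last first.
  by apply/funext => x /=; rewrite tuple_of_rvK.
apply: (measurableT_comp measurable_rv_of_tuple).
apply/measurable_fun_tnthP => i.
rewrite (_ : _ \o _ = fun x => f x ord0 i)//.
by apply/funext => x /=; rewrite tnth_mktuple.
Qed.

Lemma Rn_measurableE (u : 'rV[R]_n -> R) : Rn_measurable u <-> measurable_fun setT u.
Proof.
split=> [mu|mu]; last exact: (measurableT_comp mu measurable_rv_of_tuple).
rewrite (_ : u = (u \o @rv_of_tuple R n) \o tuple_of_rv); last first.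
  by apply/funext => x /=; rewrite tuple_of_rvK.
exact: (measurableT_comp mu measurable_tuple_of_rv).
Qed.

Let leb_exists := sigma_finite_pushforward (sigma_finiteT (tleb n))
  measurable_rv_of_tuple measurable_tuple_of_rv rv_of_tupleK.

Definition leb : {sigma_finite_measure set 'rV[R]_n -> \bar R} := sval leb_exists.

Lemma integral_leb (f : 'rV[R]_n -> \bar R) :
  measurable_fun setT f -> (forall t, 0 <= f t)%E ->
  (\int[leb]_x f x = \int[tleb n]_t f (rv_of_tuple t))%E.
Proof. exact: (svalP leb_exists). Qed.

Lemma lebE (f : 'rV[R]_n -> \bar R) :
  measurable_fun setT f -> (forall t, 0 <= f t)%E ->
  (Rn_int f = \int[leb]_x f x)%E.
Proof.
by move=> mf f0; rewrite integral_leb// tlebE//.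
Qed.

End RvMeasurable.
Arguments leb {R} n.

(** * Invariance of Lebesgue measure under shears and translations *)

Section Shear.
Context {R : realType}.
Local Open Scope ereal_scope.

Let tshift n (i : 'I_n) (s : R) (t : n.-tuple R) : n.-tuple R :=
  [tuple if j == i then (tnth t j + s)%R else tnth t j | j < n].

Let tshift_cons0 n s x (t : n.-tuple R) :
  tshift ord0 s (cons_tuple x t) = cons_tuple (x + s)%R t.
Proof.
apply: eq_from_tnth => j; rewrite tnth_mktuple.
have [->|/negbTE j0] := eqVneq j ord0; first by rewrite !tnth0.
by have [k ->|jE] := unliftP ord0 j; [rewrite !tnthS | rewrite jE eqxx in j0].
Qed.

Let tshift_consS n (i : 'I_n) s x (t : n.-tuple R) :
  tshift (lift ord0 i) s (cons_tuple x t) = cons_tuple x (tshift i s t).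
Proof.
apply: eq_from_tnth => j; rewrite tnth_mktuple.
have [k ->|->] := unliftP ord0 j; last by rewrite !tnth0.
by rewrite !tnthS tnth_mktuple (inj_eq lift_inj).
Qed.

Let measurable_tshift n (i : 'I_n) (h : n.-tuple R -> R) :
  measurable_fun setT h -> measurable_fun setT (fun t => tshift i (h t) t).
Proof.
move=> mh; apply/measurable_fun_tnthP => j.
rewrite (_ : _ \o _ = fun t => if j == i then (tnth t j + h t)%R else tnth t j).
  case: (j == i); last exact: measurable_tnth.
  by apply: measurable_funD => //; exact: measurable_tnth.
by apply/funext => t /=; rewrite tnth_mktuple.
Qed.

(** Induction on the dimension, with both orders of integration. If [i] is a later coordinate, the
    head is frozen and the induction hypothesis acts on the tail; if [i] is the head, the tail is
    frozen, [h] becomes a constant, and one-dimensional translation invariance concludes. *)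
Let integral_tshift n (i : 'I_n) (h : n.-tuple R -> R) (f : n.-tuple R -> \bar R) :
  measurable_fun setT h -> (forall s t, h (tshift i s t) = h t) ->
  measurable_fun setT f -> (forall t, 0 <= f t) ->
  \int[tleb n]_t f (tshift i (h t) t) = \int[tleb n]_t f t.
Proof.
elim: n i h f => [|n IH] i h f mh hE mf f0; first by case: i hE.
have mfi := measurableT_comp mf (measurable_tshift i mh).
have [E1 E2 m1 m2] := integral_tleb_cons mfi (fun=> f0 _).
have [F1 F2 n1 n2] := integral_tleb_cons mf f0.
have [j iE|iE] := unliftP ord0 i; subst i.
  rewrite [LHS]E1 F1; apply: eq_integral => x _.
  rewrite -(IH j (fun t => h (cons_tuple x t)) (fun t => f (cons_tuple x t)))//.
  - by apply: eq_integral => t _ /=; rewrite tshift_consS.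
  - apply: (measurableT_comp mh).
    by apply: (@measurable_cons _ _ _ R); [exact: measurable_cst|exact: measurable_id].
  - by move=> s t; rewrite -tshift_consS hE.
rewrite [LHS]E2 F2; apply: eq_integral => t _.
rewrite -[RHS](integral_translate (h (cons_tuple 0%R t)))//.
apply: eq_integral => x _ /=; rewrite tshift_cons0; congr (f (cons_tuple _ _)); congr (_ + _)%R.
by rewrite -(hE x (cons_tuple 0%R t)) tshift_cons0 add0r.
Qed.

Lemma measurable_rvZ n d (T : measurableType d) (h : T -> R) (v : 'rV[R]_n) :
  measurable_fun setT h -> measurable_fun setT (fun y => h y *: v).
Proof.
move=> mh; apply: measurable_rv => i.
rewrite (_ : (fun _ => _) = (fun y => h y * v ord0 i)%R); last first.
  by apply/funext => y; rewrite mxE.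
by apply: measurable_funM => //; exact: measurable_cst.
Qed.

Lemma measurable_rvD n d (T : measurableType d) (f g : T -> 'rV[R]_n) :
  measurable_fun setT f -> measurable_fun setT g ->
  measurable_fun setT (fun y => f y + g y)%R.
Proof.
move=> mf mg; apply: measurable_rv => i.
rewrite (_ : (fun _ => _) = (fun y => f y ord0 i + g y ord0 i)%R); last first.
  by apply/funext => y; rewrite mxE.
apply: measurable_funD; apply: (measurableT_comp (measurable_coord i)) => //.
Qed.

(* The shear [y |-> y + h y e_i] is volume preserving when [h] does not depend
   on the [i]-th coordinate. *)
Lemma integral_shear n (i : 'I_n) (h : 'rV[R]_n -> R) (f : 'rV[R]_n -> \bar R) :
  measurable_fun setT h -> (forall y s, h (y + s *: evec i)%R = h y) ->
  measurable_fun setT f -> (forall t, 0 <= f t) ->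
  \int[leb n]_y f (y + h y *: evec i)%R = \int[leb n]_y f y.
Proof.
move=> mh hE mf f0.
have tE s (t : n.-tuple R) :
    rv_of_tuple (tshift i s t) = (rv_of_tuple t + s *: evec i)%R.
  apply/rowP => j; rewrite !mxE tnth_mktuple eqxx/=.
  by case: eqP => _; rewrite ?mulr1 ?mulr0 ?addr0.
have mfs : measurable_fun setT (fun y : 'rV[R]_n => f (y + h y *: evec i)%R).
  apply: (measurableT_comp mf); apply: measurable_rvD; first exact: measurable_id.
  exact: measurable_rvZ.
rewrite !integral_leb//.
rewrite -[RHS](@integral_tshift n i (h \o @rv_of_tuple R n) (f \o @rv_of_tuple R n))//.
- by apply: eq_integral => t _ /=; rewrite tE.
- by move=> s t /=; rewrite tE hE.
- by move=> t /=.
Qed.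

Lemma measurable_shift n (a : 'rV[R]_n) : measurable_fun setT (fun x : 'rV[R]_n => x + a)%R.
Proof. by apply: measurable_rvD; [exact: measurable_id|exact: measurable_cst]. Qed.

Lemma integral_shift n (a : 'rV[R]_n) (f : 'rV[R]_n -> \bar R) :
  measurable_fun setT f -> (forall t, 0 <= f t) ->
  \int[leb n]_y f (y + a)%R = \int[leb n]_y f y.
Proof.
(* A translation is composed of [n] shears of constant height. *)
have -> : a = (\sum_(i < n) a ord0 i *: evec i)%R.
  rewrite [LHS]row_sum_delta; apply: eq_bigr => i _; congr (_ *: _).
elim/big_ind : _ f => [|u v IHu IHv|i _] f mf f0.
- by under eq_integral do rewrite addr0.
- under eq_integral do rewrite addrA.
  rewrite (IHu (fun y : 'rV[R]_n => f (y + v)%R))// ?IHv//.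
  exact: (measurableT_comp mf (measurable_shift v)).
- by rewrite (integral_shear (h := cst (a ord0 i)))//; exact: measurable_cst.
Qed.

End Shear.

(** * The Euclidean norm *)

Section Enorm.
Context {R : realType} (n : nat).
Implicit Types (x y : 'rV[R]_n) (r : R).

Definition dot x y : R := \sum_(i < n) x ord0 i * y ord0 i.

Lemma dotC x y : dot x y = dot y x.
Proof. by apply: eq_bigr => i _; rewrite mulrC. Qed.

Lemma dotDl x y z : dot (x + y) z = dot x z + dot y z.
Proof. by rewrite /dot -big_split; apply: eq_bigr => i _; rewrite mxE mulrDl. Qed.

Lemma dotZl a x y : dot (a *: x) y = a * dot x y.
Proof. by rewrite /dot mulr_sumr; apply: eq_bigr => i _; rewrite mxE mulrA. Qed.

Lemma dotNl x y : dot (- x) y = - dot x y.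
Proof. by rewrite -scaleN1r dotZl mulN1r. Qed.

Lemma dotDr x y z : dot z (x + y) = dot z x + dot z y.
Proof. by rewrite dotC dotDl !(dotC z). Qed.

Lemma dotZr a x y : dot y (a *: x) = a * dot y x.
Proof. by rewrite dotC dotZl (dotC y). Qed.

Lemma dotNr x y : dot y (- x) = - dot y x.
Proof. by rewrite dotC dotNl (dotC y). Qed.

Lemma dot_ge0 x : 0 <= dot x x.
Proof. by apply: sumr_ge0 => i _; rewrite -expr2 sqr_ge0. Qed.

Lemma enormE x : enorm x = Num.sqrt (dot x x).
Proof. by congr Num.sqrt; apply: eq_bigr => i _; rewrite expr2. Qed.

Lemma enorm_ge0 x : 0 <= enorm x.
Proof. exact: sqrtr_ge0. Qed.

Lemma enorm_sqr x : enorm x ^+ 2 = dot x x.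
Proof. by rewrite enormE sqr_sqrtr// dot_ge0. Qed.

Lemma enorm0 : enorm (0 : 'rV[R]_n) = 0.
Proof.
rewrite enormE /dot big1 ?sqrtr0// => i _.
by rewrite mxE mulr0.
Qed.

Lemma enorm_eq0 x : (enorm x == 0) = (x == 0).
Proof.
apply/idP/idP => [/eqP x0|/eqP->]; last by rewrite enorm0.
have /eqP : dot x x = 0 by rewrite -enorm_sqr x0 expr0n.
rewrite psumr_eq0 => [/allP xi|i _]; last by rewrite -expr2 sqr_ge0.
apply/eqP/rowP => i; rewrite mxE; apply/eqP.
by have := xi i (mem_index_enum _); rewrite /= mulf_eq0 orbb.
Qed.

Lemma enormZ a x : enorm (a *: x) = `|a| * enorm x.
Proof.
by rewrite !enormE dotZl dotZr mulrA -expr2 sqrtrM ?sqr_ge0// sqrtr_sqr.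
Qed.

Lemma enormN x : enorm (- x) = enorm x.
Proof. by rewrite -scaleN1r enormZ normrN1 mul1r. Qed.

Lemma enormBC x y : enorm (x - y) = enorm (y - x).
Proof. by rewrite -enormN opprB. Qed.

Lemma dot_le_enorm x y : dot x y <= enorm x * enorm y.
Proof.
have [->|y0] := eqVneq y 0.
  by rewrite enorm0 mulr0 /dot big1// => i _; rewrite mxE mulr0.
have yy0 : 0 < dot y y.
  rewrite -enorm_sqr exprn_gt0// lt_neqAle enorm_ge0 andbT eq_sym.
  by rewrite enorm_eq0.
(* Cauchy-Schwarz: this squared norm is [dot y y] times the Gram determinant of [x] and [y]. *)
have := dot_ge0 (dot y y *: x - dot x y *: y).
rewrite !(dotDl, dotDr, dotNl, dotNr, dotZl, dotZr) (dotC y x) => h.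
have {h} : 0 <= dot y y * (dot x x * dot y y - dot x y ^+ 2).
  by apply: le_trans h _; rewrite le_eqVlt; apply/orP; left; apply/eqP; ring.
rewrite pmulr_rge0// subr_ge0 -!enorm_sqr -exprMn => h.
have [d0|d0] := leP 0 (dot x y); last first.
  by apply: (le_trans (ltW d0)); rewrite mulr_ge0// enorm_ge0.
by rewrite -(@ler_pXn2r _ 2)// nnegrE mulr_ge0// enorm_ge0.
Qed.

Lemma ler_enormD x y : enorm (x + y) <= enorm x + enorm y.
Proof.
rewrite -(@ler_pXn2r _ 2)// ?nnegrE ?addr_ge0 ?enorm_ge0//.
rewrite enorm_sqr dotDl !dotDr sqrrD -!enorm_sqr (dotC y x).
by have := dot_le_enorm x y; lra.
Qed.

Lemma ler_enormB x y z : enorm (x - z) <= enorm (x - y) + enorm (y - z).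
Proof. by rewrite (_ : x - z = (x - y) + (y - z)) ?ler_enormD// addrA subrK. Qed.

Lemma ler_coord_enorm x i : `|x ord0 i| <= enorm x.
Proof.
rewrite -sqrtr_sqr; apply: ler_wsqrtr; rewrite (bigD1 i)//= lerDl.
by apply: sumr_ge0 => j _; rewrite sqr_ge0.
Qed.

Lemma enorm_le_bound x r : 0 <= r -> (forall i, `|x ord0 i| <= r) ->
  enorm x <= n%:R * r.
Proof.
move=> r0 xr; rewrite -(@ler_pXn2r _ 2)// ?nnegrE ?enorm_ge0 ?mulr_ge0//.
rewrite enorm_sqr; apply: (@le_trans _ _ (\sum_(i < n) (r ^+ 2 : R))).
  apply: ler_sum => i _; rewrite -expr2 -real_normK ?num_real//.
  by rewrite ler_pXn2r// nnegrE.
rewrite sumr_const card_ord -[leLHS]mulr_natl exprMn; apply: ler_wpM2r; rewrite ?sqr_ge0//.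
by rewrite -natrX ler_nat; case: n => // m; rewrite expnS expn1 leq_pmulr.
Qed.

Lemma evecE (i j : 'I_n) : evec i ord0 j = (j == i)%:R :> R.
Proof. by rewrite mxE eqxx. Qed.

Lemma enorm_evec i : enorm (evec i : 'rV[R]_n) = 1.
Proof.
rewrite /enorm (bigD1 i)//= evecE eqxx expr1n big1 ?addr0 ?sqrtr1// => j ji.
by rewrite evecE (negbTE ji) expr0n.
Qed.

Lemma dot_mulmx (Q : 'M[R]_n) x y : dot (x *m Q) y = dot x (y *m Q^T).
Proof.
have dotE (u v : 'rV[R]_n) : dot u v = (u *m v^T) ord0 ord0.
  by rewrite mxE; apply: eq_bigr => i _; rewrite [v^T _ _]mxE.
by rewrite !dotE trmx_mul trmxK mulmxA.
Qed.

Lemma enorm_rot (Q : 'M[R]_n) x : Q *m Q^T = 1%:M -> enorm (x *m Q) = enorm x.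
Proof. by move=> QQ; rewrite !enormE dot_mulmx -mulmxA QQ mulmx1. Qed.

Lemma measurable_enorm : measurable_fun setT (@enorm R n).
Proof.
apply: (measurableT_comp (@continuous_measurable_fun _ _ (@sqrt_continuous R))).
apply: measurable_sum => i.
by apply: measurable_funX; exact: measurable_coord.
Qed.

Lemma measurable_mulmx (Q : 'M[R]_n) : measurable_fun setT (mulmx^~ Q : 'rV[R]_n -> 'rV[R]_n).
Proof.
apply: measurable_rv => i.
rewrite (_ : (fun _ => _) = (fun x : 'rV[R]_n => \sum_j x ord0 j * Q j i)).
  apply: measurable_sum => j; apply: measurable_funM; first exact: measurable_coord.
  exact: measurable_cst.
by apply/funext => x; rewrite mxE.
Qed.

End Enorm.

Lemma integral_indicT d (T : measurableType d) (R : realType)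
    (mu : {measure set T -> \bar R}) (A : set T) : measurable A ->
  (\int[mu]_x (\1_A x)%:E = mu A)%E.
Proof. by move=> mA; rewrite integral_indic// setIT. Qed.

(** * Measure of cubes and balls, and invariance under rotations *)

Section CubeRotation.
Context {R : realType}.
Local Open Scope ereal_scope.
Local Notation leb1 := (@lebesgue_measure R).

Let measurable_tcube n (J : 'I_n -> set R) :
  (forall i, measurable (J i)) ->
  measurable [set t : n.-tuple R | forall i, J i (tnth t i)].
Proof.
move=> mJ.
rewrite (_ : [set t | _] = \bigcap_(i in setT) ((fun t => tnth t i) @^-1` J i)).
  apply: fin_bigcap_measurable => // i _.
  by rewrite -[X in measurable X]setTI; apply: measurable_tnth.
by apply/seteqP; split => t Jt i; [move=> _; exact: Jt|exact: (Jt i)].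
Qed.

Let tleb_cube n (J : 'I_n -> set R) (c : R) : (0 <= c)%R ->
  (forall i, measurable (J i)) -> (forall i, leb1 (J i) = c%:E) ->
  tleb n [set t | forall i, J i (tnth t i)] = (c ^+ n)%:E.
Proof.
move=> c0; elim: n J => [|n IH] J mJ JE.
  have -> : [set t : 0.-tuple R | forall i, J i (tnth t i)] = setT.
    by apply/seteqP; split=> // t _ [].
  rewrite -[LHS]mul1e -integral_cst// tlebE//.
have mA := measurable_tcube mJ; set A := [set t | _] in mA *.
pose A' := [set t : n.-tuple R | forall i, J (lift ord0 i) (tnth t i)].
have mA' : measurable A' by apply: (measurable_tcube (J := fun i => J (lift ord0 i))).
have A'E : \int[tleb n]_t (\1_A' t)%:E = (c ^+ n)%:E.
  by rewrite integral_indicT//; exact: (IH (fun i => J (lift ord0 i))).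
rewrite -[LHS]integral_indicT//.
have [||-> _ _ _] := @integral_tleb_cons R n (fun t => (\1_A t)%:E).
- exact/measurable_EFinP/measurable_indic.
- by move=> t; rewrite lee_fin.
have -> : \int[leb1]_x \int[tleb n]_t (\1_A (cons_tuple x t))%:E =
          \int[leb1]_x ((c ^+ n)%:E * (\1_(J ord0) x)%:E).
  apply: eq_integral => x _.
  have AE t : \1_A (cons_tuple x t) = (\1_(J ord0) x * \1_A' t)%R :> R.
    rewrite !indicE -natrM mulnb; congr (nat_of_bool _)%:R; apply/idP/andP.
      rewrite !inE => At; split; first by have := At ord0; rewrite tnth0.
      by move=> i; have := At (lift ord0 i); rewrite tnthS.
    rewrite !inE => -[J0 At] i.
    by have [j ->|->] := unliftP ord0 i; rewrite ?tnthS ?tnth0.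
  under eq_integral do rewrite AE EFinM.
  rewrite ge0_integralZl//; last exact/measurable_EFinP/measurable_indic.
  by rewrite A'E muleC.
rewrite ge0_integralZl//; last 2 first.
- by apply/measurable_EFinP; apply: measurable_indic; exact: mJ.
- by rewrite lee_fin exprn_ge0.
rewrite exprSr EFinM -(JE ord0); congr (_ * _).
exact: (integral_indicT leb1 (mJ ord0)).
Qed.

Definition cube n (J : 'I_n -> set R) : set 'rV[R]_n :=
  [set x | forall i, J i (x ord0 i)].

Lemma measurable_cube n (J : 'I_n -> set R) :
  (forall i, measurable (J i)) -> measurable (cube J).
Proof.
move=> /measurable_tcube mJ; rewrite /measurable/= /rv_measurable/=.
congr (measurable _) : mJ.
by apply/seteqP; split => t /= Jt i; have := Jt i; rewrite mxE.
Qed.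

Lemma leb_cube n (J : 'I_n -> set R) (c : R) : (0 <= c)%R ->
  (forall i, measurable (J i)) -> (forall i, leb1 (J i) = c%:E) ->
  leb n (cube J) = (c ^+ n)%:E.
Proof.
move=> c0 mJ JE; have mC := measurable_cube mJ.
rewrite -[LHS]integral_indicT// integral_leb//; last first.
  exact/measurable_EFinP/measurable_indic.
rewrite -(tleb_cube c0 mJ JE) -[RHS]integral_indicT//; last exact: measurable_tcube.
apply: eq_integral => t _; congr (_%:E); rewrite !indicE; congr (nat_of_bool _)%:R.
by apply/idP/idP; rewrite !inE => Jt i; have := Jt i; rewrite mxE.
Qed.

Definition eball n (a : 'rV[R]_n) (r : R) : set 'rV[R]_n :=
  [set x | (enorm (x - a) < r)%R].

Lemma measurable_eball n (a : 'rV[R]_n) r : measurable (eball a r).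
Proof.
have : measurable_fun setT (fun x : 'rV[R]_n => enorm (x - a)).
  exact: (measurableT_comp (@measurable_enorm R n) (measurable_shift (- a))).
move=> mf; rewrite -[X in measurable X]setTI.
have -> : eball a r = (fun x : 'rV[R]_n => enorm (x - a)) @^-1` `]-oo, r[%classic.
  by apply/seteqP; split => x /=; rewrite in_itv.
exact: mf.
Qed.

Lemma leb_eball_le n (r : R) : (0 <= r)%R ->
  leb n (eball 0%R r) <= ((2 * r) ^+ n)%:E.
Proof.
move=> r0; rewrite -(@leb_cube n (fun=> `[-r, r]%classic)%R) ?mulr_ge0//; last first.
  by move=> _; rewrite lebesgue_measure_itv/= lte_fin -EFinD; case: ifP => h; congr (_%:E); lra.
apply: le_measure; rewrite ?inE//.
- exact: measurable_eball.
- by apply: measurable_cube => i; exact: measurable_itv.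
move=> x; rewrite /eball/= subr0 => xr i /=; rewrite in_itv/=.
have := ler_coord_enorm x i; have := ler_norm (x ord0 i); have := ler_norm (- x ord0 i)%R.
by rewrite normrN; lra.
Qed.

Lemma leb_eball_gt0 n (r : R) : (0 < r)%R -> 0 < leb n (eball 0%R r).
Proof.
move=> r0; pose s := (r / (n.+1%:R))%R.
have s0 : (0 < s)%R by rewrite divr_gt0.
apply: (@lt_le_trans _ _ (leb n (cube (fun=> `[0, s]%classic)%R))).
  rewrite (@leb_cube n _ s) ?(ltW s0)//; first by rewrite lte_fin exprn_gt0.
  by move=> _; rewrite lebesgue_measure_itv/= lte_fin s0 sube0.
apply: le_measure; rewrite ?inE//.
- by apply: measurable_cube => i; exact: measurable_itv.
- exact: measurable_eball.
move=> x /= xs; rewrite /eball/= subr0.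
apply: (@le_lt_trans _ _ (n%:R * s)%R).
  apply: enorm_le_bound; first exact: ltW.
  by move=> i; have := xs i; rewrite /= in_itv/= => /andP[x0 xs']; rewrite ger0_norm.
by rewrite /s mulrA ltr_pdivrMr// mulrC ltr_pM2l// ltr_nat.
Qed.

Lemma integral_rot n (Q : 'M[R]_n) (f : 'rV[R]_n -> \bar R) :
  Q *m Q^T = 1%:M -> measurable_fun setT f -> (forall x, 0 <= f x) ->
  \int[leb n]_y f (y *m Q) = \int[leb n]_y f y.
Proof.
(* Uniqueness of translation invariant measures: with g the indicator of the
   unit ball, both sides times [\int g] equal [\int\int g(yQ) f(x + yQ)]. *)
move=> QQ mf f0.
have QTQ : Q^T *m Q = 1%:M by exact: mulmx1C.
pose B : set 'rV[R]_n := eball 0%R 1; pose g (x : 'rV[R]_n) : \bar R := (\1_B x)%:E.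
have mB : measurable B by exact: measurable_eball.
have mg : measurable_fun setT g by exact/measurable_EFinP/measurable_indic.
have g0 x : 0 <= g x by rewrite lee_fin.
have BE x : B x = (enorm x < 1)%R :> Prop by rewrite /B /eball/= subr0.
have gE x y : enorm x = enorm y -> g x = g y.
  move=> xy; congr (_%:E); rewrite !indicE; congr (nat_of_bool _)%:R.
  by apply/idP/idP; rewrite !inE !BE xy.
have mQ := @measurable_mulmx R n Q.
pose G := \int[leb n]_x g x.
have GE : G = leb n B by exact: integral_indicT.
have G0 : 0 < G by rewrite GE leb_eball_gt0.
have Gfin : G \is a fin_num.
  rewrite ge0_fin_numE ?ltW// GE (le_lt_trans (leb_eball_le n ler01))//.
  by rewrite ltry.
have mfs : measurable_fun setT f := mf.
pose F (z : 'rV[R]_n * 'rV[R]_n) := g (z.2 *m Q) * f (z.1 + z.2 *m Q)%R.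
have m2Q : measurable_fun setT (fun z : 'rV[R]_n * 'rV[R]_n => z.2 *m Q).
  exact: (measurableT_comp mQ measurable_snd).
have mF : measurable_fun setT F.
  apply: emeasurable_funM; first exact: (measurableT_comp mg m2Q).
  apply: (measurableT_comp mf).
  by apply: measurable_rvD => //; exact: measurable_fst.
have F0 z : 0 <= F z by apply: mule_ge0.
have mfQ : measurable_fun setT (fun y => f (y *m Q)) by exact: (measurableT_comp mf mQ).
have mgQ : measurable_fun setT (fun y => g (y *m Q)) by exact: (measurableT_comp mg mQ).
have E1 : \int[leb n]_y \int[leb n]_x F (x, y) = G * \int[leb n]_x f x.
  under eq_integral => y _.
    rewrite /F/= ge0_integralZl//; last exact: (measurableT_comp mf (measurable_shift _)).
    rewrite (integral_shift _ mf f0) (gE _ y); last exact: enorm_rot.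
    over.
  by rewrite ge0_integralZr//; apply: integral_ge0.
have E2 : \int[leb n]_x \int[leb n]_y F (x, y) = G * \int[leb n]_y f (y *m Q).
  (* For fixed [x], translating [y] by [x *m Q^T] turns [H] into [F]. In [H] the variable [x] occurs
     in the indicator of the ball alone, so that its integral over [x] is [G]. *)
  pose H (z : 'rV[R]_n * 'rV[R]_n) := g (z.2 *m Q - z.1)%R * f (z.2 *m Q).
  have mH : measurable_fun setT H.
    apply: emeasurable_funM; last exact: (measurableT_comp mf m2Q).
    apply: (measurableT_comp mg); apply: measurable_rvD => //.
    rewrite (_ : (fun _ => _) = (fun z : 'rV[R]_n * 'rV[R]_n => (-1)%R *: z.1)); last first.
      by apply/funext => z; rewrite scaleN1r.
    apply: measurable_rv => i.
    rewrite (_ : (fun _ => _) = (fun z : 'rV[R]_n * 'rV[R]_n => (-1) * z.1 ord0 i)%R); last first.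
      by apply/funext => z; rewrite mxE.
    apply: measurable_funM; first exact: measurable_cst.
    exact: (measurableT_comp (measurable_coord i) measurable_fst).
  have H0 z : 0 <= H z by apply: mule_ge0.
  transitivity (\int[leb n]_x \int[leb n]_y H (x, y)).
    apply: eq_integral => x _.
    have mHx : measurable_fun setT (fun y => H (x, y)).
      exact: (measurableT_comp mH (pair1_measurable x)).
    rewrite -[RHS](integral_shift (x *m Q^T) mHx (fun=> H0 _)).
    apply: eq_integral => y _; rewrite /F /H/=.
    by rewrite mulmxDl -mulmxA QTQ mulmx1 addrK addrC.
  rewrite (fubini_tonelli H mH)//.
  under eq_integral => y _.
    rewrite /H/= ge0_integralZr//; last first.
      have -> : (fun x => g (y *m Q - x)%R) = (fun x => g (x - y *m Q)%R).
        by apply/funext => x; apply: gE; rewrite enormBC.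
      exact: (measurableT_comp mg (measurable_shift _)).
    have -> : \int[leb n]_x g (y *m Q - x)%R = G.
      rewrite /G -[RHS](integral_shift (- (y *m Q))%R mg g0).
      by apply: eq_integral => x _; apply: gE; rewrite enormBC.
    over.
  by rewrite ge0_integralZl//; exact: ltW.
have : G * \int[leb n]_y f (y *m Q) = G * \int[leb n]_y f y.
  by rewrite -E2 -E1; exact: fubini_tonelli.
move=> /(congr1 (fun z => (fine G)^-1%:E * z)).
have GG : (fine G)^-1%:E * G = 1.
  by rewrite -[G in _ * G]fineK// -EFinM mulVf// gt_eqF// fine_gt0// G0 ltey_eq Gfin.
by rewrite !muleA GG !mul1e.
Qed.

End CubeRotation.

(** * Topology and differential calculus on row vectors *)

Section RvTopology.
Context {R : realType} (n : nat).
Implicit Types (x y : 'rV[R]_n) (r : R).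

Lemma ler_mx_norm_enorm x : `|x| <= enorm x.
Proof.
rewrite [leLHS]/Num.norm/= mx_normrE; apply/bigmax_leP; split; first exact: enorm_ge0.
by move=> [i j] _ /=; rewrite (ord1 i) ler_coord_enorm.
Qed.

Lemma ler_enorm_mx_norm x : enorm x <= n%:R * `|x|.
Proof.
apply: enorm_le_bound => // i; rewrite [leRHS]/Num.norm/= mx_normrE.
by apply: le_trans (le_bigmax _ _ (ord0, i)).
Qed.

Lemma nbhs_eballP x (A : set 'rV[R]_n) :
  nbhs x A <-> exists2 d : R, 0 < d & eball x d `<=` A.
Proof.
split=> [/nbhs_ballP[d /= d0 dA]|[d d0 dA]].
  exists d => // y yd; apply: dA; rewrite mx_norm_ball /ball_/= distrC.
  exact: le_lt_trans (ler_mx_norm_enorm _) yd.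
(* The Euclidean norm is at most [n] times the sup norm; [n.+1] keeps the radius positive in
   dimension 0 as well. *)
apply/nbhs_ballP; exists (d / n.+1%:R) => /=; first by rewrite divr_gt0.
move=> y; rewrite mx_norm_ball /ball_/= distrC => yd; apply: dA.
apply: (@le_lt_trans _ _ (n%:R * `|y - x|)); first exact: ler_enorm_mx_norm.
apply: (@le_lt_trans _ _ (n.+1%:R * `|y - x|)).
  by rewrite ler_wpM2r// ler_nat.
by rewrite mulrC -ltr_pdivlMr.
Qed.

Lemma open_eball x r : open (eball x r).
Proof.
rewrite openE => y /= yr; apply/nbhs_eballP; exists (r - enorm (y - x)).
  by rewrite subr_gt0.
move=> z /= zy; rewrite /eball/=; have := ler_enormB z y x.
by rewrite /eball/= in zy *; lra.
Qed.

Lemma openP_eball (A : set 'rV[R]_n) x :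
  open A -> A x -> exists2 d : R, 0 < d & eball x d `<=` A.
Proof. by move=> oA Ax; apply/nbhs_eballP; exact: open_nbhs_nbhs. Qed.

Lemma closureP_eball (A : set 'rV[R]_n) x :
  closure A x <-> forall d : R, 0 < d -> exists2 y, A y & enorm (y - x) < d.
Proof.
split=> [cA d d0|cA B /nbhs_eballP[d d0 dB]].
  have /cA[y [Ay yd]] : nbhs x (eball x d) by apply/nbhs_eballP; exists d.
  by exists y.
by have [y Ay yd] := cA _ d0; exists y; split=> //; exact: dB.
Qed.

Lemma compact_enorm (A : set 'rV[R]_n) (M : R) :
  closed A -> (forall x, A x -> enorm x <= M) -> compact A.
Proof.
move=> cA AM; apply: bounded_closed_compact => //.
exists M; split; first exact: num_real.
move=> N MN x Ax; apply: le_trans (ltW MN).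
exact: le_trans (ler_mx_norm_enorm _) (AM x Ax).
Qed.

Lemma continuous_eballP (f : 'rV[R]_n -> R) x :
  {for x, continuous f} <->
  forall e : R, 0 < e -> exists2 d : R, 0 < d &
    forall y, enorm (y - x) < d -> `|f y - f x| < e.
Proof.
split=> [/cvgrPdist_lt cf e e0|cf].
  have /nbhs_eballP[d d0 dP] := cf _ e0; exists d => // y yd.
  by rewrite distrC; exact: dP.
apply/(@cvgrPdist_lt _ _ _ (nbhs x) (nbhs_filter x)) => e e0; apply/nbhs_eballP.
have [d d0 dP] := cf _ e0; exists d => // y yd /=.
by rewrite distrC; exact: dP.
Qed.

(** The sigma-algebra is generated by the coordinates and not by the topology. An open set is the
    union of the countably many rational cubes [Q q] that it contains. *)
Lemma open_measurable_rv (A : set 'rV[R]_n) : open A -> measurable A.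
Proof.
move=> oA.
pose Q (q : 'rV[rat]_n * nat) : set 'rV[R]_n := cube (fun i : 'I_n =>
  `]ratr (q.1 ord0 i) - q.2.+1%:R^-1, ratr (q.1 ord0 i) + q.2.+1%:R^-1[%classic : set R).
have mQ q : measurable (Q q) by apply: measurable_cube => i; exact: measurable_itv.
pose F q := if pselect (Q q `<=` A) then Q q else set0.
have -> : A = \bigcup_q F q; last first.
  apply: countable_bigcupT_measurable => //.
  move=> q; rewrite /F; case: pselect => _ /=; first exact: mQ.
  exact: measurable0.
apply/seteqP; split=> [x Ax|x [q _]]; last first.
  by rewrite /F; case: pselect => //= QA; exact: QA.
have [d d0 dA] := openP_eball oA Ax.
(* If each coordinate of the centre is within [1 / (k+1)] of that of [x], the points of the cube of
   half-width [1 / (k+1)] are within [2 n / (k+1) < d] of [x]. *)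
pose k := Num.truncn (2 * n.+1%:R / d).
have k0 : 2 * n.+1%:R / d < k.+1%:R by apply: truncnS_gt; rewrite ?divr_ge0 ?mulr_ge0// ltW.
have q_ i : exists q : rat, `|x ord0 i - ratr q| < k.+1%:R^-1.
  have : x ord0 i - k.+1%:R^-1 < x ord0 i + k.+1%:R^-1.
    by rewrite ltrD2l gt0_cp// ?invr_gt0.
  move=> /rat_in_itvoo[q]; rewrite in_itv/= => /andP[h1 h2]; exists q.
  by rewrite ltr_distlC h1 h2.
pose q : 'rV[rat]_n := \row_i projT1 (cid (q_ i)).
have qx i : `|x ord0 i - ratr (q ord0 i)| < k.+1%:R^-1.
  by rewrite mxE; case: cid.
have Qx : Q (q, k) x.
  by move=> i; rewrite /= in_itv/= -ltr_distl.
have QA : Q (q, k) `<=` A.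
  move=> y Qy; apply: dA; rewrite /eball/=.
  apply: (@le_lt_trans _ _ (n%:R * (2 * k.+1%:R^-1))).
    apply: enorm_le_bound; first by rewrite mulr_ge0// invr_ge0.
    move=> i; rewrite !mxE; have := Qy i; rewrite /= in_itv/= -ltr_distl => yq.
    have := ler_distD (ratr (q ord0 i)) (y ord0 i) (x ord0 i).
    rewrite (distrC (ratr _)); have := qx i; move: yq.
    by move: (k.+1%:R^-1) => K; lra.
  apply: (@le_lt_trans _ _ (n.+1%:R * (2 * k.+1%:R^-1))).
    by rewrite ler_wpM2r ?mulr_ge0 ?invr_ge0// ler_nat.
  by move: k0; rewrite mulrA !ltr_pdivrMr// => k0; rewrite mulrC (mulrC d).
exists (q, k) => //; rewrite /F; case: pselect => //.
Qed.

Lemma continuous_measurable_rv (f : 'rV[R]_n -> R) :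
  continuous f -> measurable_fun setT f.
Proof.
move=> cf; apply: (measurability _ (RGenOpens.measurableE R)) => //.
move=> _ [_ [a [b ->] <-]]; rewrite setTI; apply: open_measurable_rv.
by apply: open_comp => // x _; exact: cf.
Qed.

End RvTopology.

Section StrictDifferentiability.
Context {R : realType} (n : nat).
Implicit Types (x y z g : 'rV[R]_n) (f : 'rV[R]_n -> R).

(* Strict differentiability at every point is equivalent to [C1] and, unlike
   [C1], it is stable under composition by elementary estimates. *)
Definition sdiff f x g := forall e : R, 0 < e -> exists2 d : R, 0 < d &
  forall y z, enorm (y - x) < d -> enorm (z - x) < d ->
    `|f y - f z - dot g (y - z)| <= e * enorm (y - z).

Definition sdiff1 (phi : R -> R) (t c : R) := forall e : R, 0 < e ->
  exists2 d : R, 0 < d & forall r s, `|r - t| < d -> `|s - t| < d ->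
    `|phi r - phi s - c * (r - s)| <= e * `|r - s|.

Lemma norm_dot_le x y : `|dot x y| <= enorm x * enorm y.
Proof.
have [d0|d0] := leP 0 (dot x y); first by rewrite ger0_norm// dot_le_enorm.
by rewrite ltr0_norm// -dotNl -[enorm x]enormN dot_le_enorm.
Qed.

Lemma sdiff_lip f x g : sdiff f x g -> exists2 d : R, 0 < d &
  forall y z, enorm (y - x) < d -> enorm (z - x) < d ->
    `|f y - f z| <= (enorm g + 1) * enorm (y - z).
Proof.
move=> /(_ 1 ltr01)[d d0 fd]; exists d => // y z yd zd.
have := fd y z yd zd; rewrite mul1r => h.
rewrite (_ : f y - f z = (f y - f z - dot g (y - z)) + dot g (y - z)); last by ring.
apply: le_trans (ler_normD _ _) _; rewrite mulrDl mul1r addrC lerD//.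
exact: norm_dot_le.
Qed.

Lemma sdiff_continuous f x g : sdiff f x g -> {for x, continuous f}.
Proof.
move=> /sdiff_lip[d d0 fd]; apply/continuous_eballP => e e0.
have g1 : 0 < enorm g + 1 by rewrite ltr_wpDl// enorm_ge0.
exists (Num.min d (e / (enorm g + 1))); first by rewrite lt_min d0 divr_gt0.
move=> y; rewrite lt_min => /andP[yd ye].
apply: le_lt_trans (fd _ _ yd _) _; first by rewrite subrr enorm0.
by rewrite mulrC -ltr_pdivlMr.
Qed.

Lemma sdiff_cst (c : R) x : sdiff (cst c) x 0.
Proof.
move=> e e0; exists 1 => // y z _ _; rewrite /cst subrr sub0r normrN.
rewrite /dot big1 ?normr0; last by move=> i _; rewrite mxE mul0r.
by rewrite mulr_ge0 ?enorm_ge0// ltW.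
Qed.

Lemma sdiff_dot (a : 'rV[R]_n) x : sdiff (dot a) x a.
Proof.
move=> e e0; exists 1 => // y z _ _; rewrite -dotNr -dotDr subrr normr0.
by rewrite mulr_ge0 ?enorm_ge0// ltW.
Qed.

Lemma sdiffD f1 f2 x g1 g2 : sdiff f1 x g1 -> sdiff f2 x g2 ->
  sdiff (fun y => f1 y + f2 y) x (g1 + g2).
Proof.
move=> h1 h2 e e0; have e20 : 0 < e / 2 by rewrite divr_gt0.
have [d1 d10 k1] := h1 _ e20; have [d2 d20 k2] := h2 _ e20.
exists (Num.min d1 d2); first by rewrite lt_min d10.
move=> y z; rewrite !lt_min => /andP[y1 y2] /andP[z1 z2].
have := k1 y z y1 z1; have := k2 y z y2 z2 => H2 H1.
rewrite (_ : _ - _ = (f1 y - f1 z - dot g1 (y - z)) + (f2 y - f2 z - dot g2 (y - z))).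
  by apply: le_trans (ler_normD _ _) _; apply: le_trans (lerD H1 H2) _; lra.
by rewrite dotDl; ring.
Qed.

Lemma sdiffM f1 f2 x g1 g2 : sdiff f1 x g1 -> sdiff f2 x g2 ->
  sdiff (fun y => f1 y * f2 y) x (f1 x *: g2 + f2 x *: g1).
Proof.
move=> h1 h2 e e0.
have [c1 c10 l1] := sdiff_lip h1; have [c2 c20 l2] := sdiff_lip h2.
pose A := `|f1 x| + `|f2 x| + enorm g1 + enorm g2 + 4.
have A0 : 0 < A by rewrite /A ltr_wpDl// !addr_ge0// enorm_ge0.
pose e' := Num.min 1 (e / (4 * A)).
have e'0 : 0 < e' by rewrite lt_min ltr01 divr_gt0// mulr_gt0.
have [d1 d10 k1] := h1 _ e'0; have [d2 d20 k2] := h2 _ e'0.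
pose dd := e' / A.
have dd0 : 0 < dd by rewrite divr_gt0.
exists (Num.min (Num.min c1 c2) (Num.min dd (Num.min d1 d2))).
  by rewrite !lt_min c10 c20 dd0 d10 d20.
move=> y z; rewrite !lt_min.
move=> /andP[/andP[yc1 yc2] /andP[ydd /andP[yd1 yd2]]].
move=> /andP[/andP[zc1 zc2] /andP[zdd /andP[zd1 zd2]]].
have xx1 : enorm (x - x) < c1 by rewrite subrr enorm0.
have xx2 : enorm (x - x) < c2 by rewrite subrr enorm0.
have Y1 : `|f1 y - f1 x| <= e'.
  apply: le_trans (l1 _ _ yc1 xx1) _; apply: le_trans (_ : A * enorm (y - x) <= _).
    rewrite ler_wpM2r ?enorm_ge0// /A.
    have := normr_ge0 (f1 x); have := normr_ge0 (f2 x); have := enorm_ge0 g2; lra.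
  by rewrite mulrC -ler_pdivlMr// ltW.
have Z2 : `|f2 z - f2 x| <= e'.
  apply: le_trans (l2 _ _ zc2 xx2) _; apply: le_trans (_ : A * enorm (z - x) <= _).
    rewrite ler_wpM2r ?enorm_ge0// /A.
    have := normr_ge0 (f1 x); have := normr_ge0 (f2 x); have := enorm_ge0 g1; lra.
  by rewrite mulrC -ler_pdivlMr// ltW.
have F1 := k1 y z yd1 zd1; have F2 := k2 y z yd2 zd2; have L2 := l2 y z yc2 zc2.
have L1 := l1 y z yc1 zc1.
set N := enorm (y - z) in F1 F2 L1 L2 *; have N0 : 0 <= N := enorm_ge0 _.
(* Leibniz rule with both factors frozen at [x]. In each of the two remaining products of increments
   one factor is at most [e'] and the other is Lipschitz; [A] exceeds the sum of all the
   coefficients that arise. *)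
rewrite (_ : _ - _ = f1 x * (f2 y - f2 z - dot g2 (y - z))
   + f2 x * (f1 y - f1 z - dot g1 (y - z))
   + ((f1 y - f1 x) * (f2 y - f2 z) + (f2 z - f2 x) * (f1 y - f1 z))); last first.
  by rewrite dotDl !dotZl; ring.
have T1 : `|f1 x * (f2 y - f2 z - dot g2 (y - z))| <= `|f1 x| * (e' * N).
  by rewrite normrM ler_wpM2l.
have T2 : `|f2 x * (f1 y - f1 z - dot g1 (y - z))| <= `|f2 x| * (e' * N).
  by rewrite normrM ler_wpM2l.
have T3 : `|(f1 y - f1 x) * (f2 y - f2 z)| <= e' * ((enorm g2 + 1) * N).
  by rewrite normrM ler_pM.
have T4 : `|(f2 z - f2 x) * (f1 y - f1 z)| <= e' * ((enorm g1 + 1) * N).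
  by rewrite normrM ler_pM.
apply: le_trans (ler_normD _ _) _.
apply: le_trans (lerD (ler_normD _ _) (ler_normD _ _)) _.
apply: (@le_trans _ _ (A * e' * N)).
  apply: le_trans (lerD (lerD T1 T2) (lerD T3 T4)) _.
  rewrite /A -subr_ge0 (_ : _ - _ = 2 * (e' * N)); last by ring.
  by rewrite mulr_ge0// mulr_ge0// ltW.
rewrite ler_wpM2r// mulrC -ler_pdivlMr//.
apply: le_trans (_ : e / (4 * A) <= _); first by rewrite ge_min lexx orbT.
rewrite ler_pM2l// lef_pV2 ?posrE ?mulr_gt0//; lra.
Qed.

Lemma sdiff_comp1 (phi : R -> R) f x g c : sdiff f x g -> sdiff1 phi (f x) c ->
  sdiff (phi \o f) x (c *: g).
Proof.
move=> hf hphi e e0.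
have [d1 d10 l1] := sdiff_lip hf.
have g1 : 0 < enorm g + 1 by rewrite ltr_wpDl// enorm_ge0.
have c1 : 0 < `|c| + 1 by rewrite ltr_wpDl.
have e1 : 0 < e / 2 / (enorm g + 1) by rewrite !divr_gt0.
have e2 : 0 < e / 2 / (`|c| + 1) by rewrite !divr_gt0.
have [d2 d20 k2] := hphi _ e1; have [d3 d30 k3] := hf _ e2.
exists (Num.min (Num.min d1 d3) (d2 / (enorm g + 1))).
  by rewrite !lt_min d10 d30 divr_gt0.
move=> y z; rewrite !lt_min => /andP[/andP[y1 y3] y2] /andP[/andP[z1 z3] z2].
have xx : enorm (x - x) < d1 by rewrite subrr enorm0.
have fy : `|f y - f x| < d2.
  by apply: le_lt_trans (l1 _ _ y1 xx) _; rewrite mulrC -ltr_pdivlMr.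
have fz : `|f z - f x| < d2.
  by apply: le_lt_trans (l1 _ _ z1 xx) _; rewrite mulrC -ltr_pdivlMr.
rewrite (_ : _ - _ = (phi (f y) - phi (f z) - c * (f y - f z))
    + c * (f y - f z - dot g (y - z))); last by rewrite dotZl /=; ring.
apply: le_trans (ler_normD _ _) _.
rewrite (splitr e) mulrDl; apply: lerD.
  apply: le_trans (k2 _ _ fy fz) _.
  apply: (@le_trans _ _ (e / 2 / (enorm g + 1) * ((enorm g + 1) * enorm (y - z)))).
    by rewrite ler_wpM2l ?(ltW e1)// l1.
  by rewrite mulrA divfK ?gt_eqF.
rewrite normrM; apply: (@le_trans _ _ ((`|c| + 1) * (e / 2 / (`|c| + 1) * enorm (y - z)))).
  by apply: ler_pM => //; [rewrite lerDl|exact: k3].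
by rewrite mulrA [_ * (e / 2 / _)]mulrC divfK ?gt_eqF.
Qed.

End StrictDifferentiability.

(** Chain rule in which the derivative of [Phi] is a plain map [A], and its transpose enters only
    through the image [g'] of the gradient [g]. Translations, rotations and shears each supply such
    an [A] directly, without a Jacobian matrix. *)
Lemma sdiff_compv {R : realType} n (Phi : 'rV[R]_n -> 'rV[R]_n) (f : 'rV[R]_n -> R)
    x (A : 'rV[R]_n -> 'rV[R]_n) g (g' : 'rV[R]_n) (M : R) :
  (forall v, enorm (A v) <= M * enorm v) ->
  (forall v, dot g (A v) = dot g' v) ->
  (forall e : R, 0 < e -> exists2 d : R, 0 < d & forall y z,
    enorm (y - x) < d -> enorm (z - x) < d ->
    enorm (Phi y - Phi z - A (y - z)) <= e * enorm (y - z)) ->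
  sdiff f (Phi x) g -> sdiff (f \o Phi) x g'.
Proof.
move=> AM gA hPhi hf e e0.
have g1 : 0 < enorm g + 1 by rewrite ltr_wpDl// enorm_ge0.
have M1 : 0 < `|M| + 1 by rewrite ltr_wpDl.
have e1 : 0 < e / 2 / (`|M| + 1) by rewrite !divr_gt0.
have e2 : 0 < Num.min 1 (e / 2 / (enorm g + 1)) by rewrite lt_min ltr01 !divr_gt0.
have [d1 d10 k1] := hf _ e1; have [d2 d20 k2] := hPhi _ e2.
exists (Num.min d2 (d1 / (`|M| + 1))); first by rewrite lt_min d20 divr_gt0.
have PhiL y z : enorm (y - x) < d2 -> enorm (z - x) < d2 ->
    enorm (Phi y - Phi z) <= (`|M| + 1) * enorm (y - z).
  move=> yd zd; rewrite -[Phi y - Phi z](subrK (A (y - z))).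
  apply: le_trans (ler_enormD _ _) _; rewrite addrC mulrDl; apply: lerD.
    apply: le_trans (AM _) _; rewrite ler_wpM2r ?enorm_ge0//; exact: ler_norm.
  apply: le_trans (k2 _ _ yd zd) _; rewrite ler_wpM2r ?enorm_ge0//.
  by rewrite ge_min lexx.
have xx : enorm (x - x) < d2 by rewrite subrr enorm0.
move=> y z; rewrite !lt_min => /andP[y2 y1] /andP[z2 z1].
have Py : enorm (Phi y - Phi x) < d1.
  by apply: le_lt_trans (PhiL _ _ y2 xx) _; rewrite mulrC -ltr_pdivlMr.
have Pz : enorm (Phi z - Phi x) < d1.
  by apply: le_lt_trans (PhiL _ _ z2 xx) _; rewrite mulrC -ltr_pdivlMr.
rewrite (_ : _ - _ = (f (Phi y) - f (Phi z) - dot g (Phi y - Phi z))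
    + dot g (Phi y - Phi z - A (y - z))); last first.
  by rewrite [dot g (_ - A _)]dotDr dotNr gA /=; ring.
apply: le_trans (ler_normD _ _) _; rewrite (splitr e) mulrDl; apply: lerD.
  apply: le_trans (k1 _ _ Py Pz) _.
  apply: (@le_trans _ _ (e / 2 / (`|M| + 1) * ((`|M| + 1) * enorm (y - z)))).
    by rewrite ler_wpM2l ?(ltW e1)// PhiL.
  by rewrite mulrA divfK ?gt_eqF.
apply: le_trans (norm_dot_le _ _) _.
apply: (@le_trans _ _ ((enorm g + 1) * (e / 2 / (enorm g + 1) * enorm (y - z)))).
  apply: ler_pM; rewrite ?enorm_ge0 ?lerDl//.
  apply: le_trans (k2 _ _ y2 z2) _; rewrite ler_wpM2r ?enorm_ge0//.
  by rewrite ge_min lexx orbT.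
by rewrite mulrA [_ * (e / 2 / _)]mulrC divfK ?gt_eqF.
Qed.

Lemma is_derive_line {R : realType} n (f : 'rV[R]_n -> R) (a v : 'rV[R]_n) (t : R) :
  derivable f (t *: v + a) v ->
  is_derive t 1 (fun h => f (h *: v + a)) ('D_v f (t *: v + a)).
Proof.
move=> df.
have E : (fun h : R => h^-1 *: (((fun h => f (h *: v + a)) \o shift t) (h *: (1 : R)) -
      f (t *: v + a))) =
    (fun h => h^-1 *: ((f \o shift (t *: v + a)) (h *: v) - f (t *: v + a))).
  by apply/funext => h /=; rewrite [_%:A]mulr1 scalerDl addrA.
by split; [rewrite /derivable E|rewrite /derive E].
Qed.

(** The mean value theorem controls [g] minus a line of slope [c]. With [c] the derivative at a
    centre, this yields strict differentiability, both for functions of one variable and along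
    coordinate segments. *)
Lemma mvt_le {R : realType} (g dg : R -> R) (c e r s : R) :
  (forall t, Num.min r s <= t <= Num.max r s ->
    is_derive t 1 g (dg t) /\ `|dg t - c| <= e) ->
  `|g r - g s - c * (r - s)| <= e * `|r - s|.
Proof.
wlog rs : r s / s <= r => [H Hg|].
  have [/H|/ltW rs] := leP s r; first exact.
  have := H s r rs; rewrite minC maxC => /(_ Hg) h.
  have -> : `|g r - g s - c * (r - s)| = `|g s - g r - c * (s - r)|.
    by rewrite -normrN; congr (`|_|); ring.
  by rewrite (distrC r s).
move=> Hg; move: (Hg); rewrite (min_idPr rs) (max_idPl rs) => {}Hg.
have [|//|t tI ->] := @MVT_segment R g dg s r rs.
- by move=> t; rewrite in_itv/= => /andP[t1 t2]; apply: (Hg t _).1; rewrite !ltW.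
- apply: derivable_within_continuous => t; rewrite in_itv/= => tI.
  by have [[]] := Hg t tI.
rewrite -mulrBl normrM ler_wpM2r//; apply: (Hg t _).2.
by move: tI; rewrite in_itv.
Qed.

Lemma sdiff1_derive {R : realType} (phi dphi : R -> R) (t : R) :
  (forall s : R, is_derive s 1 phi (dphi s)) -> {for t, continuous dphi} ->
  sdiff1 phi t (dphi t).
Proof.
move=> dphiE /cvgrPdist_le cphi e e0.
have /nbhs_ballP[d /= d0 dP] := cphi e e0; exists d => // r s rt st.
apply: (mvt_le (dg := dphi)) => u /andP[u1 u2]; split=> //.
rewrite distrC; apply: dP; rewrite /ball/= distrC.
move: rt st; rewrite !ltr_norml => /andP[? ?] /andP[? ?].
move: u1 u2; rewrite ge_min le_max => /orP[] ? /orP[] ?; apply/andP; lra.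
Qed.

Section C1Sdiff.
Context {R : realType} (n : nat).
Implicit Types (x y z g : 'rV[R]_n) (f : 'rV[R]_n -> R).

Lemma sdiff_derive f x g i : sdiff f x g ->
  derivable f x (evec i) /\ 'D_(evec i) f x = g ord0 i.
Proof.
move=> hf.
have dgi : dot g (evec i) = g ord0 i.
  rewrite /dot (bigD1 i)//= evecE eqxx mulr1 big1 ?addr0// => j ji.
  by rewrite evecE (negbTE ji) mulr0.
have C : (fun h : R => h^-1 *: ((f \o shift x) (h *: evec i) - f x)) @ 0^' --> g ord0 i.
  apply/cvgrPdist_le => e e0.
  have [d d0 k] := hf _ e0; near=> h.
  have h0 : h != 0 by near: h; exact: nbhs_dnbhs_neq.
  have hd : `|h| < d.
    near: h; rewrite near_withinE; near=> h => _; near: h.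
    by apply/nbhs_ballP; exists d => //= h; rewrite /ball/= sub0r normrN.
  have := k (h *: evec i + x) x.
  rewrite addrK subrr enorm0 enormZ enorm_evec mulr1 => /(_ hd d0).
  rewrite dotZr dgi => kk.
  rewrite -(@ler_pM2l _ `|h|) ?normr_gt0// -normrM mulrC [`|h| * e]mulrC.
  apply: le_trans kk; rewrite -normrN le_eqVlt; apply/orP; left; apply/eqP.
  congr (`|_|); rewrite /GRing.scale/=; field.
  exact: h0.
split; first by apply/cvg_ex; exists (g ord0 i).
exact: cvg_lim C.
Unshelve. all: by end_near. Qed.

Lemma sdiff_C1 f : (forall x, exists g, sdiff f x g) -> C1 f.
Proof.
move=> hf i; split=> [x|x].
  by have [g /(sdiff_derive i)[]] := hf x.
have [g hg] := hf x; have [_ Dx] := sdiff_derive i hg.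
apply/continuous_eballP => e e0; rewrite Dx.
have e20 : 0 < e / 3 by rewrite divr_gt0.
have [d d0 k] := hg _ e20; exists d => // y yd.
have [g' hg'] := hf y; have [_ ->] := sdiff_derive i hg'.
have [d' d'0 k'] := hg' _ e20.
(* A step [h] along the axis is short enough for the expansion at [y] and stays in the ball around
   [x]. Both gradients then predict the same increment of [f], each up to [e / 3 * h]. *)
pose h := Num.min d' (d - enorm (y - x)) / 2.
have h0 : 0 < h by rewrite divr_gt0// lt_min d'0 subr_gt0.
have hd' : h < d'.
  rewrite /h ltr_pdivrMr//; apply: le_lt_trans (_ : d' < _); first by rewrite ge_min lexx.
  by lra.
have hd : h < d - enorm (y - x).
  rewrite /h ltr_pdivrMr//; apply: le_lt_trans (_ : d - enorm (y - x) < _).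
    by rewrite ge_min lexx orbT.
  have : 0 < d - enorm (y - x) by rewrite subr_gt0.
  by lra.
have Y : enorm (y + h *: evec i - x) < d.
  rewrite addrAC; apply: le_lt_trans (ler_enormD _ _) _.
  by rewrite enormZ enorm_evec gtr0_norm//; lra.
have Y' : enorm (y + h *: evec i - y) < d'.
  by rewrite addrC addKr enormZ enorm_evec gtr0_norm// mulr1.
have yy : enorm (y - y) < d' by rewrite subrr enorm0.
have := k _ _ Y yd; have := k' _ _ Y' yy.
rewrite (addrC y) addrK enormZ enorm_evec mulr1 !dotZr.
have dgi (u : 'rV[R]_n) : dot u (evec i) = u ord0 i.
  rewrite /dot (bigD1 i)//= evecE eqxx mulr1 big1 ?addr0// => j ji.
  by rewrite evecE (negbTE ji) mulr0.
rewrite !dgi (gtr0_norm h0); set Df := f _ - f y => A B.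
have H : `|h * (g' ord0 i - g ord0 i)| <= (2 / 3 * e) * h.
  rewrite (_ : _ * _ = (Df - h * g ord0 i) - (Df - h * g' ord0 i)); last by ring.
  by apply: le_trans (ler_normB _ _) _; lra.
have {}H : `|g' ord0 i - g ord0 i| <= 2 / 3 * e.
  by move: H; rewrite normrM (gtr0_norm h0) mulrC ler_pM2r.
by apply: le_lt_trans H _; lra.
Qed.

Lemma C1_sdiff f : C1 f -> forall x, exists g, sdiff f x g.
Proof.
move=> hf x; exists (\row_i 'D_(evec i) f x) => e e0.
pose e' := e / n.+1%:R; have e'0 : 0 < e' by rewrite divr_gt0.
have [d d0 dP] : exists2 d : R, 0 < d & forall i y, enorm (y - x) < d ->
    `|'D_(evec i) f y - 'D_(evec i) f x| <= e'.
  have D i : exists2 d : R, 0 < d & forall y, enorm (y - x) < d ->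
      `|'D_(evec i) f y - 'D_(evec i) f x| <= e'.
    have [_ /(_ x)/continuous_eballP/(_ _ e'0)[d d0 dP]] := hf i.
    by exists d => // y /dP/ltW.
  pose dd i := projT1 (cid2 (D i)).
  have dd0 i : 0 < dd i by rewrite /dd; case: cid2.
  exists (\big[Num.min/1]_i dd i).
    by apply/bigmin_gtP.
  move=> i y yd; rewrite /dd in yd; have : enorm (y - x) < dd i.
    by apply: lt_le_trans yd _; exact: bigmin_le.
  by rewrite /dd; case: cid2 => /= r r0 rP /rP.
exists (d / n.+1%:R) => [|y z yd zd]; first by rewrite divr_gt0.
(* [w k] has the first [k] coordinates of [y] and the others of [z], so the increment telescopes
   into [n] moves along the axes, each governed by one partial derivative. The factors [n.+1] in
   [e'] and in the radius pay for the number of moves and for passing from coordinates to the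
   norm. *)
pose w (k : nat) : 'rV[R]_n := \row_i (if (i < k)%N then y ord0 i else z ord0 i).
have wn : w n = y by apply/rowP => i; rewrite mxE ltn_ord.
have w0 : w 0%N = z by apply/rowP => i; rewrite mxE.
have wS (k : 'I_n) (t : R) : w k + t *: evec k = \row_i
    (if (i < k)%N then y ord0 i else if i == k then z ord0 i + t else z ord0 i).
  apply/rowP => i; rewrite [RHS]mxE 3!mxE evecE.
  have [->|ik] := eqVneq i k; first by rewrite ltnn mulr1.
  by rewrite mulr0 addr0.
rewrite -[f y]/(f y) -{1}wn -{1}w0 -(@telescope_sumr _ 0 n (fun k => f (w k)))//.
rewrite big_mkord /dot -sumrB.
apply: le_trans (ler_norm_sum _ _ _) _.
apply: (@le_trans _ _ (\sum_(i < n) e' * enorm (y - z))); last first.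
  rewrite sumr_const card_ord -[leLHS]mulr_natl mulrA ler_wpM2r ?enorm_ge0//.
  rewrite /e' mulrA mulrC ler_pdivrMl// mulrC (mulrC e) ler_wpM2r ?ler_nat// ltW//.
apply: ler_sum => k _.
have -> : w k.+1 = (y ord0 k - z ord0 k) *: evec k + w k.
  rewrite addrC wS; apply/rowP => i; rewrite !mxE ltnS leq_eqVlt.
  have [->|ik] := eqVneq i k; first by rewrite eqxx/= ltnn addrC subrK.
  by rewrite (negbTE (_ : nat_of_ord i != k))//=; apply: contraNneq ik => /val_inj ->.
have -> : f (w k) = f (0 *: evec k + w k) by rewrite scale0r add0r.
rewrite !mxE.
apply: le_trans (_ : e' * `|(y ord0 k - z ord0 k) - 0| <= _); last first.
  by rewrite subr0 ler_wpM2l ?(ltW e'0)//; have := ler_coord_enorm (y - z) k; rewrite !mxE.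
rewrite -[X in 'D_(evec k) f x * X]subr0.
apply: (mvt_le (g := fun h => f (h *: evec k + w k)) (dg := fun h => 'D_(evec k) f (h *: evec k + w k))) => t tI.
split; first by apply: is_derive_line; exact: (hf k).1.
apply: dP; apply: (@le_lt_trans _ _ (n%:R * (Num.max (enorm (y - x)) (enorm (z - x))))).
  apply: enorm_le_bound; first by rewrite le_max enorm_ge0.
  move=> i; rewrite [_ + w k]addrC wS !mxE.
  have yi := ler_coord_enorm (y - x) i; have zi := ler_coord_enorm (z - x) i.
  rewrite !mxE in yi zi.
  rewrite le_max; case: ifP => _; first by rewrite yi.
  case: eqP => [->|_]; last by rewrite zi orbT.
  have {}yi := ler_coord_enorm (y - x) k; have {}zi := ler_coord_enorm (z - x) k.
  rewrite !mxE in yi zi.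
  have : `|z ord0 k + t - x ord0 k| <= Num.max `|y ord0 k - x ord0 k| `|z ord0 k - x ord0 k|.
    move: tI; rewrite le_max ge_min le_max.
    case: (ger0P (y ord0 k - x ord0 k)) => A; case: (ger0P (z ord0 k - x ord0 k)) => B;
    case: (ger0P (z ord0 k + t - x ord0 k)) => C /andP[/orP[D|D] /orP[E|E]];
    apply/orP; ((left; lra) || (right; lra)).
  by rewrite le_max => /orP[h|h]; apply/orP; [left|right]; exact: le_trans h _.
have : Num.max (enorm (y - x)) (enorm (z - x)) < d / n.+1%:R by rewrite gt_max yd zd.
rewrite ltr_pdivlMr// => h; apply: le_lt_trans h; rewrite mulrC ler_wpM2l ?ler_nat//.
by rewrite le_max enorm_ge0.
Qed.

Lemma C1P f : C1 f <-> forall x, exists g, sdiff f x g.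
Proof. by split; [exact: C1_sdiff|exact: sdiff_C1]. Qed.

Lemma C1_continuous f : C1 f -> continuous f.
Proof. by move=> /C1P hf x; have [g /sdiff_continuous] := hf x. Qed.

End C1Sdiff.

(** * Partitions of unity *)

Section Bump.
Context {R : realType}.

(** A C1 function that vanishes on a half-line, with piecewise linear derivative. Test functions are
    C1, so cutoffs of this regularity suffice. *)
Definition posq (s : R) : R := Num.max s 0 ^+ 2.

Let posq_bound (d r s t : R) : s <= r ->
  `|r - t| < d -> `|s - t| < d ->
  `|posq r - posq s - 2 * Num.max t 0 * (r - s)| <= 2 * d * (r - s).
Proof.
rewrite !ltr_norml /posq => sr /andP[? ?] /andP[? ?].
case: (leP r 0) => r0; case: (leP s 0) => s0; case: (leP t 0) => t0;
  rewrite ler_norml ?expr0n/=; apply/andP; split; nra.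
Qed.

Lemma sdiff1_posq t : sdiff1 posq t (2 * Num.max t 0).
Proof.
move=> e e0; exists (e / 2); first by rewrite divr_gt0.
move=> r s rt st; have [sr|rs] := leP s r.
  by rewrite (ger0_norm (_ : 0 <= r - s)) ?subr_ge0//; have := posq_bound sr rt st; lra.
have -> : `|posq r - posq s - 2 * Num.max t 0 * (r - s)| =
    `|posq s - posq r - 2 * Num.max t 0 * (s - r)|.
  by rewrite -normrN; congr (`|_|); ring.
rewrite (ltr0_norm (_ : r - s < 0)) ?subr_lt0//.
by have := posq_bound (ltW rs) st rt; lra.
Qed.

Lemma posq_lip (M r s : R) : `|r| <= M -> `|s| <= M ->
  `|posq r - posq s| <= 2 * M * `|r - s|.
Proof.
rewrite !ler_norml /posq => /andP[? ?] /andP[? ?].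
by case: (leP r 0) => r0; case: (leP s 0) => s0; case: (ger0P (r - s)) => sr;
  apply/andP; split; rewrite ?expr0n/=; nra.
Qed.

Lemma sdiff1_sin t : sdiff1 (@sin R) t (cos t).
Proof. by apply: (@sdiff1_derive _ _ cos) => //; exact: continuous_cos. Qed.

Lemma sdiff1_cos t : sdiff1 (@cos R) t (- sin t).
Proof.
apply: (@sdiff1_derive _ _ (fun t => - sin t)) => //.
by apply: continuousN; exact: continuous_sin.
Qed.

Lemma sin_lip (r s : R) : `|sin r - sin s| <= `|r - s|.
Proof.
have := @mvt_le R sin cos 0 1 r s; rewrite mul0r subr0 mul1r; apply=> t _.
split; first exact: is_derive_sin.
by rewrite subr0 ler_norml cos_geN1 cos_le1.
Qed.

Lemma cos_lip (r s : R) : `|cos r - cos s| <= `|r - s|.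
Proof.
have := @mvt_le R cos (fun t => - sin t) 0 1 r s; rewrite mul0r subr0 mul1r; apply=> t _.
split; first exact: is_derive_cos.
by rewrite subr0 normrN ler_norml sin_geN1 sin_le1.
Qed.

Variable (n : nat).
Implicit Types (x y : 'rV[R]_n) (D : set 'rV[R]_n) (f : 'rV[R]_n -> R).

(** The regularity holds everywhere, so that test functions can be multiplied by [f]; the bounds
    serve to estimate localization errors. They are restricted to [D] because building blocks such
    as squared distances are unbounded on the whole space. *)
Definition C1lip D f := (forall x, exists g, sdiff f x g) /\
  exists2 M : R, 0 <= M & forall x y, D x -> D y ->
    `|f x| <= M /\ `|f x - f y| <= M * enorm (x - y).

Lemma C1lip_cst D (c : R) : C1lip D (cst c).
Proof.
split=> [x|]; first by exists 0; exact: sdiff_cst.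
exists `|c| => // x y _ _; split=> //.
by rewrite subrr normr0 mulr_ge0// enorm_ge0.
Qed.

Lemma C1lipD D f1 f2 : C1lip D f1 -> C1lip D f2 -> C1lip D (fun x => f1 x + f2 x).
Proof.
move=> [d1 [M1 M10 h1]] [d2 [M2 M20 h2]]; split=> [x|].
  by have [g1 k1] := d1 x; have [g2 k2] := d2 x; exists (g1 + g2); exact: sdiffD.
exists (M1 + M2); first exact: addr_ge0.
move=> x y Dx Dy; have [A1 B1] := h1 x y Dx Dy; have [A2 B2] := h2 x y Dx Dy.
split; first by apply: le_trans (ler_normD _ _) _; exact: lerD.
rewrite (_ : _ - _ = (f1 x - f1 y) + (f2 x - f2 y)); last by ring.
by apply: le_trans (ler_normD _ _) _; rewrite mulrDl lerD.
Qed.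

Lemma C1lipM D f1 f2 : C1lip D f1 -> C1lip D f2 -> C1lip D (fun x => f1 x * f2 x).
Proof.
move=> [d1 [M1 M10 h1]] [d2 [M2 M20 h2]]; split=> [x|].
  have [g1 k1] := d1 x; have [g2 k2] := d2 x.
  by exists (f1 x *: g2 + f2 x *: g1); exact: sdiffM.
exists (M1 * M2 + M1 * M2); first by rewrite addr_ge0// mulr_ge0.
move=> x y Dx Dy; have [A1 B1] := h1 x y Dx Dy; have [A2 B2] := h2 x y Dx Dy.
have [A2' _] := h2 y x Dy Dx.
split; first by rewrite normrM -[leLHS]addr0; apply: lerD; [exact: ler_pM|exact: mulr_ge0].
rewrite (_ : _ - _ = f1 x * (f2 x - f2 y) + (f1 x - f1 y) * f2 y); last by ring.
apply: le_trans (ler_normD _ _) _; rewrite [leRHS]mulrDl; apply: lerD; rewrite normrM.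
  by rewrite -mulrA; exact: ler_pM.
by rewrite mulrAC; exact: ler_pM.
Qed.

Lemma C1lip_comp D (phi : R -> R) f :
  (forall t, exists c, sdiff1 phi t c) ->
  (forall M : R, 0 <= M -> exists2 L : R, 0 <= L & forall r s, `|r| <= M -> `|s| <= M ->
     `|phi r - phi s| <= L * `|r - s|) ->
  C1lip D f -> C1lip D (phi \o f).
Proof.
move=> dphi lphi [df [M M0 h]]; split=> [x|].
  have [g k] := df x; have [c kc] := dphi (f x); exists (c *: g).
  exact: sdiff_comp1.
have [L L0 kL] := lphi M M0.
exists (`|phi 0| + L * M + L * M); first by rewrite !addr_ge0// mulr_ge0.
move=> x y Dx Dy; have [A B] := h x y Dx Dy; have [A' _] := h y x Dy Dx; split=> /=.
  rewrite -[phi (f x)](subrK (phi 0)); apply: le_trans (ler_normD _ _) _.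
  have := kL (f x) 0 A; rewrite normr0 => /(_ M0); rewrite subr0 => k.
  have : L * `|f x| <= L * M by rewrite ler_wpM2l.
  by have := mulr_ge0 L0 M0; lra.
apply: le_trans (kL _ _ A A') _.
apply: le_trans (ler_wpM2l L0 B) _; rewrite mulrA ler_wpM2r ?enorm_ge0//.
by rewrite lerDr addr_ge0// mulr_ge0.
Qed.

Lemma C1lip_sum D I (r : seq I) (F : I -> 'rV[R]_n -> R) :
  (forall i, C1lip D (F i)) -> C1lip D (fun x => \sum_(i <- r) F i x).
Proof.
move=> hF; elim: r => [|i r IH].
  by have := C1lip_cst D 0; congr (C1lip _ _); apply/funext => x; rewrite big_nil.
by have := C1lipD (hF i) IH; congr (C1lip _ _); apply/funext => x; rewrite big_cons.
Qed.

Lemma C1lip_prod D I (r : seq I) (F : I -> 'rV[R]_n -> R) :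
  (forall i, C1lip D (F i)) -> C1lip D (fun x => \prod_(i <- r) F i x).
Proof.
move=> hF; elim: r => [|i r IH].
  by have := C1lip_cst D 1; congr (C1lip _ _); apply/funext => x; rewrite big_nil.
by have := C1lipM (hF i) IH; congr (C1lip _ _); apply/funext => x; rewrite big_cons.
Qed.

Lemma C1lip_coord D (i : 'I_n) (M : R) : (forall x, D x -> enorm x <= M) ->
  C1lip D (fun x => x ord0 i).
Proof.
move=> DM; have E : (fun x : 'rV[R]_n => x ord0 i) = dot (evec i).
  apply/funext => x; rewrite /dot (bigD1 i)//= evecE eqxx mul1r big1 ?addr0// => j ji.
  by rewrite evecE (negbTE ji) mul0r.
split=> [x|]; first by rewrite E; exists (evec i); exact: sdiff_dot.
exists (`|M| + 1) => [|x y Dx Dy]; first by rewrite addr_ge0.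
split.
  apply: le_trans (ler_coord_enorm _ _) _; apply: le_trans (DM _ Dx) _.
  by apply: le_trans (ler_norm _) _; rewrite lerDl.
have := ler_coord_enorm (x - y) i; rewrite !mxE => /le_trans; apply.
by rewrite mulrDl mul1r lerDr mulr_ge0// enorm_ge0.
Qed.

Lemma C1lip_sqnorm D (p : 'rV[R]_n) (M : R) : (forall x, D x -> enorm x <= M) ->
  C1lip D (fun x => enorm (x - p) ^+ 2).
Proof.
move=> DM.
rewrite (_ : (fun x => _) = fun x : 'rV[R]_n => \sum_(i <- index_enum 'I_n)
    (x ord0 i + cst (- p ord0 i) x) * (x ord0 i + cst (- p ord0 i) x)); last first.
  by apply/funext => x; rewrite enorm_sqr; apply: eq_bigr => i _; rewrite !mxE.
apply: C1lip_sum => i; apply: C1lipM; apply: C1lipD; try exact: C1lip_cst.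
all: exact: C1lip_coord DM.
Qed.

(** Its derivative is the tent on [[0, 1]] of height 2 and integral 1, which gives a C1 transition
    from 0 to 1. *)
Definition step (s : R) : R := 2 * posq s - 4 * posq (s - 2^-1) + 2 * posq (s - 1).

Lemma step0 s : s <= 0 -> step s = 0.
Proof.
by move=> s0; rewrite /step /posq; case: leP => ?; case: leP => ?; case: leP => ?;
  rewrite ?expr0n/=; lra.
Qed.

Lemma step1 s : 1 <= s -> step s = 1.
Proof.
by move=> s1; rewrite /step /posq (max_l (_ : 0 <= s)) ?(max_l (_ : 0 <= s - 2^-1)) ?(max_l (_ : 0 <= s - 1)); try lra.
Qed.

Lemma C1lip_posq D f : C1lip D f -> C1lip D (posq \o f).
Proof.
apply: C1lip_comp => [t|M M0].
  by exists (2 * Num.max t 0); exact: sdiff1_posq.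
by exists (2 * M); [rewrite mulr_ge0|move=> r s; exact: posq_lip].
Qed.

Lemma C1lip_step D f : C1lip D f -> C1lip D (step \o f).
Proof.
move=> hf.
have S c : C1lip D (fun x => posq (f x + cst c x)).
  exact: (C1lip_posq (C1lipD hf (C1lip_cst D c))).
have := C1lipD (C1lipD (C1lipM (C1lip_cst D 2) (S 0))
  (C1lipM (C1lip_cst D (-4)) (S (- 2^-1)))) (C1lipM (C1lip_cst D 2) (S (-1))).
congr (C1lip _ _); apply/funext => x /=; rewrite /step /cst addr0; ring.
Qed.

Lemma C1lip_sin D f : C1lip D f -> C1lip D (sin \o f).
Proof.
apply: C1lip_comp => [t|M M0]; first by exists (cos t); exact: sdiff1_sin.
by exists 1 => // r s _ _; rewrite mul1r; exact: sin_lip.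
Qed.

Lemma C1lip_cos D f : C1lip D f -> C1lip D (cos \o f).
Proof.
apply: C1lip_comp => [t|M M0]; first by exists (- sin t); exact: sdiff1_cos.
by exists 1 => // r s _ _; rewrite mul1r; exact: cos_lip.
Qed.

(** The factor [4 / 3] makes the argument of [step] equal to 1 at distance [r / 2] and to 0 at
    distance [r]. Squaring the distance avoids the singularity of the norm at [p]. *)
Definition angle (p : 'rV[R]_n) (r : R) x : R :=
  pi / 2 * step (4 / 3 * (1 - enorm (x - p) ^+ 2 / r ^+ 2)).

Lemma C1lip_angle D p r M : (forall x, D x -> enorm x <= M) -> C1lip D (angle p r).
Proof.
move=> DM; have := C1lipM (C1lip_cst D (pi / 2)) (C1lip_step (C1lipD (C1lip_cst D (4 / 3))
   (C1lipM (C1lip_cst D (- (4 / 3) / r ^+ 2)) (C1lip_sqnorm p DM)))).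
congr (C1lip _ _); apply/funext => x; rewrite /angle /cst/=; congr (_ * step _); ring.
Qed.

Lemma angle0 p r x : 0 < r -> r <= enorm (x - p) -> angle p r x = 0.
Proof.
move=> r0 rx; rewrite /angle step0 ?mulr0//.
rewrite pmulr_rle0// subr_le0 ler_pdivlMr ?exprn_gt0// mul1r.
by rewrite ler_pXn2r// nnegrE ?enorm_ge0// ltW.
Qed.

Lemma angle1 p r x : 0 < r -> enorm (x - p) <= r / 2 -> angle p r x = pi / 2.
Proof.
move=> r0 rx; rewrite /angle step1 ?mulr1//.
have : enorm (x - p) ^+ 2 / r ^+ 2 <= 1 / 4.
  rewrite ler_pdivrMr ?exprn_gt0//.
  have -> : 1 / 4 * r ^+ 2 = (r / 2) ^+ 2 by field.
  by rewrite ler_pXn2r// nnegrE ?enorm_ge0// divr_ge0// ltW.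
by lra.
Qed.

(* With angles [a_j] equal to [pi / 2] near the [j]-th point, the functions
   [sin a_j * \prod_(i < j) cos a_i] have squares summing to
   [1 - \prod_j (cos a_j)^2]. *)
Lemma partition_of_unity D (K : set 'rV[R]_n) (M : R) (rad : 'rV[R]_n -> R) :
  (forall x, D x -> enorm x <= M) -> compact K -> (forall p, K p -> 0 < rad p) ->
  exists (N : nat) (p : 'I_N -> 'rV[R]_n) (eta : 'I_N -> 'rV[R]_n -> R),
  [/\ forall j, K (p j), forall j, C1lip D (eta j),
      forall j x, rad (p j) <= enorm (x - p j) -> eta j x = 0 &
      forall x, K x -> \sum_(j < N) eta j x ^+ 2 = 1].
Proof.
move=> DM; rewrite compact_cover => cK Krad.
have Kc : K `<=` cover K (fun p => eball p (rad p / 2)).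
  by move=> x Kx; exists x => //; rewrite /eball/= subrr enorm0 divr_gt0// Krad.
have [F FK KF] := cK _ K _ (fun p _ => @open_eball R n p (rad p / 2)) Kc.
pose l := finmap.enum_fset F; pose N := size l; pose p (j : 'I_N) := nth 0 l j.
have Kp j : K (p j) by apply/set_mem/FK/mem_nth/ltn_ord.
pose a (j : nat) := angle (nth 0 l j) (rad (nth 0 l j)).
pose rest (k : nat) x := \prod_(i <- iota 0 k) cos (a i x).
pose eta (j : nat) x := sin (a j x) * rest j x.
have lipa j : C1lip D (a j) by exact: C1lip_angle DM.
exists N, p, (fun j => eta j); split=> // [j|j x rx|x Kx].
- apply: C1lipM; first exact: C1lip_sin.
  by apply: C1lip_prod => i; exact: C1lip_cos.
- have aj0 : a j x = 0 by apply: angle0 => //; exact: Krad (Kp j).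
  by rewrite /eta aj0 sin0 mul0r.
have S k : \sum_(0 <= j < k) eta j x ^+ 2 = 1 - rest k x ^+ 2.
  elim: k => [|k IH]; first by rewrite big_geq// /rest big_nil expr1n subrr.
  have rS : rest k.+1 x = rest k x * cos (a k x).
    by rewrite /rest -[k.+1]addn1 iotaD big_cat big_seq1.
  by rewrite big_nat_recr//= IH rS /eta !exprMn sin2cos2; ring.
rewrite -(big_mkord xpredT (fun j => eta j x ^+ 2)) S.
have [q qF xq] := KF x Kx.
have ql : q \in l by exact: qF.
rewrite /rest (big_rem (index q l))/=; last by rewrite mem_iota add0n index_mem.
have Kq : K q by exact/set_mem/FK.
rewrite /a nth_index// (angle1 (Krad _ Kq) (ltW xq)).
by rewrite cos_pihalf mul0r expr0n/= subr0.
Qed.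

End Bump.

(** * Integrals of powers and the Brezis-Lieb lemma *)

Section IntegralT.
Context d (T : measurableType d) (R : realType).
Variable mu : {measure set T -> \bar R}.
Local Open Scope ereal_scope.
Implicit Types f g : T -> \bar R.

Lemma integralT_le f g : measurable_fun setT f -> measurable_fun setT g ->
  (forall x, 0 <= f x) -> (forall x, f x <= g x) ->
  \int[mu]_x f x <= \int[mu]_x g x.
Proof.
move=> mf mg f0 fg; apply: ge0_le_integral => //.
Qed.

Lemma integralT_D f g : measurable_fun setT f -> measurable_fun setT g ->
  (forall x, 0 <= f x) -> (forall x, 0 <= g x) ->
  \int[mu]_x (f x + g x) = \int[mu]_x f x + \int[mu]_x g x.
Proof. by move=> mf mg f0 g0; rewrite ge0_integralD. Qed.

Lemma integralT_Z (c : R) f : (0 <= c)%R -> measurable_fun setT f ->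
  (forall x, 0 <= f x) -> \int[mu]_x (c%:E * f x) = c%:E * \int[mu]_x f x.
Proof. by move=> c0 mf f0; rewrite ge0_integralZl. Qed.

Lemma integralT_ge0 f : (forall x, 0 <= f x) -> 0 <= \int[mu]_x f x.
Proof. by move=> f0; apply: integral_ge0. Qed.

End IntegralT.

(** In place of the triangle inequality, which fails for p-th powers of norms: the hypotheses are
    what [powR_normD_le] gives in the two directions. The choice of [e1] ensures
    [e1 * (4 * (a + 1) + e) <= e], which pays for the terms in [e1 * a] and [e1 * e]. *)
Lemma quasi_close (R : realFieldType) (a b s e : R) :
  let e1 := Num.min 1 (e / (4 * (a + 1) + e)) in
  0 < e -> 0 <= a -> 0 <= s <= e / 4 ->
  b <= (1 + e1) * a + s -> a <= (1 + e1) * b + s -> `|a - b| <= e.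
Proof.
move=> e1 e0 a0 /andP[s0 se] h1 h2.
have D0 : 0 < 4 * (a + 1) + e by lra.
have e10 : 0 < e1 by rewrite lt_min ltr01 divr_gt0.
have e11 : e1 <= 1 by rewrite ge_min lexx.
have e1D : e1 * (4 * (a + 1) + e) <= e by rewrite -ler_pdivlMr// ge_min lexx orbT.
have e1a : 0 <= e1 * a by rewrite mulr_ge0// ltW.
have e1e : 0 <= e1 * e by rewrite mulr_ge0// ltW.
have e1a1 : e1 * a <= e / 4 by lra.
have e1b : e1 * b <= e1 * (a + e1 * a + s) by rewrite ler_wpM2l ?(ltW e10)//; lra.
have h3 : e1 * (e1 * a) <= e1 * a by rewrite -[leRHS]mul1r ler_wpM2r.
have h4 : e1 * s <= s by rewrite -[leRHS]mul1r ler_wpM2r.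
by rewrite ler_norml; apply/andP; split; lra.
Qed.

Section Pint.
Context d (T : measurableType d) (R : realType).
Variable mu : {measure set T -> \bar R}.
Implicit Types (w g u v : T -> R) (p : R).

(** Either [|a| <= l |b|], where [(1 + l)^p = 1 + e], or [|b| <= |a| / l]. The argument is free of
    convexity, so it covers exponents below 1 such as [2 / p]. *)
Lemma powR_normD_le p (e : R) : 0 < p -> 0 < e -> exists2 C : R, 0 < C &
  forall a b : R, `|a + b| `^ p <= (1 + e) * `|b| `^ p + C * `|a| `^ p.
Proof.
move=> p0 e0; pose l := (1 + e) `^ p^-1 - 1.
have l0 : 0 < l.
  have : 1 `^ p^-1 < (1 + e) `^ p^-1.
    by apply: gt0_ltr_powR; rewrite ?invr_gt0// ?nnegrE; lra.
  by rewrite powR1 /l; lra.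
have lE : (1 + l) `^ p = 1 + e.
  rewrite (_ : 1 + l = (1 + e) `^ p^-1); last by rewrite /l; ring.
  by rewrite -powRrM mulVf ?gt_eqF// powRr1//; lra.
have il0 : 0 < 1 + l^-1 by rewrite addr_gt0// invr_gt0.
exists ((1 + l^-1) `^ p); first exact: powR_gt0.
move=> a b; have a0 := normr_ge0 a; have b0 := normr_ge0 b.
have pb := powR_ge0 `|b| p; have pa := powR_ge0 `|a| p.
have [al|la] := leP `|a| (l * `|b|).
  apply: (@le_trans _ _ (((1 + l) * `|b|) `^ p)).
    apply: ge0_ler_powR; rewrite ?nnegrE ?mulr_ge0 ?(ltW p0)//; try lra.
    by apply: le_trans (ler_normD _ _) _; lra.
  rewrite powRM ?lE//; last lra.
  by rewrite lerDl mulr_ge0// powR_ge0.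
apply: (@le_trans _ _ (((1 + l^-1) * `|a|) `^ p)).
  apply: ge0_ler_powR; rewrite ?nnegrE ?mulr_ge0 ?(ltW p0)// ?(ltW il0)//.
  apply: le_trans (ler_normD _ _) _; rewrite mulrDl mul1r lerD2l.
  by rewrite mulrC ler_pdivlMr// mulrC ltW.
rewrite powRM ?(ltW il0)//.
by rewrite lerDr mulr_ge0//; lra.
Qed.

(** The pointwise inequality of Brezis and Lieb: the previous bound is applied to [a + b] and, for
    the other direction, to [b = - a + (a + b)]. *)
Lemma powR_normB_le p (e : R) : 0 < p -> 0 < e -> exists2 C : R, 0 < C &
  forall a b : R, `| `|a + b| `^ p - `|b| `^ p| <= e * `|b| `^ p + C * `|a| `^ p.
Proof.
move=> p0 e0; pose e' := Num.min 1 (e / 2).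
have e'0 : 0 < e' by rewrite lt_min ltr01 divr_gt0.
have e'1 : e' <= 1 by rewrite ge_min lexx.
have e'e : e' <= e / 2 by rewrite ge_min lexx orbT.
have [C C0 hC] := powR_normD_le p0 e'0; exists (2 * C); first by rewrite mulr_gt0.
move=> a b; have h1 := hC a b; have h2 := hC (- a) (a + b).
rewrite addKr normrN in h2.
have pb := powR_ge0 `|b| p; have pa := powR_ge0 `|a| p.
have pab := powR_ge0 `|a + b| p.
move: (`|a| `^ p) (`|b| `^ p) (`|a + b| `^ p) h1 h2 pb pa pab => A B S h1 h2 B0 A0 S0.
have BS : e' * S <= e' * ((1 + e') * B + C * A) by rewrite ler_wpM2l// ltW.
have CA0 : 0 <= C * A by rewrite mulr_ge0// ltW.
have eCA : e' * (C * A) <= C * A by rewrite -[leRHS]mul1r ler_wpM2r.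
have eB : e' * B <= e / 2 * B by rewrite ler_wpM2r.
have eeB : e' * (e' * B) <= e' * B by rewrite -[leRHS]mul1r ler_wpM2r ?mulr_ge0// ltW.
by rewrite ler_norml; apply/andP; split; lra.
Qed.

Definition pint p w : \bar R := (\int[mu]_x (`|w x| `^ p)%:E)%E.

Lemma measurable_pw p w : measurable_fun setT w ->
  measurable_fun setT (fun x => `|w x| `^ p).
Proof.
move=> mw; apply: (measurableT_comp (measurable_powR p)).
exact: measurableT_comp.
Qed.

Lemma pint_ge0 p w : (0 <= pint p w)%E.
Proof. by apply: integral_ge0 => x _; rewrite lee_fin powR_ge0. Qed.

Lemma pint_fin p w : (pint p w < +oo)%E -> pint p w \is a fin_num.
Proof. by move=> h; rewrite ge0_fin_numE ?pint_ge0. Qed.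

Lemma pint_integrable p w : measurable_fun setT w -> (pint p w < +oo)%E ->
  mu.-integrable setT (fun x => (`|w x| `^ p)%:E).
Proof.
move=> mw wfin; apply/integrableP; split.
  exact/measurable_EFinP/measurable_pw.
under eq_integral do rewrite gee0_abs ?lee_fin ?powR_ge0//.
exact: wfin.
Qed.

Lemma eq_pint p w g : (forall x, `|w x| = `|g x|) -> pint p w = pint p g.
Proof. by move=> wg; apply: eq_integral => x _; rewrite wg. Qed.

Lemma pintN p w : pint p (fun x => - w x) = pint p w.
Proof. by apply: eq_pint => x; rewrite normrN. Qed.

Lemma pintZ p (c : R) w : measurable_fun setT w ->
  pint p (fun x => c * w x) = ((`|c| `^ p)%:E * pint p w)%E.
Proof.
move=> mw; rewrite /pint -ge0_integralZl ?lee_fin ?powR_ge0//.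
- by apply: eq_integral => x _; rewrite -EFinM normrM powRM.
- exact/measurable_EFinP/measurable_pw.
Qed.

Lemma pintD_le p (e : R) : 0 < p -> 0 < e -> exists2 C : R, 0 < C &
  forall u v : T -> R, measurable_fun setT u -> measurable_fun setT v ->
    (pint p (fun x => u x + v x)%R <= (1 + e)%:E * pint p v + C%:E * pint p u)%E.
Proof.
move=> p0 e0; have [C C0 hC] := powR_normD_le p0 e0; exists C => // u v mu' mv.
have mpu := measurable_pw p mu'; have mpv := measurable_pw p mv.
have P w x : (0 <= (`|w x| `^ p)%:E :> \bar R)%E by rewrite lee_fin powR_ge0.
have e10 : (0 <= (1 + e)%:E :> \bar R)%E by rewrite lee_fin; lra.
have C0' : (0 <= C%:E :> \bar R)%E by rewrite lee_fin ltW.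
rewrite /pint -!ge0_integralZl//; try exact/measurable_EFinP.
rewrite -ge0_integralD//; last 4 first.
- by move=> x _; rewrite mule_ge0.
- by apply: measurable_funeM; exact/measurable_EFinP.
- by move=> x _; rewrite mule_ge0.
- by apply: measurable_funeM; exact/measurable_EFinP.
apply: ge0_le_integral => //.
- by apply/measurable_EFinP/measurable_pw; exact: measurable_funD.
- apply: emeasurable_funD; apply: measurable_funeM; exact/measurable_EFinP.
- by move=> x _; rewrite -!EFinM -EFinD lee_fin.
Qed.

Lemma pintD_fin p u v : 0 < p -> measurable_fun setT u -> measurable_fun setT v ->
  (pint p u < +oo)%E -> (pint p v < +oo)%E -> (pint p (fun x => u x + v x)%R < +oo)%E.
Proof.
move=> p0 mu' mv uf vf; have [C C0 hC] := pintD_le p0 ltr01.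
apply: le_lt_trans (hC _ _ mu' mv) _.
by apply: lte_add_pinfty; apply: lte_mul_pinfty; rewrite ?fin_numE ?lee_fin ?(ltW C0)//; lra.
Qed.

Lemma le_pint p u v : 0 <= p -> measurable_fun setT u -> measurable_fun setT v ->
  (forall x, `|u x| <= `|v x|) -> (pint p u <= pint p v)%E.
Proof.
move=> p0 mu' mv uv; apply: ge0_le_integral => //.
- exact/measurable_EFinP/measurable_pw.
- exact/measurable_EFinP/measurable_pw.
- by move=> x _; rewrite lee_fin; apply: ge0_ler_powR.
Qed.

Lemma pint_cvg p u (u_ : nat -> T -> R) : 0 < p ->
  measurable_fun setT u -> (forall k, measurable_fun setT (u_ k)) ->
  (pint p u < +oo)%E ->
  pint p (fun x => u_ k x - u x)%R @[k --> \oo] --> 0%E ->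
  pint p (u_ k) @[k --> \oo] --> pint p u.
Proof.
move=> p0 mu' mu_ ufin ukc.
have mB k : measurable_fun setT (fun x => u_ k x - u x) by exact: measurable_funB.
have P0 w := pint_ge0 p w.
have [a aE] : exists a : R, a%:E = pint p u.
  by exists (fine (pint p u)); rewrite (fineK (pint_fin ufin)).
have a0 : 0 <= a by rewrite -lee_fin aE.
have near1 (e : R) : 0 < e -> \forall k \near \oo, (pint p (fun x => u_ k x - u x)%R < e%:E)%E.
  by move=> e0; move/fine_cvgP: ukc => [fk /cvgrPdist_lt/(_ e e0)]; apply: filter_app;
     near=> k; rewrite sub0r normrN ger0_norm ?fine_ge0// => h;
     rewrite -(@fineK _ (pint p _)) ?lte_fin//; near: k.
have fin_k : \forall k \near \oo, (pint p (u_ k) < +oo)%E.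
  have := near1 1 ltr01; apply: filter_app; near=> k => h.
  have -> : u_ k = (fun x => (u_ k x - u x) + u x) by apply/funext => x; rewrite subrK.
  by apply: (pintD_fin p0 (mB k) mu' _ ufin); apply: lt_trans h _; rewrite ltry.
rewrite -aE; apply/fine_cvgP; split; first by move: fin_k; apply: filter_app; near=> k => /pint_fin.
apply/cvgrPdist_le => e e0.
pose e1 := Num.min 1 (e / (4 * (a + 1) + e)).
have e10 : 0 < e1 by rewrite lt_min ltr01 divr_gt0//; lra.
have [C C0 hC] := pintD_le p0 e10.
have eC : 0 < e / (4 * C) by rewrite divr_gt0// mulr_gt0.
move: (near1 _ eC) fin_k; apply: filter_app2; near=> k => Hk Fk.
have rfin : (pint p (fun x => u_ k x - u x)%R < +oo)%E by apply: lt_trans Hk _; rewrite ltry.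
have [b bE] : exists b : R, b%:E = pint p (u_ k).
  by exists (fine (pint p (u_ k))); rewrite (fineK (pint_fin Fk)).
have [r rE] : exists r : R, r%:E = pint p (fun x => u_ k x - u x).
  by exists (fine (pint p (fun x => u_ k x - u x))); rewrite (fineK (pint_fin rfin)).
have b0 : 0 <= b by rewrite -lee_fin bE.
have r0 : 0 <= r by rewrite -lee_fin rE.
have h1 : b <= (1 + e1) * a + C * r.
  have := hC _ _ (mB k) mu'.
  have -> : (fun x => u_ k x - u x + u x) = u_ k by apply/funext => x; rewrite subrK.
  by rewrite -bE -aE -rE -!EFinM -EFinD lee_fin.
have h2 : a <= (1 + e1) * b + C * r.
  have mBN : measurable_fun setT (fun x => - (u_ k x - u x)) by exact: measurable_funN.
  have := hC _ _ mBN (mu_ k); rewrite pintN.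
  have -> : (fun x => - (u_ k x - u x) + u_ k x) = u by apply/funext => x; rewrite opprB subrK.
  by rewrite -bE -aE -rE -!EFinM -EFinD lee_fin.
have Cr : C * r <= e / 4.
  have : r <= e / (4 * C) by rewrite -lee_fin rE ltW.
  by rewrite -(ler_pM2l C0) (_ : C * (e / (4 * C)) = e / 4)//; field; rewrite gt_eqF.
rewrite /= -bE; apply: (@quasi_close _ a b (C * r) e) => //.
by rewrite Cr mulr_ge0// ltW.
Unshelve. all: by end_near. Qed.

End Pint.

Lemma cvg_norm0 (R : realType) (u : nat -> R) :
  u k @[k --> \oo] --> 0 -> `|u k| @[k --> \oo] --> 0.
Proof.
move=> /cvgrPdist_le u0; apply/cvgrPdist_le => e e0.
by move: (u0 _ e0); apply: filterS => k; rewrite !sub0r !normrN normr_id.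
Qed.

Section BrezisLieb.
Context d (T : measurableType d) (R : realType).
Variable mu : {measure set T -> \bar R}.
Implicit Types (w : T -> R) (p : R).

Lemma powR_cvg (p : R) (u : nat -> R) (l : R) : 0 < p ->
  u k @[k --> \oo] --> l -> (`|u k| `^ p) @[k --> \oo] --> `|l| `^ p.
Proof.
move=> p0 ul.
have cu : (fun k => 1 * (u k - l)) @ \oo --> 0.
  rewrite -[X in _ --> X](mulr0 1) -(subrr l).
  by apply: cvgMr; apply: cvgB => //; exact: cvg_cst.
apply/cvgrPdist_le => e e0.
pose e1 := Num.min 1 (e / (4 * (`|l| `^ p + 1) + e)).
have a0 : 0 <= `|l| `^ p := powR_ge0 _ _.
have e10 : 0 < e1 by rewrite lt_min ltr01 divr_gt0//; lra.
have [C C0 hC] := powR_normD_le p0 e10.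
have s0 : 0 < (e / (4 * C)) `^ p^-1 by rewrite powR_gt0// divr_gt0// mulr_gt0.
move/cvgrPdist_lt/(_ _ s0): cu; apply: filter_app; near=> k.
rewrite sub0r mul1r normrN => h.
have hs : C * `|u k - l| `^ p <= e / 4.
  have : `|u k - l| `^ p <= e / (4 * C).
    have -> : e / (4 * C) = ((e / (4 * C)) `^ p^-1) `^ p.
      by rewrite -powRrM mulVf ?gt_eqF// powRr1// divr_ge0 ?mulr_ge0// ltW.
    by apply: ge0_ler_powR; rewrite ?nnegrE ?powR_ge0 ?(ltW p0)// ltW.
  by rewrite -(ler_pM2l C0) (_ : C * (e / (4 * C)) = e / 4)//; field; rewrite gt_eqF.
apply: (quasi_close e0 a0 (s := C * `|u k - l| `^ p)).
- by rewrite hs mulr_ge0 ?powR_ge0// ltW.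
- by have := hC (u k - l) l; rewrite subrK.
- by have := hC (- (u k - l)) (u k); rewrite normrN opprB subrK.
Unshelve. all: by end_near. Qed.

Lemma brezis_lieb p w (g : nat -> T -> R) (M : R) : 0 < p ->
  measurable_fun setT w -> (forall k, measurable_fun setT (g k)) ->
  (pint mu p w < +oo)%E -> (forall k, pint mu p (g k) <= M%:E)%E ->
  {ae mu, forall x, g k x @[k --> \oo] --> 0} ->
  (fine (pint mu p (fun x => w x + g k x)) - fine (pint mu p (g k))) @[k --> \oo] -->
    fine (pint mu p w).
Proof.
move=> p0 mw mg wfin gM gae.
have M0 : 0 <= M by rewrite -lee_fin (le_trans _ (gM 0%N)) ?pint_ge0.
have gfin k : (pint mu p (g k) < +oo)%E by apply: le_lt_trans (gM k) _; rewrite ltry.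
have mwg k : measurable_fun setT (fun x => w x + g k x) by exact: measurable_funD.
have wgfin k : (pint mu p (fun x => w x + g k x)%R < +oo)%E by exact: (pintD_fin p0 mw (mg k) wfin (gfin k)).
pose A k x := `|w x + g k x| `^ p - `|g k x| `^ p - `|w x| `^ p.
have mA k : measurable_fun setT (A k).
  by apply: measurable_funB; [apply: measurable_funB|]; exact: measurable_pw.
have iW := pint_integrable mw wfin.
have iG k := pint_integrable (mg k) (gfin k).
have iWG k := pint_integrable (mwg k) (wgfin k).
have AE k : fine (pint mu p (fun x => w x + g k x)) - fine (pint mu p (g k)) -
    fine (pint mu p w) = fine (\int[mu]_x (A k x)%:E)%E.
  have -> : (\int[mu]_x (A k x)%:E = pint mu p (fun x => w x + g k x)%R
      - pint mu p (g k) - pint mu p w)%E.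
    have E1 := integralB measurableT (iWG k) (iG k).
    have E2 := integralB measurableT (integrableB measurableT (iWG k) (iG k)) iW.
    rewrite /pint -E1 -E2; apply: eq_integral => x _ /=.
    by rewrite !EFinB.
  move: (pint_fin (wgfin k)) (pint_fin (gfin k)) (pint_fin wfin).
  by move: (pint _ _ _) (pint _ _ _) (pint _ _ _) => [a| |] [b| |] [c| |].
have key (e : R) : 0 < e -> \forall k \near \oo,
    (\int[mu]_x `|(A k x)%:E| <= (e * (1 + M))%:E)%E.
  move=> e0; have [C C0 hC] := powR_normB_le p0 e0.
  (* [g k] is bounded only in norm, so [A k] has no integrable majorant. Subtracting [e |g k|^p] and
     truncating at 0 leaves a function below [(C + 1) |w|^p], to which dominated convergence
     applies; what was subtracted has integral at most [e M]. *)
  pose W k x := Num.max (`|A k x| - e * `|g k x| `^ p) 0.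
  have mW k : measurable_fun setT (W k).
    apply: measurable_maxr; last exact: measurable_cst.
    apply: measurable_funB; first exact: measurableT_comp.
    by apply: measurable_funM; [exact: measurable_cst|exact: measurable_pw].
  have W0 k x : 0 <= W k x by rewrite le_max lexx orbT.
  have WC k x : W k x <= (C + 1) * `|w x| `^ p.
    rewrite ge_max mulr_ge0 ?powR_ge0 ?addr_ge0 ?(ltW C0)// andbT.
    have h1 := hC (w x) (g k x); have h2 := ler_normB (`|w x + g k x| `^ p - `|g k x| `^ p) (`|w x| `^ p).
    rewrite [X in _ <= _ + X]ger0_norm ?powR_ge0// -/(A k x) in h2.
    lra.
  have Wae : {ae mu, forall x, (W k x)%:E @[k --> \oo] --> 0%E}.
    apply: filterS gae => x gx; apply: cvg_EFin; first by near=> k.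
    have -> : (fine \o (fun k => (W k x)%:E)) = (fun k => W k x) by [].
    have c1 : `|g k x| `^ p @[k --> \oo] --> 0.
      by have := powR_cvg p0 gx; rewrite normr0 powR0 ?gt_eqF.
    have c2 : `|w x + g k x| `^ p @[k --> \oo] --> `|w x| `^ p.
      by apply: powR_cvg => //; rewrite -[X in _ --> X]addr0; apply: cvgD => //; exact: cvg_cst.
    have c3 : A k x @[k --> \oo] --> 0.
      rewrite -[X in _ --> X](subrr (`|w x| `^ p)); apply: cvgB; last exact: cvg_cst.
      by rewrite -[X in _ --> X]subr0; exact: cvgB.
    have c4 : `|A k x| - e * `|g k x| `^ p @[k --> \oo] --> 0.
      rewrite -[X in _ --> X]subr0; apply: cvgB; first exact: cvg_norm0.
      by rewrite -[X in _ --> X](mulr0 e); apply: cvgMr.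
    apply: (@squeeze_cvgr _ _ _ _ (fun=> 0) (fun k => `| `|A k x| - e * `|g k x| `^ p|)).
    - by near=> k; rewrite W0/= ge_max normr_ge0 ler_norm.
    - exact: cvg_cst.
    - exact: cvg_norm0.
  have [|||||_ _] := @dominated_convergence _ _ _ mu setT measurableT
      (fun k x => (W k x)%:E) (cst 0%E) (fun x => ((C + 1)%:E * (`|w x| `^ p)%:E)%E).
  - by move=> k; exact/measurable_EFinP.
  - exact: measurable_cst.
  - by apply: filterS Wae => x h _.
  - exact: integrableZl.
  - by apply: nearW => x k _; rewrite -EFinM lee_fin ger0_norm.
  rewrite integral_cst// mul0e => /fine_cvgP[Wf /cvgrPdist_lt/(_ e e0)].
  move: Wf; apply: filter_app2; near=> k => Wf.
  rewrite sub0r normrN ger0_norm ?fine_ge0//; last first.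
    by apply: integral_ge0 => x _; rewrite lee_fin.
  move=> We.
  have mWE : measurable_fun setT (fun x => (W k x)%:E) by exact/measurable_EFinP.
  have mgE : measurable_fun setT (fun x => (`|g k x| `^ p)%:E).
    exact/measurable_EFinP/measurable_pw.
  have meg : measurable_fun setT (fun x => (e%:E * (`|g k x| `^ p)%:E)%E).
    exact: measurable_funeM.
  have g0 x : (0 <= (`|g k x| `^ p)%:E :> \bar R)%E by rewrite lee_fin powR_ge0.
  have eg0 x : (0 <= e%:E * (`|g k x| `^ p)%:E :> \bar R)%E.
    by rewrite mule_ge0// lee_fin ltW.
  have W0E x : (0 <= (W k x)%:E :> \bar R)%E by rewrite lee_fin.
  apply: (@le_trans _ _ (\int[mu]_x ((W k x)%:E + e%:E * (`|g k x| `^ p)%:E))%E).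
    apply: integralT_le.
    - by apply/measurable_EFinP; exact: measurableT_comp.
    - exact: emeasurable_funD.
    - by move=> x.
    - by move=> x; rewrite -EFinM -EFinD lee_fin /W -lerBlDr le_max lexx.
  rewrite (integralT_D mu mWE meg W0E eg0) (integralT_Z mu (ltW e0) mgE g0).
  rewrite mulrDr mulr1 EFinD; apply: leeD.
    by have := ltW We; rewrite /= -lee_fin fineK.
  by rewrite EFinM; apply: lee_wpmul2l; [rewrite lee_fin ltW|exact: gM].
apply/cvgrPdist_le => e e0.
have M1 : 0 < 1 + M by lra.
have eM : 0 < e / (1 + M) by rewrite divr_gt0.
move: (key _ eM); apply: filter_app; near=> k => h.
rewrite distrC AE.
have iA : mu.-integrable setT (fun x => (A k x)%:E).
  have := integrableB measurableT (integrableB measurableT (iWG k) (iG k)) iW.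
  by apply: eq_integrable => // x _ /=; rewrite !EFinB.
have fA := integrable_fin_num measurableT iA.
rewrite -lee_fin -fine_abse// fineK ?abse_fin_num//.
apply: le_trans (le_abse_integral _ measurableT (measurable_int _ iA)) _.
apply: le_trans h _; rewrite lee_fin divfK// gt_eqF//.
Unshelve. all: by end_near. Qed.
End BrezisLieb.

(** * Minkowski inequality and the truncated kernel *)

Section SquaredNorm.
Context d (T : measurableType d) (R : realType).
Variable mu : {measure set T -> \bar R}.
Implicit Types (u v : T -> R) (p : R).
Local Open Scope ereal_scope.

Definition psq p u : \bar R := pint mu p u `^ (2 / p).

Lemma psq_Lnorm p u : (2 <= p)%R ->
  psq p u = Lnorm mu (p / 2)%:E (fun x => (u x ^+ 2)%:E).
Proof.
move=> p2; rewrite /psq unlock.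
have -> : ((p / 2)^-1 = 2 / p)%R by rewrite invf_div.
congr (_ `^ _); apply: eq_integral => x _.
transitivity ((`|u x ^+ 2| `^ (p / 2))%:E)%R; last by rewrite -poweR_EFin.
congr (_%:E).
rewrite normrX -powR_mulrn// -powRrM; congr (_ `^ _)%R.
by rewrite mulrC divfK.
Qed.

(** Minkowski's inequality in [L^(p/2)], applied to squares; here [p >= 2] enters. It recombines the
    L^p norms of localized pieces. *)
Lemma psq_sum p I (r : seq I) u (v : I -> T -> R) : (2 <= p)%R ->
  measurable_fun setT u -> (forall i, measurable_fun setT (v i)) ->
  (forall x, u x ^+ 2 <= \sum_(i <- r) v i x ^+ 2)%R ->
  psq p u <= \sum_(i <- r) psq p (v i).
Proof.
move=> p2 mu' mv uv.
have q1 : (1 <= p / 2)%R by lra.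
have q0 : (p / 2 != 0)%R by lra.
have ms (w : T -> R) : measurable_fun setT w -> measurable_fun setT (fun x => w x ^+ 2)%R.
  by move=> mw; exact: measurable_funX.
have EE (y : R) : `|y%:E| `^ (p / 2) = ((`|y| `^ (p / 2))%R)%:E.
  by rewrite -poweR_EFin.
pose S (r : seq I) x : R := (\sum_(i <- r) v i x ^+ 2)%R.
have mS r' : measurable_fun setT (S r') by apply: measurable_sum => i; exact: ms.
apply: (@le_trans _ _ (Lnorm mu (p / 2)%:E (EFin \o S r))).
  rewrite psq_Lnorm// unlock; apply: gt0_ler_poweR.
  - by rewrite invr_ge0; lra.
  - rewrite in_itv/= leey andbT; apply: integral_ge0 => x _.
    by rewrite ?EE lee_fin powR_ge0.
  - rewrite in_itv/= leey andbT; apply: integral_ge0 => x _.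
    by rewrite ?EE lee_fin powR_ge0.
  - apply: integralT_le.
    + under eq_fun do rewrite ?EE.
      by apply/measurable_EFinP; apply: measurable_pw; exact: ms.
    + under eq_fun do rewrite ?EE.
      by apply/measurable_EFinP; exact: measurable_pw.
    + by move=> x; rewrite ?EE lee_fin powR_ge0.
    + move=> x; rewrite !EE lee_fin; apply: ge0_ler_powR; rewrite ?nnegrE//; first by lra.
      by rewrite !ger0_norm ?sqr_ge0// /S ?(le_trans _ (uv x)) ?sqr_ge0.
elim: r {uv} => [|i r IH].
  rewrite big_nil (_ : EFin \o _ = cst 0) ?Lnorm0//.
  by apply/funext => x; rewrite /S/= big_nil.
rewrite big_cons; apply: le_trans (leeD2l _ IH); rewrite psq_Lnorm//.
apply: le_trans (minkowski_EFin mu (ms _ (mv i)) (mS r) q1).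
rewrite le_eqVlt; apply/orP; left; apply/eqP; apply: eq_Lnorm => x.
by rewrite /= /S big_cons.
Qed.

End SquaredNorm.

Section Kernel.
Context {R : realType}.

Lemma dyadic_bracket (t : R) : 1 <= t -> exists j : nat, 2 ^+ j <= t < 2 ^+ j.+1.
Proof.
move=> t1; have [k tk] : exists k : nat, t < 2 ^+ k.
  exists (Num.truncn t).+1; apply: lt_le_trans (truncnS_gt t) _.
  by rewrite -natrX ler_nat ltnW// ltn_expl.
have := ex_minnP (ex_intro (fun k => t < 2 ^+ k) k tk) => -[m tm mmin].
case: m tm mmin => [|m] tm mmin; first by rewrite expr0 ltNge t1 in tm.
exists m; rewrite tm andbT leNgt; apply/negP => /mmin.
by rewrite ltnn.
Qed.

Lemma nneseries_geometric_le (C r : R) : 0 <= C -> 0 < r < 1 ->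
  (\sum_(0 <= j <oo) (C * r ^+ j)%:E <= (C / (1 - r))%:E)%E.
Proof.
move=> C0 /andP[r0 r1]; apply: lime_le.
  by apply: is_cvg_nneseries => j _ _; rewrite lee_fin mulr_ge0// exprn_ge0// ltW.
apply: nearW => N; rewrite sumEFin lee_fin.
rewrite -[leLHS]/(series (geometric C r) N) geometric_seriesE; last by rewrite lt_eqF.
rewrite /= -mulrA; apply: ler_wpM2l => //.
rewrite -[leRHS]mul1r; apply: ler_wpM2r; rewrite ?invr_ge0 ?subr_ge0 ?(ltW r1)//.
by rewrite lerBlDr lerDl exprn_ge0// ltW.
Qed.

Variables (n : nat) (sigma : R).
Local Notation a := (n%:R + 2 * sigma).

Definition ker (w : 'rV[R]_n) : R := Num.min 1 (enorm w ^+ 2) / (enorm w) `^ a.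

Lemma measurable_ker : measurable_fun setT ker.
Proof.
apply: measurable_funM.
  apply: measurable_minr; first exact: measurable_cst.
  by apply: measurable_funX; exact: measurable_enorm.
rewrite (_ : (fun _ => _) = fun w : 'rV[R]_n => (enorm w) `^ (- a)).
  exact: (measurableT_comp (measurable_powR _) (@measurable_enorm R n)).
by apply/funext => w; rewrite powRN.
Qed.

Lemma ker_ge0 w : 0 <= ker w.
Proof. by rewrite divr_ge0 ?powR_ge0// le_min ler01 sqr_ge0. Qed.

(** Dyadic shells take the place of polar coordinates. Those near infinity contribute a geometric
    series of ratio [2^(-2 sigma)], those near 0 one of ratio [2^(-(2 - 2 sigma))]; both converge
    for [0 < sigma < 1]. *)
Lemma ker_fin : (2 <= n)%N -> 0 < sigma < 1 ->
  exists C : R, (\int[leb n]_w (ker w)%:E <= C%:E)%E.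
Proof.
move=> n2 /andP[s0 s1].
have n2R : 2 <= n%:R :> R by rewrite ler_nat.
have two0 : 0 < 2 :> R by [].
have two2 : (2:R) `^ 2 = 4 by rewrite powR_mulrn// expr2; ring.
pose r1 : R := 2 `^ (- (2 * sigma)); pose r2 : R := 2 `^ (- (2 - 2 * sigma)).
have r_lt (b : R) : 0 < b -> 0 < (2:R) `^ (- b) < 1.
  move=> b0; rewrite powR_gt0//= powRN invf_lt1 ?powR_gt0//.
  have := @gt0_ltr_powR R b b0 1 2; rewrite powR1; apply; rewrite ?nnegrE//; lra.
have r10 : 0 < r1 < 1 by apply: r_lt; lra.
have r20 : 0 < r2 < 1 by apply: r_lt; lra.
have pw (j : nat) : (2:R) ^+ j = 2 `^ j%:R by rewrite powR_mulrn.
(* The first term dominates the kernel where [2^j <= |w| < 2^(j+1)], the second where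
   [2^-(j+1) < |w| <= 2^-j]. Balls stand in for the shells, because a bound on their measure is at
   hand. *)
pose F j (w : 'rV[R]_n) : R := 2 `^ (- (j%:R * a)) * \1_(eball 0 (2 ^+ j.+1)) w +
   2 `^ (j.+1%:R * (a - 2)) * \1_(eball 0 (2 / 2 ^+ j)) w.
have mF j : measurable_fun setT (F j).
  apply: measurable_funD; apply: measurable_funM; try exact: measurable_cst.
  - exact: (measurable_indic (measurable_eball _ _)).
  - exact: (measurable_indic (measurable_eball _ _)).
have F0 j w : 0 <= F j w by rewrite addr_ge0// mulr_ge0// powR_ge0.
have kF w : ((ker w)%:E <= \sum_(0 <= j <oo) (F j w)%:E)%E.
  suff [j hj] : exists j, ker w <= F j w.
    apply: le_trans (nneseries_lim_ge j.+1 _); last by move=> *; rewrite lee_fin.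
    rewrite big_nat_recr//=; apply: le_trans (_ : (F j w)%:E <= _)%E; first by rewrite lee_fin.
    by rewrite leeDr// sume_ge0// => *; rewrite lee_fin.
  have [->|w0] := eqVneq w 0.
    by exists 0%N; rewrite /ker enorm0 expr0n/= (min_idPr ler01) mul0r.
  have e0 : 0 < enorm w by rewrite lt_neqAle enorm_ge0 andbT eq_sym enorm_eq0.
  have [e1|e1] := leP 1 (enorm w).
    have [j /andP[j1 j2]] := dyadic_bracket e1; exists j.
    have wB : w \in eball 0 (2 ^+ j.+1) by rewrite inE /eball/= subr0.
    rewrite /F [\1_(eball 0 (2 ^+ j.+1)) w]indicE wB mulr1 /ker.
    apply: le_trans (_ : 2 `^ (- (j%:R * a)) <= _); last by rewrite lerDl mulr_ge0// powR_ge0.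
    apply: (@le_trans _ _ (1 / enorm w `^ a)).
      by rewrite ler_wpM2r ?invr_ge0 ?powR_ge0// ge_min lexx.
    rewrite powRN mul1r lef_pV2 ?posrE ?powR_gt0// powRrM -pw.
    by apply: ge0_ler_powR; rewrite ?nnegrE ?exprn_ge0 ?enorm_ge0//; lra.
  have e1' : 1 <= (enorm w)^-1 by rewrite invf_ge1// ltW.
  have [j /andP[j1 j2]] := dyadic_bracket e1'; exists j.
  have wB : w \in eball 0 (2 / 2 ^+ j).
    rewrite inE /eball/= subr0; apply: (@le_lt_trans _ _ (2 ^+ j)^-1).
      by rewrite -[leLHS]invrK lef_pV2 ?posrE ?invr_gt0 ?exprn_gt0.
    by rewrite -[ltLHS]mul1r ltr_pM2r ?invr_gt0 ?exprn_gt0// ltr1n.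
  rewrite /F [\1_(eball 0 (2 / 2 ^+ j)) w]indicE wB mulr1 /ker.
  apply: le_trans (_ : 2 `^ (j.+1%:R * (a - 2)) <= _); last by rewrite lerDr mulr_ge0// powR_ge0.
  apply: (@le_trans _ _ (enorm w ^+ 2 / enorm w `^ a)).
    by rewrite ler_wpM2r ?invr_ge0 ?powR_ge0// ge_min lexx orbT.
  have -> : enorm w ^+ 2 / enorm w `^ a = (enorm w)^-1 `^ (a - 2).
    have -> : (enorm w)^-1 = enorm w `^ (-1) by rewrite powR_inv1 ?enorm_ge0.
    rewrite -powRrM -powR_mulrn ?enorm_ge0// -powRN -powRD.
      by congr (_ `^ _); ring.
    by apply/implyP => _; rewrite gt_eqF.
  rewrite powRrM -pw; apply: ge0_ler_powR; rewrite ?nnegrE ?exprn_ge0 ?invr_ge0 ?enorm_ge0//; last exact: ltW.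
  by lra.
pose C1 : R := 4 ^+ n; pose C2 : R := 2 `^ (a - 2) * 4 ^+ n.
have C10 : 0 <= C1 by rewrite exprn_ge0.
have C20 : 0 <= C2 by rewrite mulr_ge0 ?powR_ge0 ?exprn_ge0.
have intF j : (\int[leb n]_w (F j w)%:E <= (C1 * r1 ^+ j)%:E + (C2 * r2 ^+ j)%:E)%E.
  have mI (r : R) : measurable_fun setT (fun w : 'rV[R]_n => (\1_(eball 0 r) w : R)%:E).
    by apply/measurable_EFinP; exact: (measurable_indic (measurable_eball _ _)).
  have I0 (r : R) (w : 'rV[R]_n) : (0 <= (\1_(eball 0 r) w : R)%:E)%E by rewrite lee_fin.
  have II (r : R) : 0 <= r -> (\int[leb n]_w (\1_(eball 0 r) w : R)%:E <= ((2 * r) ^+ n)%:E)%E.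
    by move=> r0; rewrite integral_indicT ?leb_eball_le//; exact: measurable_eball.
  have P0 (b : R) : 0 <= (2:R) `^ b by exact: powR_ge0.
  rewrite /F; under eq_integral do rewrite EFinD !EFinM.
  rewrite integralT_D; last 4 first.
  - exact: measurable_funeM.
  - exact: measurable_funeM.
  - by move=> w; rewrite mule_ge0// lee_fin.
  - by move=> w; rewrite mule_ge0// lee_fin.
  rewrite !integralT_Z//; apply: leeD.
    apply: le_trans (lee_wpmul2l _ (II _ _)) _; rewrite ?lee_fin ?exprn_ge0//.
    rewrite -?EFinM ?lee_fin le_eqVlt; apply/orP; left; apply/eqP.
    rewrite /C1 /r1 -!powR_mulrn ?powR_ge0// ?mulr_ge0 ?exprn_ge0//.
    have -> : 2 * 2 `^ j.+1%:R = (2:R) `^ (2 + j%:R).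
      by rewrite powR_mulrn// -exprS -powR_mulrn//; congr (_ `^ _); rewrite -natr1 -natr1; ring.
    rewrite -two2.
    rewrite -!powRrM -!powRD; try by apply/implyP => _; rewrite gt_eqF.
    by congr (_ `^ _); ring.
  apply: le_trans (lee_wpmul2l _ (II _ _)) _; rewrite ?lee_fin ?divr_ge0 ?exprn_ge0//.
  rewrite -?EFinM ?lee_fin le_eqVlt; apply/orP; left; apply/eqP.
  rewrite /C2 /r2 -!powR_mulrn ?powR_ge0// ?mulr_ge0 ?invr_ge0 ?exprn_ge0//.
  have -> : 2 * (2 / 2 `^ j%:R) = (2:R) `^ (2 - j%:R).
    rewrite powRB; last by apply/implyP => _; rewrite gt_eqF.
    by rewrite two2; ring.
  rewrite -two2.
  rewrite -!powRrM -!powRD; try by apply/implyP => _; rewrite gt_eqF.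
  by congr (_ `^ _); rewrite -natr1; ring.
exists (C1 / (1 - r1) + C2 / (1 - r2)).
apply: (@le_trans _ _ (\int[leb n]_w \sum_(0 <= j <oo) (F j w)%:E)%E).
  apply: integralT_le.
  - by apply/measurable_EFinP; exact: measurable_ker.
  - by apply: ge0_emeasurable_sum => *; [rewrite lee_fin|apply/measurable_EFinP].
  - by move=> w; rewrite lee_fin ker_ge0.
  - exact: kF.
rewrite integral_nneseries//; last 2 first.
- by move=> j; exact/measurable_EFinP.
- by move=> j w _; rewrite lee_fin.
apply: (@le_trans _ _ (\sum_(0 <= j <oo) ((C1 * r1 ^+ j)%:E + (C2 * r2 ^+ j)%:E))%E).
  by apply: lee_nneseries => j *; [apply: integralT_ge0 => w; rewrite lee_fin|exact: intF].
have r1p := proj1 (andP r10); have r2p := proj1 (andP r20).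
rewrite nneseriesD; last 2 first.
- by move=> j *; rewrite lee_fin mulr_ge0// exprn_ge0// ltW.
- by move=> j *; rewrite lee_fin mulr_ge0// exprn_ge0// ltW.
by rewrite EFinD; apply: leeD; exact: nneseries_geometric_le.
Qed.

End Kernel.

(** * Energy, L^p integral, and the space H0 *)

Definition rst {R : realType} (n : nat) (Om : set 'rV[R]_n) (u : 'rV[R]_n -> R) x : R :=
  \1_Om x * u x.

(** A signed square root of the energy density. It is linear in [u], so the energy becomes a [pint]
    of exponent 2 on the product space and shares the convergence and Brezis-Lieb lemmas with the
    L^p integral. *)
Definition gag {R : realType} (n : nat) (sigma : R) (Om : set 'rV[R]_n) (u : 'rV[R]_n -> R)
  (z : 'rV[R]_n * 'rV[R]_n) : R :=
  (\1_Om z.1 * \1_Om z.2) * ((u z.1 - u z.2) / enorm (z.1 - z.2) `^ ((n%:R + 2 * sigma) / 2)).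

(* These are sealed because unification otherwise unfolds the measures. *)
HB.lock Definition energy {R : realType} (n : nat) (sigma : R) (Om : set 'rV[R]_n)
  (u : 'rV[R]_n -> R) : \bar R := pint (leb n \x leb n)%E 2 (gag sigma Om u).

HB.lock Definition lpow {R : realType} (n : nat) (sigma : R) (Om : set 'rV[R]_n)
  (u : 'rV[R]_n -> R) : \bar R := pint (leb n) (pstar n sigma) (rst Om u).

HB.lock Definition mass {R : realType} (n : nat) (Om : set 'rV[R]_n)
  (u : 'rV[R]_n -> R) : \bar R := pint (leb n) 2 (rst Om u).

Arguments energy {R n} sigma Om%_classical_set_scope u%_ring_scope.
Arguments lpow {R n} sigma Om%_classical_set_scope u%_ring_scope.
Arguments mass {R n} Om%_classical_set_scope u%_ring_scope.

Section Functionals.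
Context {R : realType} (n : nat) (sigma : R).
Hypothesis (n2 : (2 <= n)%N) (s0 : 0 < sigma) (s1 : sigma < 1).
Implicit Types (u v : 'rV[R]_n -> R) (Om A : set 'rV[R]_n).
Local Notation p := (pstar n sigma).
Local Notation a := (n%:R + 2 * sigma).
Local Notation mu := (leb n).
Local Notation mu2 := ((leb n \x leb n)%E).

Lemma measurable_rvB2 : measurable_fun setT (fun z : 'rV[R]_n * 'rV[R]_n => z.1 - z.2).
Proof.
apply: measurable_rv => i.
rewrite (_ : (fun _ => _) = fun z : 'rV[R]_n * 'rV[R]_n => z.1 ord0 i - z.2 ord0 i).
  apply: measurable_funB.
    exact: (measurableT_comp (measurable_coord i) measurable_fst).
  exact: (measurableT_comp (measurable_coord i) measurable_snd).
by apply/funext => z; rewrite !mxE.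
Qed.

Lemma n_ge2 : 2 <= n%:R :> R.
Proof. by rewrite ler_nat. Qed.

Lemma dim_sub_gt0 : 0 < n%:R - 2 * sigma.
Proof. by have := n_ge2; move: (n%:R : R) => N; have := s1; lra. Qed.

Lemma pstar_gt2 : 2 < p.
Proof.
have d0 := dim_sub_gt0; have h := n_ge2.
rewrite /pstar ltr_pdivlMr//; move: (n%:R : R) h d0 => N h d0.
by have := s0; lra.
Qed.

Lemma pstar_gt0 : 0 < p.
Proof. by have := pstar_gt2; lra. Qed.

Lemma two_div_pstar : (n%:R - 2 * sigma) / n%:R = 2 / p.
Proof.
have d0 := dim_sub_gt0; have h := n_ge2.
rewrite /pstar; move: (n%:R : R) h d0 => N h d0.
by field; apply/andP; split; rewrite gt_eqF//; lra.
Qed.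

Lemma measurable_rst Om u : measurable Om -> measurable_fun setT u ->
  measurable_fun setT (rst Om u).
Proof. by move=> mO mu'; apply: measurable_funM => //; exact: measurable_indic. Qed.

Lemma measurable_gag Om u : measurable Om -> measurable_fun setT u ->
  measurable_fun setT (gag sigma Om u).
Proof.
move=> mO mu'.
have m1 : measurable_fun setT (fun z : 'rV[R]_n * 'rV[R]_n => (\1_Om z.1 : R)).
  exact: (measurableT_comp (measurable_indic mO) measurable_fst).
have m2 : measurable_fun setT (fun z : 'rV[R]_n * 'rV[R]_n => (\1_Om z.2 : R)).
  exact: (measurableT_comp (measurable_indic mO) measurable_snd).
have u1 : measurable_fun setT (fun z : 'rV[R]_n * 'rV[R]_n => u z.1).
  exact: (measurableT_comp mu' measurable_fst).
have u2 : measurable_fun setT (fun z : 'rV[R]_n * 'rV[R]_n => u z.2).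
  exact: (measurableT_comp mu' measurable_snd).
have mk : measurable_fun setT (fun z : 'rV[R]_n * 'rV[R]_n => (enorm (z.1 - z.2) `^ (a / 2))^-1).
  rewrite (_ : (fun _ => _) = fun z : 'rV[R]_n * 'rV[R]_n => (enorm (z.1 - z.2)) `^ (- (a / 2))).
    apply: (measurableT_comp (measurable_powR _)).
    exact: (measurableT_comp (@measurable_enorm R n) measurable_rvB2).
  by apply/funext => z; rewrite powRN.
by apply: measurable_funM; [exact: measurable_funM|apply: measurable_funM => //; exact: measurable_funB].
Qed.

Lemma indic01 Om (x : 'rV[R]_n) : (\1_Om x = 0 :> R) \/ (\1_Om x = 1 :> R).
Proof. by rewrite indicE; case: (_ \in _); [right|left]. Qed.

Lemma gag_sqr Om u z : `|gag sigma Om u z| `^ 2 =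
  (\1_Om z.1 * \1_Om z.2) * ((u z.1 - u z.2) ^+ 2 / enorm (z.1 - z.2) `^ a).
Proof.
rewrite powR_mulrn// real_normK ?num_real// /gag exprMn [(_ / _) ^+ 2]exprMn exprVn.
have -> : (enorm (z.1 - z.2) `^ (a / 2)) ^+ 2 = enorm (z.1 - z.2) `^ a.
  by rewrite -powR_mulrn ?powR_ge0// -powRrM divfK.
congr (_ * _); case: (indic01 Om z.1) => ->; case: (indic01 Om z.2) => ->;
  by rewrite ?mul0r ?mulr0 ?mulr1 ?expr0n ?expr1n.
Qed.

Lemma IgagE Om u : measurable Om -> measurable_fun setT u ->
  Igag sigma Om u = energy sigma Om u.
Proof.
rewrite energy.unlock; move=> mO mu'; have mg := measurable_pw 2 (measurable_gag mO mu').
pose f (z : 'rV[R]_n * 'rV[R]_n) : \bar R := (`|gag sigma Om u z| `^ 2)%:E.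
have mf : measurable_fun setT f by apply/measurable_EFinP.
have f0 z : (0 <= f z)%E by rewrite lee_fin powR_ge0.
have mfx x : measurable_fun setT (fun y => f (x, y)).
  exact: (measurableT_comp mf (pair1_measurable x)).
transitivity (\int[mu]_x \int[mu]_y f (x, y))%E; last first.
  by rewrite /pint (fubini_tonelli1 f mf f0).
have E x : Rn_int (fun y => ((\1_Om x * \1_Om y) *
     ((u x - u y) ^+ 2 / (enorm (x - y)) `^ a))%:E) = (\int[mu]_y f (x, y))%E.
  transitivity (Rn_int (fun y => f (x, y))); last exact: (lebE (mfx x) (fun=> f0 _)).
  by congr Rn_int; apply/funext => y; rewrite /f gag_sqr.
rewrite /Igag (_ : (fun x => Rn_int _) = (fun x => \int[mu]_y f (x, y)))%E; last exact/funext.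
apply: lebE; last by move=> x; exact: integralT_ge0.
exact: (measurable_fun_fubini_tonelli_F f mf).
Qed.

Lemma LintE Om u : measurable Om -> measurable_fun setT u ->
  Lint sigma Om u = lpow sigma Om u.
Proof.
rewrite lpow.unlock; move=> mO mu'; rewrite /Lint.
have E : (fun x => (\1_Om x * `|u x| `^ p)%:E) = (fun x => (`|rst Om u x| `^ p)%:E).
  apply/funext => x; rewrite /rst; case: (indic01 Om x) => ->.
    by rewrite !mul0r normr0 powR0// gt_eqF// pstar_gt0.
  by rewrite !mul1r.
rewrite E; apply: lebE; last by move=> x; rewrite lee_fin powR_ge0.
by apply/measurable_EFinP; apply: measurable_pw; exact: measurable_rst.
Qed.

Lemma rstB Om u v : rst Om (fun x => u x - v x) = (fun x => rst Om u x - rst Om v x).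
Proof. by apply/funext => x; rewrite /rst mulrBr. Qed.

Lemma rstD Om u v : rst Om (fun x => u x + v x) = (fun x => rst Om u x + rst Om v x).
Proof. by apply/funext => x; rewrite /rst mulrDr. Qed.

Lemma rstZ Om (c : R) u : rst Om (fun x => c * u x) = (fun x => c * rst Om u x).
Proof. by apply/funext => x; rewrite /rst mulrCA. Qed.

Lemma gagB Om u v : gag sigma Om (fun x => u x - v x) = (fun z => gag sigma Om u z - gag sigma Om v z).
Proof. by apply/funext => x; rewrite /gag; ring. Qed.

Lemma gagD Om u v : gag sigma Om (fun x => u x + v x) = (fun z => gag sigma Om u z + gag sigma Om v z).
Proof. by apply/funext => x; rewrite /gag; ring. Qed.

Lemma gagZ Om (c : R) u : gag sigma Om (fun x => c * u x) = (fun z => c * gag sigma Om u z).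
Proof. by apply/funext => x; rewrite /gag; ring. Qed.

Lemma C1c_measurable Om u : C1c Om u -> measurable_fun setT u.
Proof. by move=> [/C1_continuous uC _]; exact: continuous_measurable_rv. Qed.

Lemma C1cD Om u v : C1c Om u -> C1c Om v -> C1c Om (fun x => u x + v x).
Proof.
move=> [/C1P du [K [cK KO uK]]] [/C1P dv [K' [cK' KO' vK]]]; split.
  by apply/C1P => x; have [g hg] := du x; have [g' hg'] := dv x; exists (g + g'); exact: sdiffD.
exists (K `|` K'); split; first exact: compactU.
- by move=> x [/KO|/KO'].
- by move=> x Kx; rewrite uK ?vK ?addr0// => ?; apply: Kx; [right|left].
Qed.

Lemma C1cM Om u v : C1 v -> C1c Om u -> C1c Om (fun x => v x * u x).
Proof.
move=> /C1P dv [/C1P du [K [cK KO uK]]]; split.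
  apply/C1P => x; have [g hg] := du x; have [g' hg'] := dv x.
  by exists (v x *: g + u x *: g'); exact: sdiffM.
by exists K; split=> // x /uK ->; rewrite mulr0.
Qed.

Lemma C1cZ Om (c : R) u : C1c Om u -> C1c Om (fun x => c * u x).
Proof.
apply: C1cM; apply/C1P => x; exists 0; exact: sdiff_cst.
Qed.

(** Where [u^2 <= tau] the first term bounds the square. Elsewhere [u^2] is [|u|^p] times a negative
    power of [u^2], which is at most [tau^((2-p)/2)]. The free [tau] trades the measure of [A]
    against the L^p integral. *)
Lemma mass_le Om A u (tau : R) : measurable Om -> measurable A -> measurable_fun setT u ->
  A `<=` Om -> 0 < tau ->
  (mass A u <= tau%:E * mu A + (tau `^ ((2 - p) / 2))%:E * lpow sigma Om u)%E.
Proof.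
move=> mO mA mu' AO t0; rewrite lpow.unlock mass.unlock /pint.
have mr := measurable_rst mO mu'; have mrA := measurable_rst mA mu'.
have mL : measurable_fun setT (fun x => (`|rst Om u x| `^ p)%:E).
  by apply/measurable_EFinP; exact: measurable_pw.
have mI : measurable_fun setT (fun x => (\1_A x : R)%:E).
  by apply/measurable_EFinP; exact: measurable_indic.
rewrite -(integral_indicT mu mA) -(integralT_Z mu (ltW t0) mI); last by move=> x; rewrite lee_fin.
rewrite -(integralT_Z mu (powR_ge0 _ _) mL); last by move=> x; rewrite lee_fin powR_ge0.
rewrite -integralT_D; last 4 first.
- exact: measurable_funeM.
- exact: measurable_funeM.
- by move=> x; rewrite mule_ge0 ?lee_fin// ltW.
- by move=> x; rewrite mule_ge0 ?lee_fin ?powR_ge0.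
apply: integralT_le.
- by apply/measurable_EFinP; exact: measurable_pw.
- by apply: emeasurable_funD; exact: measurable_funeM.
- by move=> x; rewrite lee_fin powR_ge0.
move=> x; rewrite -!EFinM -EFinD lee_fin.
have rhs0 : 0 <= tau `^ ((2 - p) / 2) * `|rst Om u x| `^ p by rewrite mulr_ge0 ?powR_ge0.
have [Ax|nAx] := pselect (A x); last first.
  by rewrite /rst !indicE memNset//= mul0r normr0 powR0// mulr0 add0r; exact: rhs0.
have Ox := AO _ Ax.
rewrite /rst [\1_A x]indicE mem_set//= mul1r mulr1 [\1_Om x]indicE mem_set//= mul1r.
have [h|h] := leP (`|u x| `^ 2) tau.
  by apply: le_trans h _; rewrite lerDl mulr_ge0 ?powR_ge0.
have u0 : 0 < `|u x|.
  rewrite normr_gt0; apply/eqP => u0; move: h.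
  by rewrite u0 normr0 powR0// ltNge (ltW t0).
apply: le_trans (_ : tau `^ ((2 - p) / 2) * `|u x| `^ p <= _); last by rewrite lerDr ltW.
have -> : `|u x| `^ 2 = (`|u x| `^ 2) `^ ((2 - p) / 2) * `|u x| `^ p.
  rewrite -powRrM -powRD; last by apply/implyP => _; rewrite gt_eqF.
  by congr (_ `^ _); field.
rewrite ler_wpM2r ?powR_ge0//.
have e0 : (2 - p) / 2 = - ((p - 2) / 2) by field.
rewrite e0 !powRN lef_pV2 ?posrE ?powR_gt0//.
apply: ge0_ler_powR; rewrite ?nnegrE ?powR_ge0// ?(ltW t0) ?(ltW h)//.
by have := pstar_gt2; lra.
Qed.

Lemma energy_ge0 Om u : (0 <= energy sigma Om u)%E.
Proof. rewrite energy.unlock; exact: pint_ge0. Qed.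

Lemma lpow_ge0 Om u : (0 <= lpow sigma Om u)%E.
Proof. rewrite lpow.unlock; exact: pint_ge0. Qed.

Lemma mass_ge0 Om u : (0 <= mass Om u)%E.
Proof. rewrite mass.unlock; exact: pint_ge0. Qed.

Lemma energyZ Om c u : measurable Om -> measurable_fun setT u ->
  energy sigma Om (fun x => c * u x) = ((c ^+ 2)%:E * energy sigma Om u)%E.
Proof.
move=> mO mu'; rewrite energy.unlock gagZ pintZ; last exact: measurable_gag.
by rewrite powR_mulrn// real_normK ?num_real.
Qed.

Lemma lpowZ Om c u : measurable Om -> measurable_fun setT u ->
  lpow sigma Om (fun x => c * u x) = ((`|c| `^ p)%:E * lpow sigma Om u)%E.
Proof. by move=> mO mu'; rewrite lpow.unlock rstZ pintZ//; exact: measurable_rst. Qed.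

Lemma energyD_fin Om u v : measurable Om -> measurable_fun setT u -> measurable_fun setT v ->
  (energy sigma Om u < +oo)%E -> (energy sigma Om v < +oo)%E ->
  (energy sigma Om (fun x => u x + v x)%R < +oo)%E.
Proof.
rewrite energy.unlock => mO mu' mv fu fv; rewrite gagD.
exact: (@pintD_fin _ _ _ mu2 2 _ _ (ltr0Sn R 1) (measurable_gag mO mu') (measurable_gag mO mv) fu fv).
Qed.

Lemma lpowD_fin Om u v : measurable Om -> measurable_fun setT u -> measurable_fun setT v ->
  (lpow sigma Om u < +oo)%E -> (lpow sigma Om v < +oo)%E ->
  (lpow sigma Om (fun x => u x + v x)%R < +oo)%E.
Proof.
rewrite lpow.unlock => mO mu' mv fu fv; rewrite rstD.
exact: (@pintD_fin _ _ _ mu p _ _ pstar_gt0 (measurable_rst mO mu') (measurable_rst mO mv) fu fv).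
Qed.

Lemma energy_fineK Om u : (energy sigma Om u < +oo)%E ->
  (fine (energy sigma Om u))%:E = energy sigma Om u.
Proof. by move=> h; rewrite fineK// ge0_fin_numE// energy_ge0. Qed.

Lemma lpow_fineK Om u : (lpow sigma Om u < +oo)%E ->
  (fine (lpow sigma Om u))%:E = lpow sigma Om u.
Proof. by move=> h; rewrite fineK// ge0_fin_numE// lpow_ge0. Qed.

Lemma mass_fineK Om u : (mass Om u < +oo)%E -> (fine (mass Om u))%:E = mass Om u.
Proof. by move=> h; rewrite fineK// ge0_fin_numE// mass_ge0. Qed.

End Functionals.

(** * Limits in the extended reals and bounds for differences *)

Section ExtendedLimits.
Context {R : realType}.

Lemma squeeze0 (f g : nat -> \bar R) : (forall k, (0 <= f k)%E) -> (forall k, (f k <= g k)%E) ->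
  g k @[k --> \oo] --> 0%E -> f k @[k --> \oo] --> 0%E.
Proof.
move=> f0 fg g0; apply: (squeeze_cvge _ _ g0); last exact: cvg_cst.
by apply: nearW => k; rewrite f0 fg.
Qed.

Lemma cvg0Z (c : R) (f : nat -> \bar R) : f k @[k --> \oo] --> 0%E ->
  (c%:E * f k)%E @[k --> \oo] --> 0%E.
Proof.
by move=> f0; rewrite -[X in _ --> X](mule0 c%:E); apply: cvgeZl.
Qed.

Lemma cvg0D (f g : nat -> \bar R) : f k @[k --> \oo] --> 0%E -> g k @[k --> \oo] --> 0%E ->
  (f k + g k)%E @[k --> \oo] --> 0%E.
Proof. by move=> f0 g0; rewrite -[X in _ --> X](adde0 0%E); apply: cvgeD. Qed.

Lemma near_lt_cvg0 (e : R) (f : nat -> \bar R) : 0 < e -> f k @[k --> \oo] --> 0%E ->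
  \forall k \near \oo, (f k < e%:E)%E.
Proof.
move=> e0 f0; have h : nbhs (0%E : \bar R) [set x | (x < e%:E)%E].
  apply: (@open_nbhs_nbhs (\bar R)); split; first exact: open_ereal_lt_ereal.
  by rewrite /= lte_fin.
exact: f0 h.
Qed.

Lemma ex_lt_cvg0 (e : R) (f : nat -> \bar R) : 0 < e -> f k @[k --> \oo] --> 0%E ->
  exists N, forall k, (N <= k)%N -> (f k < e%:E)%E.
Proof. by move=> e0 /(near_lt_cvg0 e0)[N _ h]; exists N. Qed.

Lemma eq_cvg_ext (U : topologicalType) (f g : nat -> U) (l : U) : f =1 g ->
  f k @[k --> \oo] --> l -> g k @[k --> \oo] --> l.
Proof. by move=> /funext ->. Qed.

End ExtendedLimits.

Section PintLimits.
Context d (T : measurableType d) {R : realType} (mu : {measure set T -> \bar R}).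

Lemma pint_cvg0D (p : R) (u v : nat -> T -> R) : 0 < p ->
  (forall k, measurable_fun setT (u k)) -> (forall k, measurable_fun setT (v k)) ->
  pint mu p (u k) @[k --> \oo] --> 0%E -> pint mu p (v k) @[k --> \oo] --> 0%E ->
  pint mu p (fun x => u k x + v k x) @[k --> \oo] --> 0%E.
Proof.
move=> p0 mu' mv u0 v0; have [C C0 h] := pintD_le mu p0 (@ltr01 R).
apply: (squeeze0 (g := fun k => ((1 + 1)%:E * pint mu p (v k) + C%:E * pint mu p (u k))%E)).
- by move=> k; exact: pint_ge0.
- by move=> k; exact: h.
- exact: (cvg0D (cvg0Z (1 + 1) v0) (cvg0Z C u0)).
Qed.

End PintLimits.

Lemma pintB_bound d (T : measurableType d) {R : realType} (mu : {measure set T -> \bar R}) (p : R) :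
  0 < p -> forall L : R, exists2 L' : R, 0 <= L' & forall u w : T -> R,
  measurable_fun setT u -> measurable_fun setT w -> (pint mu p u <= L%:E)%E ->
  (pint mu p w <= L%:E)%E -> (pint mu p (fun x => u x - w x)%R <= L'%:E)%E.
Proof.
move=> p0 L; have [C C0 hC] := pintD_le mu p0 (@ltr01 R).
exists (2 * `|L| + C * `|L|); first by rewrite addr_ge0// mulr_ge0// ltW.
move=> u w mu' mw uL wL.
have mN : measurable_fun setT (fun x => - w x) by exact: measurableT_comp.
apply: (le_trans (hC _ _ mu' mN)).
have L1 : (L%:E <= `|L|%:E)%E by rewrite lee_fin ler_norm.
apply: (@le_trans _ _ ((1 + 1)%:E * `|L|%:E + C%:E * `|L|%:E)%E); last first.
  by rewrite -!EFinM -EFinD lee_fin; lra.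
rewrite pintN; apply: leeD; apply: lee_wpmul2l; rewrite ?lee_fin ?(ltW C0)//.
- exact: le_trans L1.
- exact: le_trans L1.
Qed.

Lemma energyB_bound {R : realType} (n : nat) (sigma : R) (Om : set 'rV[R]_n) (L : R) :
  measurable Om -> exists2 L' : R, 0 <= L' & forall u w : 'rV[R]_n -> R,
  measurable_fun setT u -> measurable_fun setT w ->
  (energy sigma Om u <= L%:E)%E -> (energy sigma Om w <= L%:E)%E ->
  (energy sigma Om (fun x => u x - w x)%R <= L'%:E)%E.
Proof.
move=> mO; have [L' L'0 h] := pintB_bound (leb n \x leb n)%E (ltr0Sn R 1) L.
exists L' => // u w mu mw; rewrite energy.unlock gagB; apply: h; exact: measurable_gag.
Qed.

Lemma lpowB_bound {R : realType} (n : nat) (sigma : R) : (2 <= n)%N -> 0 < sigma -> sigma < 1 ->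
  forall (L : R) (Om : set 'rV[R]_n), measurable Om -> exists2 L' : R, 0 <= L' &
  forall u w : 'rV[R]_n -> R, measurable_fun setT u -> measurable_fun setT w ->
  (lpow sigma Om u <= L%:E)%E -> (lpow sigma Om w <= L%:E)%E ->
  (lpow sigma Om (fun x => u x - w x)%R <= L'%:E)%E.
Proof.
move=> n2 s0 s1 L Om mO; have [L' L'0 h] := pintB_bound (leb n) (pstar_gt0 n2 s0 s1) L.
exists L' => // u w mu mw; rewrite lpow.unlock rstB; apply: h; exact: measurable_rst.
Qed.

Section SobolevSpace.
Context {R : realType} (n : nat) (sigma : R).
Hypothesis (n2 : (2 <= n)%N) (s0 : 0 < sigma) (s1 : sigma < 1).
Local Notation p := (pstar n sigma).
Local Notation mu := (leb n).
Let p0 : 0 < p := pstar_gt0 n2 s0 s1.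

(** [fine] sends infinity to 0 and division by 0 gives 0, so [Rquot] vanishes as soon as the energy
    or the L^p integral is infinite. A positive lower bound for all quotients excludes this, and
    that is how finiteness is obtained for every test function. *)
Lemma Sconst_le (D : set 'rV[R]_n) (s : R) u : measurable D -> 0 < s ->
  (s%:E <= Sconst sigma D)%E -> C1c D u ->
  [/\ (energy sigma D u < +oo)%E, (lpow sigma D u < +oo)%E &
    s * fine (lpow sigma D u) `^ (2 / p) <= fine (energy sigma D u)].
Proof.
move=> mD sgt0 sS uC; have mu' := C1c_measurable uC.
have q0 : 2 / p != 0 by rewrite gt_eqF// divr_gt0.
have [[x ux]|u0] := pselect (exists x, u x != 0); last first.
  have uz x : u x = 0 by apply/eqP; apply: contrapT => ux; apply: u0; exists x; apply/negP.
  have -> : u = fun x => 0 * u x by apply/funext => x; rewrite uz mulr0.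
  rewrite energyZ// lpowZ// expr0n normr0 powR0 ?gt_eqF// !mul0e /= powR0//.
  by rewrite mulr0 !ltry.
have : (s%:E <= (Rquot sigma D u)%:E)%E.
  by apply: le_trans sS _; apply: ereal_inf_lbound; exists u => //; split=> //; exists x.
rewrite lee_fin /Rquot IgagE// LintE// two_div_pstar//.
case E : (energy sigma D u) => [e||]; case F : (lpow sigma D u) => [l||] //=.
- move=> h; rewrite !ltry; split=> //.
  have := lpow_ge0 sigma D u; rewrite F lee_fin le_eqVlt => /predU1P[<-|l0].
    by have := energy_ge0 sigma D u; rewrite E lee_fin powR0// mulr0.
  by rewrite mulrC -ler_pdivlMl ?powR_gt0// mulrC.
- by rewrite powR0// invr0 mulr0 leNgt sgt0.
- by have := lpow_ge0 sigma D u; rewrite F.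
- by rewrite mul0r leNgt sgt0.
- by rewrite mul0r leNgt sgt0.
- by rewrite mul0r leNgt sgt0.
- by have := energy_ge0 sigma D u; rewrite E.
- by have := energy_ge0 sigma D u; rewrite E.
- by have := energy_ge0 sigma D u; rewrite E.
Qed.

Context (Om : set 'rV[R]_n) (S c : R).
Hypotheses (mO : measurable Om) (muO : (mu Om <= c%:E)%E)
  (S0 : 0 < S) (SO : (S%:E <= Sconst sigma Om)%E).
Implicit Types u v : 'rV[R]_n -> R.
Local Notation En := (energy sigma Om).
Local Notation Lp := (lpow sigma Om).

Lemma H0E u : H0 sigma Om u <-> measurable_fun setT u /\ exists phi : nat -> 'rV[R]_n -> R,
  [/\ forall k, C1c Om (phi k), En (fun x => phi k x - u x) @[k --> \oo] --> 0%E &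
     Lp (fun x => phi k x - u x) @[k --> \oo] --> 0%E].
Proof.
rewrite /H0 Rn_measurableE; split=> -[mu' [phi [pC h1 h2]]]; split=> //; exists phi; split=> //.
- apply: eq_cvg_ext h1 => k; rewrite IgagE//.
  by apply: measurable_funB => //; exact: C1c_measurable (pC k).
- apply: eq_cvg_ext h2 => k; rewrite LintE//.
  by apply: measurable_funB => //; exact: C1c_measurable (pC k).
- apply: eq_cvg_ext h1 => k; rewrite IgagE//.
  by apply: measurable_funB => //; exact: C1c_measurable (pC k).
- apply: eq_cvg_ext h2 => k; rewrite LintE//.
  by apply: measurable_funB => //; exact: C1c_measurable (pC k).
Qed.

Lemma mass_fin u : measurable_fun setT u -> (Lp u < +oo)%E -> (mass Om u < +oo)%E.
Proof.
move=> mu' Lf; apply: le_lt_trans (mass_le n2 s0 s1 mO mO mu' _ ltr01) _ => //.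
rewrite lte_add_pinfty//.
  by rewrite mul1e; apply: le_lt_trans muO _; exact: ltry.
by rewrite lte_mul_pinfty// lee_fin powR_ge0.
Qed.

Lemma mass_cvg0 (u : nat -> 'rV[R]_n -> R) : (forall k, measurable_fun setT (u k)) ->
  Lp (u k) @[k --> \oo] --> 0%E -> mass Om (u k) @[k --> \oo] --> 0%E.
Proof.
move=> mu' L0; have c0 : 0 <= c by rewrite -lee_fin (le_trans _ muO).
have M0 k : (0 <= mass Om (u k))%E by exact: mass_ge0.
apply/fine_cvgP; split.
  have := near_lt_cvg0 ltr01 L0; apply: filterS => k h; rewrite ge0_fin_numE ?mass_ge0//; apply: mass_fin => //.
  by apply: lt_trans h _; exact: ltry.
have L1 := near_lt_cvg0 ltr01 L0.
apply/cvgrPdist_le => e e0.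
(* With this [tau] the volume term of [mass_le] is at most [e / 2]; the L^p term is at most [e / 2]
   once [Lp (u k)] is below [e / (2 * C)]. *)
pose tau := e / (2 * (c + 1)).
have t0 : 0 < tau by rewrite divr_gt0// mulr_gt0//; lra.
pose C := tau `^ ((2 - p) / 2).
have C0 : 0 < C by exact: powR_gt0.
have e2 : 0 < e / (2 * C) by rewrite divr_gt0// mulr_gt0.
have L2 := near_lt_cvg0 e2 L0.
near=> k.
have Lk : (Lp (u k) < 1)%E by near: k.
have Lk2 : (Lp (u k) < (e / (2 * C))%:E)%E by near: k.
have Lf : (Lp (u k) < +oo)%E by apply: lt_trans Lk _; exact: ltry.
have Mf := mass_fin (mu' k) Lf.
have := mass_le n2 s0 s1 mO mO (mu' k) (@subset_refl _ _) t0.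
rewrite -/C.
have -> : mass Om (u k) = (fine (mass Om (u k)))%:E by rewrite mass_fineK.
move=> h; rewrite fctE /= sub0r normrN ger0_norm ?fine_ge0//.
rewrite -lee_fin; apply: le_trans h _.
apply: (@le_trans _ _ (tau%:E * c%:E + C%:E * (e / (2 * C))%:E)%E).
  apply: leeD; apply: lee_wpmul2l; rewrite ?lee_fin ?(ltW t0) ?(ltW C0)//.
  exact: ltW.
rewrite -!EFinM -EFinD lee_fin.
have -> : C * (e / (2 * C)) = e / 2 by field; rewrite gt_eqF.
have : tau * c <= e / 2.
  rewrite /tau mulrAC ler_pdivrMr; last by lra.
  by nra.
lra.
Unshelve. all: by end_near.
Qed.

Lemma measurable_C1cB phi u : C1c Om phi -> measurable_fun setT u ->
  measurable_fun setT (fun x => phi x - u x).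
Proof. by move=> pC mu'; apply: measurable_funB => //; exact: C1c_measurable pC. Qed.

Lemma H0_measurable u : H0 sigma Om u -> measurable_fun setT u.
Proof. by move=> /H0E[]. Qed.

Lemma H0_C1c u : C1c Om u -> H0 sigma Om u.
Proof.
move=> uC; apply/H0E; split; first exact: C1c_measurable uC.
have z : (fun x : 'rV[R]_n => u x - u x) = fun x => 0 * u x.
  by apply/funext => x; rewrite subrr mul0r.
have mu' := C1c_measurable uC.
exists (fun=> u); split=> //; rewrite z ?energyZ ?lpowZ// ?normr0 ?expr0n ?powR0 ?gt_eqF// mul0e;
  exact: cvg_cst.
Qed.

Lemma H0_fin u : H0 sigma Om u -> (En u < +oo)%E /\ (Lp u < +oo)%E.
Proof.
move=> /H0E[mu' [phi [pC h1 h2]]].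
have [N1 hN1] := ex_lt_cvg0 ltr01 h1; have [N2 hN2] := ex_lt_cvg0 ltr01 h2.
pose k := maxn N1 N2; have mB := measurable_C1cB (pC k) mu'.
have l1 : (En (fun x => phi k x - u x)%R < +oo)%E.
  by apply: lt_trans (hN1 k (leq_maxl _ _)) _; exact: ltry.
have l2 : (Lp (fun x => phi k x - u x)%R < +oo)%E.
  by apply: lt_trans (hN2 k (leq_maxr _ _)) _; exact: ltry.
have [f1 f2 _] := Sconst_le mO S0 SO (pC k).
have mp := C1c_measurable (pC k).
have mN : measurable_fun setT (fun x => - 1 * (phi k x - u x)) by exact: measurable_funM.
have -> : u = fun x => phi k x + - 1 * (phi k x - u x) by apply/funext => x; ring.
split.
- by apply: energyD_fin => //; rewrite energyZ// sqrrN expr1n mul1e.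
- by apply: lpowD_fin => //; rewrite lpowZ// normrN normr1 powR1 mul1e.
Qed.

Lemma En_cvg0D (u v : nat -> 'rV[R]_n -> R) :
  (forall k, measurable_fun setT (u k)) -> (forall k, measurable_fun setT (v k)) ->
  En (u k) @[k --> \oo] --> 0%E -> En (v k) @[k --> \oo] --> 0%E ->
  En (fun x => u k x + v k x) @[k --> \oo] --> 0%E.
Proof.
rewrite energy.unlock => mu' mv u0 v0.
have h := pint_cvg0D (ltr0Sn R 1) (fun k => measurable_gag sigma mO (mu' k))
  (fun k => measurable_gag sigma mO (mv k)) u0 v0.
by apply: eq_cvg_ext h => k; rewrite gagD.
Qed.

Lemma Lp_cvg0D (u v : nat -> 'rV[R]_n -> R) :
  (forall k, measurable_fun setT (u k)) -> (forall k, measurable_fun setT (v k)) ->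
  Lp (u k) @[k --> \oo] --> 0%E -> Lp (v k) @[k --> \oo] --> 0%E ->
  Lp (fun x => u k x + v k x) @[k --> \oo] --> 0%E.
Proof.
rewrite lpow.unlock => mu' mv u0 v0.
have h := pint_cvg0D p0 (fun k => measurable_rst mO (mu' k))
  (fun k => measurable_rst mO (mv k)) u0 v0.
by apply: eq_cvg_ext h => k; rewrite rstD.
Qed.

Lemma H0Z (e : R) u : H0 sigma Om u -> H0 sigma Om (fun x => e * u x).
Proof.
move=> /H0E[mu' [phi [pC h1 h2]]]; apply/H0E; split; first exact: measurable_funM.
exists (fun k x => e * phi k x); split.
- by move=> k; exact: C1cZ.
- apply: eq_cvg_ext (cvg0Z (e ^+ 2) h1) => k; rewrite -energyZ//; last exact: measurable_C1cB.
  by congr energy; apply/funext => x; rewrite mulrBr.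
- apply: eq_cvg_ext (cvg0Z (`|e| `^ p) h2) => k; rewrite -lpowZ//; last exact: measurable_C1cB.
  by congr lpow; apply/funext => x; rewrite mulrBr.
Qed.

Lemma H0D u v : H0 sigma Om u -> H0 sigma Om v -> H0 sigma Om (fun x => u x + v x).
Proof.
move=> /H0E[mu' [phi [pC h1 h2]]] /H0E[mv [psi [qC g1 g2]]].
apply/H0E; split; first exact: measurable_funD.
exists (fun k x => phi k x + psi k x); split.
- by move=> k; exact: C1cD.
- have h := En_cvg0D (fun k => measurable_C1cB (pC k) mu') (fun k => measurable_C1cB (qC k) mv) h1 g1.
  apply: eq_cvg_ext h => k; congr energy; apply/funext => x /=; ring.
- have h := Lp_cvg0D (fun k => measurable_C1cB (pC k) mu') (fun k => measurable_C1cB (qC k) mv) h2 g2.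
  apply: eq_cvg_ext h => k; congr lpow; apply/funext => x /=; ring.
Qed.

(** Diagonal choice: a test function within [1 / (k+1)] of [U k] for both functionals. Applied later
    to averages, it shows that their limit belongs to the space. *)
Lemma H0_closed (U : nat -> 'rV[R]_n -> R) v : (forall k, H0 sigma Om (U k)) ->
  measurable_fun setT v ->
  En (fun x => U k x - v x) @[k --> \oo] --> 0%E ->
  Lp (fun x => U k x - v x) @[k --> \oo] --> 0%E -> H0 sigma Om v.
Proof.
move=> UH mv h1 h2; have mU k := H0_measurable (UH k).
have ex k : exists phi, [/\ C1c Om phi, (En (fun x => phi x - U k x)%R < (k.+1%:R^-1)%:E)%E &
    (Lp (fun x => phi x - U k x)%R < (k.+1%:R^-1)%:E)%E].
  have [_ [phi [pC g1 g2]]] := (H0E (U k)).1 (UH k).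
  have i0 : 0 < k.+1%:R^-1 :> R by rewrite invr_gt0.
  have [N1 hN1] := ex_lt_cvg0 i0 g1; have [N2 hN2] := ex_lt_cvg0 i0 g2.
  by exists (phi (maxn N1 N2)); split; [|exact: hN1 (leq_maxl _ _)|exact: hN2 (leq_maxr _ _)].
have [phi hphi] := choice ex.
have inv0 : ((k.+1%:R^-1)%:E : \bar R) @[k --> \oo] --> 0%E.
  by apply: cvg_EFin; [exact: nearW|exact: cvg_harmonic].
have pC k : C1c Om (phi k) by case: (hphi k).
have mp k := measurable_C1cB (pC k) (mU k).
have mUv k : measurable_fun setT (fun x => U k x - v x) by exact: measurable_funB.
apply/H0E; split=> //; exists phi; split=> //.
- have g : En (fun x => phi k x - U k x) @[k --> \oo] --> 0%E.
    by apply: squeeze0 inv0 => k; [exact: energy_ge0|case: (hphi k) => _ /ltW].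
  have h := En_cvg0D mp mUv g h1.
  by apply: eq_cvg_ext h => k; congr energy; apply/funext => x /=; ring.
- have g : Lp (fun x => phi k x - U k x) @[k --> \oo] --> 0%E.
    by apply: squeeze0 inv0 => k; [exact: lpow_ge0|case: (hphi k) => _ _ /ltW].
  have h := Lp_cvg0D mp mUv g h2.
  by apply: eq_cvg_ext h => k; congr lpow; apply/funext => x /=; ring.
Qed.

Lemma En_cvg (u : nat -> 'rV[R]_n -> R) v : (forall k, measurable_fun setT (u k)) ->
  measurable_fun setT v -> (En v < +oo)%E ->
  En (fun x => u k x - v x) @[k --> \oo] --> 0%E -> En (u k) @[k --> \oo] --> En v.
Proof.
rewrite energy.unlock => mu' mv vf h; apply: (pint_cvg (ltr0Sn R 1) (measurable_gag sigma mO mv)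
  (fun k => measurable_gag sigma mO (mu' k)) vf).
by apply: eq_cvg_ext h => k; rewrite gagB.
Qed.

Lemma Lp_cvg (u : nat -> 'rV[R]_n -> R) v : (forall k, measurable_fun setT (u k)) ->
  measurable_fun setT v -> (Lp v < +oo)%E ->
  Lp (fun x => u k x - v x) @[k --> \oo] --> 0%E -> Lp (u k) @[k --> \oo] --> Lp v.
Proof.
rewrite lpow.unlock => mu' mv vf h; apply: (pint_cvg p0 (measurable_rst mO mv)
  (fun k => measurable_rst mO (mu' k)) vf).
by apply: eq_cvg_ext h => k; rewrite rstB.
Qed.

Lemma mass_cvg (u : nat -> 'rV[R]_n -> R) v : (forall k, measurable_fun setT (u k)) ->
  measurable_fun setT v -> (Lp v < +oo)%E ->
  Lp (fun x => u k x - v x) @[k --> \oo] --> 0%E -> mass Om (u k) @[k --> \oo] --> mass Om v.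
Proof.
move=> mu' mv vf h.
have mB k : measurable_fun setT (fun x => u k x - v x) by exact: measurable_funB.
have := mass_cvg0 mB h; have := mass_fin mv vf; rewrite mass.unlock => Mf h0.
apply: (pint_cvg (ltr0Sn R 1) (measurable_rst mO mv) (fun k => measurable_rst mO (mu' k)) Mf).
by apply: eq_cvg_ext h0 => k; rewrite rstB.
Qed.

(** All three functionals converge along the approximating test functions, the mass because [Om] has
    finite measure. This carries both the Sobolev inequality and the inequality with a mass term
    from test functions to [H0]. *)
Lemma H0_ineq (s A C : R) :
  (forall phi, C1c Om phi -> s * fine (Lp phi) `^ (2 / p) <=
     A * fine (En phi) + C * fine (mass Om phi)) ->
  forall u, H0 sigma Om u -> s * fine (Lp u) `^ (2 / p) <=
     A * fine (En u) + C * fine (mass Om u).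
Proof.
move=> h u uH; have [Ef Lf] := H0_fin uH.
have /H0E[mu' [phi [pC h1 h2]]] := uH.
have mp k := C1c_measurable (pC k).
have mB k := measurable_C1cB (pC k) mu'.
have h3 := mass_cvg0 mB h2.
have c1 : fine (En (phi k)) @[k --> \oo] --> fine (En u).
  by apply: fine_cvg; rewrite energy_fineK//; exact: En_cvg.
have c2 : fine (Lp (phi k)) @[k --> \oo] --> fine (Lp u).
  by apply: fine_cvg; rewrite lpow_fineK//; exact: Lp_cvg.
have c3 : fine (mass Om (phi k)) @[k --> \oo] --> fine (mass Om u).
  by apply: fine_cvg; rewrite mass_fineK ?mass_fin//; exact: mass_cvg.
have q0 : 0 < 2 / p by rewrite divr_gt0.
have c4 : fine (Lp (phi k)) `^ (2 / p) @[k --> \oo] --> fine (Lp u) `^ (2 / p).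
  have h4 := powR_cvg q0 c2; rewrite ger0_norm ?fine_ge0 ?lpow_ge0// in h4.
  by apply: eq_cvg_ext h4 => k; rewrite ger0_norm// fine_ge0// lpow_ge0.
have l : (fun k => s * fine (Lp (phi k)) `^ (2 / p)) @ \oo --> s * fine (Lp u) `^ (2 / p).
  by apply: cvgMr.
have r : (fun k => A * fine (En (phi k)) + C * fine (mass Om (phi k))) @ \oo -->
    A * fine (En u) + C * fine (mass Om u).
  by apply: cvgD; apply: cvgMr.
rewrite -(cvg_lim (@Rhausdorff R) l) -(cvg_lim (@Rhausdorff R) r).
by apply: ler_lim; [apply: cvgP l|apply: cvgP r|apply: nearW => k; exact: h].
Qed.

Lemma H0_Sconst u : H0 sigma Om u -> S * fine (Lp u) `^ (2 / p) <= fine (En u).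
Proof.
move=> uH; have h phi : C1c Om phi -> S * fine (Lp phi) `^ (2 / p) <=
     1 * fine (En phi) + 0 * fine (mass Om phi).
  by move=> pC; rewrite mul1r mul0r addr0; have [] := Sconst_le mO S0 SO pC.
by have := H0_ineq h uH; rewrite mul1r mul0r addr0.
Qed.

End SobolevSpace.

(** * Charts and the inequality localized near a point *)

Section VolumeDiffeo.
Context {R : realType} (n : nat).
Implicit Types (x y z a : 'rV[R]_n) (T S : 'rV[R]_n -> 'rV[R]_n).

(** Collects what the transport of integrals and test functions uses: composition with [T] preserves
    [C1], and continuity of the inverse carries compact supports over. Near-isometry is a local
    property and is left to [chart]. *)
Record volume_diffeo T S : Prop := VolumeDiffeo {
  diffeo_measurable : measurable_fun setT T;
  diffeo_integral : forall f : 'rV[R]_n -> \bar R, measurable_fun setT f ->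
    (forall x, 0 <= f x)%E -> (\int[leb n]_y f (T y) = \int[leb n]_y f y)%E;
  diffeo_C1 : forall u, C1 u -> C1 (u \o T);
  diffeoK : cancel T S;
  diffeoVK : cancel S T;
  diffeo_continuous : continuous S }.

Lemma diffeo_comp T S T' S' : volume_diffeo T S -> volume_diffeo T' S' -> volume_diffeo (T \o T') (S' \o S).
Proof.
move=> G G'; split.
- exact: (measurableT_comp (diffeo_measurable G) (diffeo_measurable G')).
- move=> f mf f0 /=.
  have mfT : measurable_fun setT (fun x => f (T x)).
    exact: (measurableT_comp mf (diffeo_measurable G)).
  by rewrite (diffeo_integral G' mfT)//; exact: (diffeo_integral G mf).
- by move=> u /(diffeo_C1 G) /(diffeo_C1 G').
- by apply: can_comp; [exact: diffeoK G|exact: diffeoK G'].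
- by apply: can_comp; [exact: diffeoVK G'|exact: diffeoVK G].
- move=> x; apply: continuous_comp; [exact: diffeo_continuous G _|exact: diffeo_continuous G' _].
Qed.

Lemma continuous_enorm T : (forall x (e : R), 0 < e -> exists2 d : R, 0 < d &
    forall y, enorm (y - x) < d -> enorm (T y - T x) < e) -> continuous T.
Proof.
move=> h x A /nbhs_eballP[e e0 eA]; have [d d0 hd] := h x e e0.
by apply/nbhs_eballP; exists d => // y yd; apply: eA; exact: hd.
Qed.

Lemma diffeo_translation a : volume_diffeo (fun y => y + a) (fun y => y - a).
Proof.
split.
- apply: measurable_rv => i.
  rewrite (_ : (fun _ => _) = fun x : 'rV[R]_n => x ord0 i + a ord0 i).
    by apply: measurable_funD => //; exact: measurable_coord.
  by apply/funext => x; rewrite mxE.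
- by move=> f mf f0; exact: integral_shift.
- move=> u /C1P du; apply/C1P => x; have [g hg] := du (x + a); exists g.
  apply: (@sdiff_compv _ _ (fun y => y + a) u x id g g 1) => //.
    by move=> v; rewrite mul1r.
  move=> e e0; exists 1 => // y z _ _.
  by rewrite opprD addrACA subrr addr0 subrr enorm0 mulr_ge0 ?enorm_ge0// ltW.
- by move=> y; rewrite addrK.
- by move=> y; rewrite subrK.
- apply: continuous_enorm => x e e0; exists e => // y.
  by rewrite opprB addrA subrK.
Qed.

Lemma diffeo_rotation (Q : 'M[R]_n) : Q *m Q^T = 1%:M ->
  volume_diffeo (fun y => y *m Q) (fun y => y *m Q^T).
Proof.
move=> QQ; have QQ' : Q^T *m Q = 1%:M by exact: mulmx1C.
split.
- exact: measurable_mulmx.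
- by move=> f mf f0; exact: integral_rot.
- move=> u /C1P du; apply/C1P => x; have [g hg] := du (x *m Q); exists (g *m Q^T).
  apply: (@sdiff_compv _ _ (fun y => y *m Q) u x (fun y => y *m Q) g _ 1) => //.
  + by move=> v; rewrite mul1r enorm_rot.
  + by move=> v; rewrite [RHS]dot_mulmx trmxK.
  + move=> e e0; exists 1 => // y z _ _.
    by rewrite mulmxBl subrr enorm0 mulr_ge0 ?enorm_ge0// ltW.
- by move=> y; rewrite -mulmxA QQ mulmx1.
- by move=> y; rewrite -mulmxA QQ' mulmx1.
- apply: continuous_enorm => x e e0; exists e => // y.
  by rewrite -mulmxBl enorm_rot// trmxK.
Qed.

Lemma diffeo_shear (i : 'I_n) h : C1 h -> (forall y t, h (y + t *: evec i) = h y) ->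
  volume_diffeo (fun y => y + h y *: evec i) (fun y => y - h y *: evec i).
Proof.
move=> hC hi; have mh := continuous_measurable_rv (C1_continuous hC).
split.
- apply: measurable_rv => j.
  rewrite (_ : (fun _ => _) = fun x : 'rV[R]_n => x ord0 j + h x * (evec i : 'rV[R]_n) ord0 j).
    by apply: measurable_funD; [exact: measurable_coord|exact: measurable_funM].
  by apply/funext => x; rewrite !mxE.
- by move=> f mf f0; exact: integral_shear.
- move=> u /C1P du; apply/C1P => x; have [g hg] := du (x + h x *: evec i).
  have /C1P/(_ x)[gh hgh] := hC.
  exists (g + dot g (evec i) *: gh).
  apply: (@sdiff_compv _ _ (fun y => y + h y *: evec i) u x (fun v => v + dot gh v *: evec i) g _
    (1 + enorm gh)) => //.
  + move=> v; apply: le_trans (ler_enormD _ _) _.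
    rewrite mulrDl mul1r lerD2l enormZ enorm_evec mulr1; exact: norm_dot_le.
  + by move=> v; rewrite dotDr dotZr dotDl dotZl mulrC.
  + move=> e e0; have [d d0 hd] := hgh _ e0; exists d => // y z yd zd.
    rewrite (_ : _ - _ = (h y - h z - dot gh (y - z)) *: evec i); last first.
      by apply/rowP => j; rewrite !mxE; ring.
    by rewrite enormZ enorm_evec mulr1; exact: hd.
- by move=> y; rewrite hi addrK.
- by move=> y; rewrite -scaleNr hi scaleNr subrK.
- apply: continuous_enorm => x e e0; have e2 : 0 < e / 2 by rewrite divr_gt0.
  have hc : {for x, continuous h} by exact: C1_continuous.
  have [d d0 hd] := (continuous_eballP h x).1 hc _ e2.
  exists (Num.min d (e / 2)); first by rewrite lt_min d0.
  move=> y; rewrite lt_min => /andP[yd ye].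
  rewrite (_ : _ - _ = (y - x) + (h x - h y) *: evec i); last first.
    by apply/rowP => j; rewrite !mxE; ring.
  apply: le_lt_trans (ler_enormD _ _) _; rewrite enormZ enorm_evec mulr1 (splitr e).
  by rewrite ltrD// distrC hd.
Qed.

End VolumeDiffeo.

Section Charts.
Context {R : realType} (n : nat).
Hypothesis n2 : (2 <= n)%N.
Implicit Types (x y z p : 'rV[R]_n) (Om : set 'rV[R]_n) (T : 'rV[R]_n -> 'rV[R]_n).

Lemma last_index : exists il : 'I_n, forall x, halfspace x <-> 0 < x ord0 il.
Proof.
have h : (n.-1 < n)%N by rewrite prednK// (ltn_trans _ n2).
exists (Ordinal h) => x; split => [|x0 i iE].
  by apply; rewrite /= prednK// (ltn_trans _ n2).
by rewrite (_ : i = Ordinal h)//; apply/val_inj => /=; rewrite -[RHS]/(n.-1); lia.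
Qed.

Lemma halfspace_open : open (@halfspace R n).
Proof.
have [il hil] := last_index.
rewrite openE => x /hil x0; apply/nbhs_eballP; exists (x ord0 il) => // y.
rewrite /eball /= => yx; apply/hil; have := ler_coord_enorm (y - x) il; rewrite !mxE => h.
have := le_lt_trans h yx; rewrite ltr_norml; lra.
Qed.

(** The reflection in the hyperplane orthogonal to [e - f], or the identity when [e = f]. *)
Lemma householder (e f : 'rV[R]_n) : dot e e = 1 -> dot f f = 1 ->
  exists M : 'M[R]_n, M *m M^T = 1%:M /\ e *m M = f.
Proof.
move=> ee ff; have [->|ef] := eqVneq e f; first by exists 1%:M; rewrite trmx1 !mulmx1.
pose v := e - f; pose c := dot v v.
have c0 : c != 0.
  rewrite /c -enorm_sqr sqrf_eq0; by rewrite enorm_eq0 subr_eq0.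
have vv : v *m v^T = c%:M.
  apply/matrixP => i j; rewrite !ord1 mxE [RHS]mxE eqxx mulr1n.
  by apply: eq_bigr => k _; rewrite [v^T _ _]mxE.
(* As both vectors have norm 1, [dot e (e - f) = 1 - dot e f], which is half of [dot v v]. *)
have ev : e *m v^T = (c / 2)%:M.
  apply/matrixP => i j; rewrite !ord1 mxE [RHS]mxE eqxx mulr1n.
  transitivity (dot e v); first by apply: eq_bigr => k _; rewrite [v^T _ _]mxE.
  rewrite /c /v !dotDl !dotDr !dotNl !dotNr ee ff [dot f e]dotC; by field.
pose P := v^T *m v.
have PP : P *m P = c *: P.
  by rewrite /P mulmxA -[_ *m v *m _]mulmxA vv mul_mx_scalar -scalemxAl.
exists (1%:M - (2 / c) *: P); split; last first.
  rewrite mulmxBr mulmx1 -scalemxAr mulmxA ev mul_scalar_mx scalerA.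
  have -> : 2 / c * (c / 2) = 1 by rewrite mulrA divfK// divff// pnatr_eq0.
  by rewrite scale1r /v opprB addrC subrK.
have -> : (1%:M - (2 / c) *: P)^T = 1%:M - (2 / c) *: P.
  by rewrite linearB /= trmx1 linearZ /= trmx_mul trmxK.
rewrite mulmxBr mulmx1 mulmxBl mul1mx -scalemxAl -scalemxAr PP !scalerA opprB addrA.
have -> : 2 / c * (2 / c) * c = 2 / c + 2 / c by rewrite -mulrA divfK// mulr_natr.
by rewrite scalerDl addrA subrK addrK.
Qed.

(* [T] carries the half ball [half :&: B(z0, s)] into [Om], nearly isometrically, and
   covers [Om] near [p]. *)
Record chart Om p (K rho : R) (T : 'rV[R]_n -> 'rV[R]_n) z0 (s : R) : Prop := Chart {
  chart_diffeo : exists S, volume_diffeo T S;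
  chart_lip : forall z z', enorm (z - z0) < s -> enorm (z' - z0) < s ->
    enorm (T z - T z') <= K * enorm (z - z');
  chart_in : forall z, enorm (z - z0) < s -> halfspace z -> Om (T z);
  chart_cover : forall z, Om (T z) -> enorm (T z - p) <= rho ->
    halfspace z /\ enorm (z - z0) < s / 2 }.

Lemma interior_chart Om p (K : R) : open Om -> Om p -> 1 <= K ->
  exists rho, 0 < rho /\ exists T z0 s, 0 < s /\ chart Om p K rho T z0 s.
Proof.
move=> oO Op K1; have [il hil] := last_index.
have [s s0 sO] := openP_eball oO Op.
exists (s / 4); split; first by rewrite divr_gt0.
(* The centre has height [s], so the whole ball of radius [s] lies in the half-space and a
   translation is a chart. *)
pose z0 : 'rV[R]_n := s *: evec il.
have half z : enorm (z - z0) < s -> halfspace z.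
  move=> zs; apply/hil; have := ler_coord_enorm (z - z0) il; rewrite !mxE !eqxx mulr1 => h.
  have := le_lt_trans h zs; rewrite ltr_norml; lra.
exists (fun z => z + (p - z0)), z0, s; split=> //; split.
- by eexists; exact: diffeo_translation.
- move=> z z' _ _; rewrite opprD addrACA subrr addr0 ler_peMl ?enorm_ge0//.
- by move=> z zs _; apply: sO; rewrite /eball /= addrA addrAC addrK.
- move=> z _; rewrite addrA addrAC addrK => zs.
  have zs2 : enorm (z - z0) < s / 2 by apply: le_lt_trans zs _; lra.
  by split=> //; apply: half; lra.
Qed.

(** In the rotated coordinates [Om] lies above the graph of [g], which may be steep. The vector
    [b = evec i - a], with [a] the gradient of [g] at 0, is normal to the tangent plane, and the
    orthogonal matrix [M] sends its direction to the last axis. The remainder [h = g - dot a] has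
    gradient 0 at 0, hence Lipschitz constant at most [de] nearby, and the shear by [h] carries the
    half-space [dot b w > 0] onto [Om] locally. *)
Lemma boundary_chart Om p (K : R) : C1_boundary Om -> closure Om p -> ~ Om p -> 1 < K ->
  exists rho, 0 < rho /\ exists T z0 s, 0 < s /\ chart Om p K rho T z0 s.
Proof.
move=> bO cp nOp K1; have [r [r0 [Q [QQ [i [g [gC gi gO]]]]]]] := bO p cp nOp.
have [il hil] := last_index.
have QQ' : Q^T *m Q = 1%:M by exact: mulmx1C.
(* Since [p] is not in [Om], [g 0 >= 0]; a positive value would by continuity keep [Om] away from
   [p]. *)
have g0 : g 0 = 0.
  apply/eqP; rewrite eq_le; apply/andP; split; last first.
    have := gO p; rewrite subrr enorm0 mul0mx mxE => /(_ r0) h.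
    by rewrite leNgt; apply/negP => /h.
  rewrite leNgt; apply/negP => gpos.
  have gc : {for 0, continuous g} by exact: C1_continuous.
  have g2 : 0 < g 0 / 2 by rewrite divr_gt0.
  have [d d0 hd] := (continuous_eballP g 0).1 gc _ g2.
  have d1 : 0 < Num.min r (Num.min d (g 0 / 2)) by rewrite !lt_min r0 d0.
  have [x Ox] := (closureP_eball Om p).1 cp _ d1.
  rewrite !lt_min => /and3P[xr xd xg].
  have /(gO _ xr) := Ox; set y := (x - p) *m Q => gy.
  have ye : enorm y = enorm (x - p) by exact: enorm_rot.
  have := hd y; rewrite subr0 ye => /(_ xd); rewrite ltr_norml.
  have := ler_coord_enorm y i; rewrite ye => h.
  have := le_lt_trans h xg; rewrite ltr_norml; lra.
have [a ha] := (C1P g).1 gC 0.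
(* [g] is constant along [evec i], so its gradient has no component in that direction. *)
have ai : a ord0 i = 0.
  apply/eqP; rewrite -normr_eq0; apply/negPn/negP => a0.
  have ap : 0 < `|a ord0 i| by rewrite lt0r a0 /=.
  have ap2 : 0 < `|a ord0 i| / 2 by rewrite divr_gt0.
  have [d d0 hd] := ha _ ap2.
  have := hd ((d / 2) *: evec i) 0; rewrite !subr0 enorm0 d0 enormZ enorm_evec mulr1.
  rewrite gtr0_norm ?divr_gt0// -{1}[_ *: _]add0r gi subrr sub0r normrN.
  have -> : dot a ((d / 2) *: evec i) = d / 2 * a ord0 i.
    rewrite dotZr; congr (_ * _); rewrite /dot (bigD1 i)//= evecE eqxx mulr1 big1 ?addr0//.
    by move=> j ji; rewrite evecE (negbTE ji) mulr0.
  rewrite normrM gtr0_norm ?divr_gt0// => /(_ ltac:(lra) isT); nra.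
pose h y := g y - dot a y.
have hC : C1 h.
  apply/C1P => y; have [b hb] := (C1P g).1 gC y; exists (b + - 1 *: a).
  have -> : h = fun y => g y + cst (- 1) y * dot a y by apply/funext => z; rewrite /h mulN1r.
  apply: sdiffD => //; rewrite -[_ *: a]addr0 -(scaler0 _ (dot a y)).
  by apply: sdiffM; [exact: sdiff_cst|exact: sdiff_dot].
have aei : dot a (evec i) = 0.
  rewrite /dot big1// => j _; rewrite evecE; case: eqP => [->|_]; by rewrite ?ai ?mul0r ?mulr0.
have hi y t : h (y + t *: evec i) = h y by rewrite /h gi dotDr dotZr aei mulr0 addr0.
have h0 : h 0 = 0 by rewrite /h g0 sub0r /dot big1 ?oppr0// => j _; rewrite mxE mulr0.
(* The shear has Lipschitz constant [1 + de <= K]. The bound [1 / 2] makes [enorm z] at most [3 / 2]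
   of the distance from [T z] to [p], which stays below [s / 2] when that distance is at most
   [rho = s / 4]. *)
pose de := Num.min (K - 1) (1 / 2).
have de0 : 0 < de by rewrite lt_min; lra.
have de1 : de <= K - 1 by rewrite ge_min lexx.
have de2 : de <= 1 / 2 by rewrite ge_min lexx orbT.
have [d d0 hd] := ha _ de0.
have hlip y z : enorm y < d -> enorm z < d -> `|h y - h z| <= de * enorm (y - z).
  move=> yd zd; have := hd y z; rewrite !subr0 => /(_ yd zd).
  by congr (`|_| <= _); rewrite /h dotDr dotNr; ring.
pose b := evec i - a.
have bE y : dot b y = y ord0 i - dot a y.
  rewrite /b dotDl dotNl; congr (_ - _).
  rewrite /dot (bigD1 i)//= evecE eqxx mul1r big1 ?addr0// => j ji.
  by rewrite evecE (negbTE ji) mul0r.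
have bei : dot b (evec i) = 1 by rewrite bE evecE eqxx aei subr0.
have bn : 0 < enorm b.
  rewrite lt_neqAle enorm_ge0 andbT eq_sym enorm_eq0; apply/eqP => b0.
  move: bei; rewrite b0 /dot big1 => [/eqP|j _]; last by rewrite mxE mul0r.
  by rewrite eq_sym oner_eq0.
have [M [MM eM]] : exists M : 'M[R]_n, M *m M^T = 1%:M /\ (enorm b)^-1 *: b *m M = evec il.
  apply: householder; last by rewrite -enorm_sqr enorm_evec expr1n.
  by rewrite dotZl dotZr -enorm_sqr; field; rewrite gt_eqF.
have MM' : M^T *m M = 1%:M by exact: mulmx1C.
have bM z : dot b (z *m M^T) = enorm b * z ord0 il.
  rewrite -[b in LHS](scalerKV (lt0r_neq0 bn)) dotZl; congr (_ * _).
  rewrite dotC dot_mulmx trmxK eM /dot (bigD1 il)//= evecE eqxx mulr1 big1 ?addr0// => j ji.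
  by rewrite evecE (negbTE ji) mulr0.
pose T z := (z *m M^T + h (z *m M^T) *: evec i) *m Q^T + p.
have wE z : enorm (z *m M^T) = enorm z by rewrite enorm_rot// trmxK.
have TQ z : (T z - p) *m Q = z *m M^T + h (z *m M^T) *: evec i.
  by rewrite /T addrK -mulmxA QQ' mulmx1.
have Tn z : enorm (T z - p) = enorm (z *m M^T + h (z *m M^T) *: evec i).
  by rewrite -TQ enorm_rot.
have Omh z : enorm (T z - p) < r -> Om (T z) <-> halfspace z.
  move=> zr; apply: iff_trans (gO _ zr) _; apply: iff_trans (iff_sym (hil z)).
  rewrite TQ; set w := z *m M^T; set y := w + _.
  have -> : (g y < y ord0 i) = (0 < dot b w).
    have -> : g y = h w + dot a y by rewrite -(hi w (h w)) -/y /h subrK.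
    have -> : y ord0 i = dot b y + dot a y by rewrite bE subrK.
    by rewrite ltrD2r /y [dot b (_ + _)]dotDr dotZr bei mulr1 ltrDr.
  by rewrite /w bM pmulr_rgt0.
(* [d] is the range of the Lipschitz bound on [h]; [r / K] keeps [T z] in the ball where the graph
   describes [Om]. *)
pose s := Num.min d (r / K).
have K0 : 0 < K by lra.
have s0 : 0 < s by rewrite lt_min d0 divr_gt0.
have sd z : enorm z < s -> enorm z < d by rewrite lt_min => /andP[].
have sr z : enorm z < s -> K * enorm z < r.
  by rewrite lt_min => /andP[_]; rewrite ltr_pdivlMr// mulrC.
have Tlip z z' : enorm z < d -> enorm z' < d -> enorm (T z - T z') <= K * enorm (z - z').
  move=> zd zd'; pose w := z *m M^T; pose w' := z' *m M^T.
  have -> : T z - T z' = ((w - w') + (h w - h w') *: evec i) *m Q^T.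
    rewrite /T -/w -/w' opprD addrACA subrr addr0 -mulmxBl; congr (_ *m _).
    by apply/rowP => j; rewrite !mxE; ring.
  have wd : enorm w < d by rewrite wE.
  have wd' : enorm w' < d by rewrite wE.
  rewrite enorm_rot ?trmxK//; apply: le_trans (ler_enormD _ _) _.
  rewrite enormZ enorm_evec mulr1 -(wE (z - z')) mulmxBl -/w -/w'.
  apply: (@le_trans _ _ (enorm (w - w') + de * enorm (w - w'))).
    by rewrite lerD2l hlip.
  by rewrite -{1}[enorm (w - w')]mul1r -mulrDl ler_wpM2r ?enorm_ge0//; lra.
have T0 : T 0 = p by rewrite /T mul0mx h0 scale0r addr0 mul0mx add0r.
have Tr z : enorm z < s -> enorm (T z - p) < r.
  move=> zs; rewrite -{1}T0; apply: le_lt_trans (sr _ zs); rewrite -{2}[z]subr0.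
  by apply: Tlip; rewrite ?enorm0//; exact: sd.
exists (s / 4); split; first by rewrite divr_gt0.
exists T, 0, s; split=> //; split.
- exists ((fun y => y *m M^T^T) \o ((fun y => y - h y *: evec i) \o
     ((fun y => y *m Q^T^T) \o (fun y => y - p)))).
  have G1 := diffeo_translation p.
  have G2 : volume_diffeo (fun y => y *m Q^T) (fun y => y *m Q^T^T) by apply: diffeo_rotation; rewrite trmxK.
  have G3 := diffeo_shear hC hi.
  have G4 : volume_diffeo (fun y => y *m M^T) (fun y => y *m M^T^T) by apply: diffeo_rotation; rewrite trmxK.
  exact: (diffeo_comp G1 (diffeo_comp G2 (diffeo_comp G3 G4))).
- by move=> z z'; rewrite !subr0 => /sd zd /sd zd'; exact: Tlip.
- by move=> z; rewrite subr0 => zs hz; apply/Omh => //; exact: Tr.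
- move=> z OTz zrho; rewrite subr0.
  have sd' : s <= d by rewrite ge_min lexx.
  have sr' : s <= r.
    have : s <= r / K by rewrite ge_min lexx orbT.
    move=> /le_trans; apply; rewrite ler_pdivrMr//; nra.
  have zr : enorm (T z - p) < r by apply: le_lt_trans zrho _; lra.
  split; first exact/(Omh _ zr).
  move: zrho; rewrite Tn; set w := z *m M^T; set y := w + _ => yrho.
  have hy : h y = h w by exact: hi.
  have yd : enorm y < d by apply: le_lt_trans yrho _; lra.
  have z00 : enorm (0 : 'rV[R]_n) < d by rewrite enorm0.
  have := hlip _ _ yd z00; rewrite h0 !subr0 => hle.
  rewrite -wE -/w; have -> : w = y + (- h y) *: evec i by rewrite hy scaleNr addrK.
  apply: le_lt_trans (ler_enormD _ _) _; rewrite enormZ enorm_evec mulr1 normrN.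
  have := enorm_ge0 y; nra.
Qed.

End Charts.

(** * Integration against the truncated kernel *)

Section KernelBounds.
Context {R : realType} (n : nat) (sigma : R).
Local Notation a := (n%:R + 2 * sigma).
Local Notation mu := (leb n).
Local Notation mu2 := ((leb n \x leb n)%E).
Local Notation ker := (ker sigma).

Lemma kerBC (x y : 'rV[R]_n) : ker (x - y) = ker (y - x).
Proof. by rewrite /ker enormBC. Qed.

Lemma measurable_kerB : measurable_fun setT (fun z : 'rV[R]_n * 'rV[R]_n => ker (z.1 - z.2)).
Proof. exact: (measurableT_comp (@measurable_ker R n sigma) (@measurable_rvB2 R n)). Qed.

Lemma ker_conv1 (C : R) (f : 'rV[R]_n -> R) : 0 <= C -> (\int[mu]_w (ker w)%:E <= C%:E)%E ->
  measurable_fun setT f -> (forall x, 0 <= f x) ->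
  (\int[mu2]_z (f z.1 * ker (z.1 - z.2))%:E <= C%:E * \int[mu]_x (f x)%:E)%E.
Proof.
move=> C0 hC mf f0.
pose F (z : 'rV[R]_n * 'rV[R]_n) : \bar R := (f z.1 * ker (z.1 - z.2))%:E.
have mF : measurable_fun setT F.
  apply/measurable_EFinP; apply: measurable_funM; last exact: measurable_kerB.
  exact: (measurableT_comp mf measurable_fst).
have F0 z : (0 <= F z)%E by rewrite lee_fin mulr_ge0 ?ker_ge0.
have mkE : measurable_fun setT (fun y : 'rV[R]_n => (ker y)%:E).
  by apply/measurable_EFinP; exact: measurable_ker.
have inner x : (\int[mu]_y F (x, y) <= C%:E * (f x)%:E)%E.
  have -> : (\int[mu]_y F (x, y) = \int[mu]_y ((f x)%:E * (ker (y + - x)%R)%:E))%E.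
    by apply: eq_integral => y _; rewrite /F /= kerBC EFinM.
  have G := measurableT_comp mkE (diffeo_measurable (@diffeo_translation R n (- x))).
  have k0 (y : 'rV[R]_n) : (0 <= (ker y)%:E)%E by rewrite lee_fin ker_ge0.
  rewrite (integralT_Z mu (f0 x) G (fun y => k0 _)) (integral_shift (- x)%R mkE k0).
  by rewrite muleC; apply: lee_wpmul2r hC; rewrite lee_fin.
have mfE : measurable_fun setT (fun y : 'rV[R]_n => (f y)%:E) by apply/measurable_EFinP.
rewrite (fubini_tonelli1 F mF F0) -(integralT_Z mu C0 mfE); last by move=> y; rewrite lee_fin.
apply: integralT_le => //.
- exact: (measurable_fun_fubini_tonelli_F F mF).
- exact: measurable_funeM.
- by move=> x; exact: integralT_ge0.
Qed.

Lemma ker_conv2 (C : R) (f : 'rV[R]_n -> R) : 0 <= C -> (\int[mu]_w (ker w)%:E <= C%:E)%E ->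
  measurable_fun setT f -> (forall x, 0 <= f x) ->
  (\int[mu2]_z (f z.2 * ker (z.1 - z.2))%:E <= C%:E * \int[mu]_x (f x)%:E)%E.
Proof.
move=> C0 hC mf f0.
pose F (z : 'rV[R]_n * 'rV[R]_n) : \bar R := (f z.1 * ker (z.1 - z.2))%:E.
pose G (z : 'rV[R]_n * 'rV[R]_n) : \bar R := (f z.2 * ker (z.1 - z.2))%:E.
have mF : measurable_fun setT F.
  apply/measurable_EFinP; apply: measurable_funM; last exact: measurable_kerB.
  exact: (measurableT_comp mf measurable_fst).
have F0 z : (0 <= F z)%E by rewrite lee_fin mulr_ge0 ?ker_ge0.
have mG : measurable_fun setT G.
  apply/measurable_EFinP; apply: measurable_funM; last exact: measurable_kerB.
  exact: (measurableT_comp mf measurable_snd).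
have G0 z : (0 <= G z)%E by rewrite lee_fin mulr_ge0 ?ker_ge0.
apply: le_trans _ (ker_conv1 C0 hC mf f0).
have GF x y : G (x, y) = F (y, x) by rewrite /G /F /= kerBC.
rewrite (fubini_tonelli2 G mG G0) (fubini_tonelli1 F mF F0).
rewrite le_eqVlt; apply/orP; left; apply/eqP.
apply: eq_integral => y _; apply: eq_integral => x _; exact: GF.
Qed.

(** Both sources of error, far pairs in a chart and the partition of unity, are bounded pointwise by
    [ker] times squares. Integrating one variable at a time turns them into a multiple of the mass,
    with a [C] fixed before the functions are. *)
Lemma integral_le_ker : (2 <= n)%N -> 0 < sigma < 1 -> exists2 C : R, 0 <= C &
  forall (F A : 'rV[R]_n * 'rV[R]_n -> R) (f : 'rV[R]_n -> R) (k c : R),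
  measurable_fun setT F -> measurable_fun setT A -> measurable_fun setT f ->
  (forall z, 0 <= F z) -> (forall z, 0 <= A z) -> (forall x, 0 <= f x) -> 0 <= k -> 0 <= c ->
  (forall z, F z <= k * A z + c * ((f z.1 + f z.2) * ker (z.1 - z.2))) ->
  (\int[mu2]_z (F z)%:E <= k%:E * \int[mu2]_z (A z)%:E + (c * C)%:E * \int[mu]_x (f x)%:E)%E.
Proof.
move=> n2 s01; have [C hC] := @ker_fin R n sigma n2 s01.
have C0 : 0 <= C.
  by rewrite -lee_fin; apply: le_trans hC; apply: integralT_ge0 => w; rewrite lee_fin ker_ge0.
exists (C + C); first by rewrite addr_ge0.
move=> F A f k c mF mA mf F0 A0 f0 k0 c0 FA.
pose B1 (z : 'rV[R]_n * 'rV[R]_n) : \bar R := (f z.1 * ker (z.1 - z.2))%:E.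
pose B2 (z : 'rV[R]_n * 'rV[R]_n) : \bar R := (f z.2 * ker (z.1 - z.2))%:E.
have mB1 : measurable_fun setT B1.
  apply/measurable_EFinP; apply: measurable_funM; last exact: measurable_kerB.
  exact: (measurableT_comp mf measurable_fst).
have mB2 : measurable_fun setT B2.
  apply/measurable_EFinP; apply: measurable_funM; last exact: measurable_kerB.
  exact: (measurableT_comp mf measurable_snd).
have B10 z : (0 <= B1 z)%E by rewrite lee_fin mulr_ge0 ?ker_ge0.
have B20 z : (0 <= B2 z)%E by rewrite lee_fin mulr_ge0 ?ker_ge0.
have BB0 z : (0 <= B1 z + B2 z)%E := adde_ge0 (B10 z) (B20 z).
have mBB : measurable_fun setT (fun z => B1 z + B2 z)%E by exact: emeasurable_funD.
have A0' z : (0 <= (A z)%:E)%E by rewrite lee_fin.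
have mA' : measurable_fun setT (fun z => (A z)%:E) by apply/measurable_EFinP.
apply: (@le_trans _ _ (\int[mu2]_z (k%:E * (A z)%:E + c%:E * (B1 z + B2 z)))%E).
  apply: integralT_le.
  - by apply/measurable_EFinP.
  - exact: (emeasurable_funD (measurable_funeM _ mA') (measurable_funeM _ mBB)).
  - by move=> z; rewrite lee_fin.
  move=> z; have h := FA z.
  by rewrite mulrDl -lee_fin EFinD [(k * _)%:E]EFinM [(c * _)%:E]EFinM in h.
rewrite (integralT_D mu2 (measurable_funeM _ mA') (measurable_funeM _ mBB)); last 2 first.
- by move=> z; apply: mule_ge0; rewrite lee_fin.
- by move=> z; apply: mule_ge0; [rewrite lee_fin|exact: BB0].
rewrite (integralT_Z mu2 k0 mA' A0') (integralT_Z mu2 c0 mBB BB0).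
rewrite (integralT_D mu2 mB1 mB2 B10 B20); apply: leeD => //.
rewrite [(c * (C + C))%:E]EFinM -muleA; apply: lee_wpmul2l; first by rewrite lee_fin.
by rewrite EFinD ge0_muleDl ?lee_fin//; apply: leeD; [exact: ker_conv1|exact: ker_conv2].
Qed.

Lemma ker_tail (t : R) (w : 'rV[R]_n) : 0 < t -> t <= enorm w ->
  (enorm w `^ a)^-1 <= (Num.min 1 (t ^+ 2))^-1 * ker w.
Proof.
move=> t0 tw; rewrite /ker mulrA ler_peMl ?invr_ge0 ?powR_ge0//.
have m0 : 0 < Num.min 1 (t ^+ 2) by rewrite lt_min ltr01 exprn_gt0.
rewrite mulrC ler_pdivlMr// mul1r le_min ge_min lexx /= ge_min orbC.
by rewrite ler_sqr ?nnegrE ?enorm_ge0 ?(ltW t0)// tw.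
Qed.

Lemma diffeo_integral2 (T S : 'rV[R]_n -> 'rV[R]_n) (F : 'rV[R]_n * 'rV[R]_n -> \bar R) :
  volume_diffeo T S -> measurable_fun setT F -> (forall z, 0 <= F z)%E ->
  (\int[mu2]_z F (T z.1, T z.2) = \int[mu2]_z F z)%E.
Proof.
move=> G mF F0; have mT := diffeo_measurable G.
pose FT (z : 'rV[R]_n * 'rV[R]_n) := F (T z.1, T z.2).
have mTT : measurable_fun setT (fun z : 'rV[R]_n * 'rV[R]_n => (T z.1, T z.2)).
  apply/measurable_fun_pairP; split.
    exact: (measurableT_comp mT measurable_fst).
  exact: (measurableT_comp mT measurable_snd).
have mFT : measurable_fun setT FT by exact: (measurableT_comp mF mTT).
have FT0 z : (0 <= FT z)%E by exact: F0.
rewrite (fubini_tonelli1 FT mFT FT0) (fubini_tonelli1 F mF F0).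
have mFx x : measurable_fun setT (fun y => F (x, y)).
  exact: (measurableT_comp mF (pair1_measurable x)).
pose H (x : 'rV[R]_n) := (\int[mu]_y F (x, y))%E.
transitivity (\int[mu]_x H (T x))%E.
  apply: eq_integral => x _; rewrite /fubini_F /FT /H /=.
  by rewrite -(diffeo_integral G (mFx (T x))).
apply: (diffeo_integral G); last by move=> x; exact: integralT_ge0.
exact: (measurable_fun_fubini_tonelli_F F mF).
Qed.

Lemma pint2E d (X : measurableType d) (nu : {measure set X -> \bar R}) (f : X -> R) :
  pint nu 2 f = (\int[nu]_x (f x ^+ 2)%:E)%E.
Proof. by apply: eq_integral => x _; rewrite powR_mulrn// real_normK ?num_real. Qed.

Lemma rst_id (Om : set 'rV[R]_n) u : (forall x, ~ Om x -> u x = 0) -> rst Om u = u.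
Proof.
move=> u0; apply/funext => x; rewrite /rst indicE.
have [Ox|nOx] := pselect (Om x); first by rewrite mem_set// mul1r.
by rewrite u0// mulr0.
Qed.

Definition gq (D : set 'rV[R]_n) (u : 'rV[R]_n -> R) (x y : 'rV[R]_n) : R :=
  (\1_D x * \1_D y) * ((u x - u y) ^+ 2 / enorm (x - y) `^ a).

Implicit Types (D : set 'rV[R]_n) (u : 'rV[R]_n -> R).

Lemma gqC D u x y : gq D u x y = gq D u y x.
Proof. by rewrite /gq enormBC [\1_D x * _]mulrC -[(u x - u y) ^+ 2]sqrrN opprB. Qed.

Lemma gq_ge0 D u x y : 0 <= gq D u x y.
Proof. rewrite /gq !indicE; apply: mulr_ge0; first by rewrite mulr_ge0 ?ler0n.
by rewrite mulr_ge0 ?sqr_ge0// invr_ge0 powR_ge0. Qed.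

Lemma gq_out D u x y : ~ D x -> gq D u x y = 0.
Proof. by move=> nD; rewrite /gq indicE memNset//= !mul0r. Qed.

Lemma gq_in D u x y : D x -> D y ->
  gq D u x y = (u x - u y) ^+ 2 / enorm (x - y) `^ a.
Proof. by move=> Dx Dy; rewrite /gq !indicE (mem_set Dx) (mem_set Dy) !mul1r. Qed.

Lemma gq_eq D u x y : u x = u y -> gq D u x y = 0.
Proof. by move=> xy; rewrite /gq xy subrr expr0n mul0r mulr0. Qed.

Lemma energy_gq D u : energy sigma D u = (\int[mu2]_z (gq D u z.1 z.2)%:E)%E.
Proof. by rewrite energy.unlock; apply: eq_integral => z _; rewrite gag_sqr. Qed.

Lemma measurable_gq D u : measurable D -> measurable_fun setT u ->
  measurable_fun setT (fun z : 'rV[R]_n * 'rV[R]_n => gq D u z.1 z.2).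
Proof.
move=> mD mu'; rewrite (_ : (fun _ => _) = fun z => `|gag sigma D u z| `^ 2).
  by apply: measurable_pw; exact: measurable_gag.
by apply/funext => z; rewrite gag_sqr.
Qed.

Lemma closed_eball (q : 'rV[R]_n) (r : R) : closed [set x | enorm (x - q) <= r].
Proof.
move=> x /closureP_eball h; rewrite /= leNgt; apply/negP => gt.
have d0 : 0 < enorm (x - q) - r by rewrite subr_gt0.
have [y /= yr yx] := h _ d0.
have := ler_enormD (x - y) (y - q); rewrite subrKA enormBC; lra.
Qed.

End KernelBounds.

Section LocalInequality.
Context {R : realType} (n : nat) (sigma : R).
Hypothesis (n2 : (2 <= n)%N) (s0 : 0 < sigma) (s1 : sigma < 1).
Local Notation p := (pstar n sigma).
Local Notation a := (n%:R + 2 * sigma).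
Local Notation mu := (leb n).
Local Notation mu2 := ((leb n \x leb n)%E).
Local Notation ker := (ker sigma).
Local Notation half := (@halfspace R n).
Local Notation gq := (gq sigma).
Context (Om : set 'rV[R]_n) (q : 'rV[R]_n) (K rho : R) (T : 'rV[R]_n -> 'rV[R]_n)
  (z0 : 'rV[R]_n) (s : R).
Hypotheses (mO : measurable Om) (sgt0 : 0 < s) (K1 : 1 <= K)
  (ch : chart Om q K rho T z0 s).

Let m := Num.min 1 ((s / 2) ^+ 2).

(** By symmetry some point [w] of the pair has [u (T w)] nonzero, and [chart_cover] puts it in the
    ball of radius [s / 2]. A partner closer than [s / 2] lies in the ball where [T] is K-Lipschitz,
    which costs [K^a] in the kernel. For a farther one the kernel is at most [ker / m], and the
    squared difference at most twice the sum of squares. *)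
Lemma chart_pointwise u z z' : (forall x, ~ Om x -> u x = 0) ->
  (forall x, rho <= enorm (x - q) -> u x = 0) ->
  gq half (u \o T) z z' <= K `^ a * gq Om u (T z) (T z') +
    2 / m * ((u (T z) ^+ 2 + u (T z') ^+ 2) * ker (z - z')).
Proof.
move=> uO urho.
have m0 : 0 < m by rewrite lt_min ltr01 exprn_gt0// divr_gt0.
have rhs0 w w' : 0 <= K `^ a * gq Om u (T w) (T w') +
    2 / m * ((u (T w) ^+ 2 + u (T w') ^+ 2) * ker (w - w')).
  apply: addr_ge0; first by rewrite mulr_ge0 ?powR_ge0 ?gq_ge0.
  by rewrite mulr_ge0 ?divr_ge0 ?(ltW m0)// mulr_ge0 ?ker_ge0// addr_ge0 ?sqr_ge0.
suff main w w' : u (T w) != 0 -> halfspace w -> halfspace w' -> gq half (u \o T) w w' <=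
    K `^ a * gq Om u (T w) (T w') +
    2 / m * ((u (T w) ^+ 2 + u (T w') ^+ 2) * ker (w - w')).
  have [hz|nz] := pselect (half z); last first.
    by rewrite gq_out//; exact: rhs0.
  have [hz'|nz'] := pselect (half z'); last first.
    by rewrite gqC gq_out//; exact: rhs0.
  have [u1|u1] := eqVneq (u (T z)) 0; last exact: main.
  have [u2|u2] := eqVneq (u (T z')) 0.
    by rewrite [gq half _ _ _]gq_eq ?rhs0//= u1 u2.
  have := main _ _ u2 hz' hz; rewrite [gq half _ _ _]gqC [gq Om _ _ _]gqC kerBC.
  by rewrite [u (T z') ^+ 2 + _]addrC.
move=> uw hw hw'.
have OTw : Om (T w) by apply: contrapT => /uO/eqP; apply/negP.
have Tw : enorm (T w - q) <= rho.
  by rewrite leNgt; apply/negP => /ltW /urho/eqP; apply/negP.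
have [_ wz] := chart_cover ch OTw Tw.
have [near|far] := ltP (enorm (w - w')) (s / 2).
  apply: (@le_trans _ _ (K `^ a * gq Om u (T w) (T w'))); last first.
    by rewrite lerDl mulr_ge0 ?divr_ge0 ?(ltW m0)// mulr_ge0 ?ker_ge0// addr_ge0 ?sqr_ge0.
  have wz1 : enorm (w - z0) < s by have := sgt0; lra.
  have wz2 : enorm (w' - z0) < s.
    rewrite -(subrKA w); apply: le_lt_trans (ler_enormD _ _) _; rewrite enormBC; have := sgt0; lra.
  have OTw' := chart_in ch wz2 hw'.
  rewrite (gq_in _ _ hw hw') (gq_in _ _ OTw OTw') /=.
  have [<-|ww] := eqVneq w w'; first by rewrite !subrr expr0n !mul0r mulr0.
  have [S G] := chart_diffeo ch.
  have d0 : 0 < enorm (T w - T w').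
    rewrite lt_neqAle enorm_ge0 andbT eq_sym enorm_eq0 subr_eq0.
    by apply: contra_neq ww; exact: (can_inj (diffeoK G)).
  have d1 : 0 < enorm (w - w').
    by rewrite lt_neqAle enorm_ge0 andbT eq_sym enorm_eq0 subr_eq0.
  rewrite mulrCA ler_wpM2l ?sqr_ge0// ler_pdivlMr ?powR_gt0// ler_pdivrMl ?powR_gt0//.
  rewrite mulrC -powRM ?enorm_ge0//; last by have := K1; lra.
  have K0 : 0 <= K by have := K1; lra.
  apply: ge0_ler_powR; rewrite ?nnegrE ?mulr_ge0 ?enorm_ge0//.
    by rewrite addr_ge0// mulr_ge0// ltW.
  rewrite mulrC; exact: (chart_lip ch wz1 wz2).
apply: (@le_trans _ _ (2 / m * ((u (T w) ^+ 2 + u (T w') ^+ 2) * ker (w - w')))); last first.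
  by rewrite lerDr mulr_ge0 ?powR_ge0 ?gq_ge0.
rewrite (gq_in _ _ hw hw') /=.
have s20 : 0 < s / 2 by rewrite divr_gt0.
have := ker_tail sigma s20 far; rewrite -/m => kt.
apply: (@le_trans _ _ ((u (T w) - u (T w')) ^+ 2 * (m^-1 * ker (w - w')))).
  by rewrite ler_wpM2l ?sqr_ge0.
have c0 : 0 <= m^-1 * ker (w - w') by rewrite mulr_ge0 ?ker_ge0// invr_ge0 ltW.
rewrite (_ : 2 / m * _ = 2 * (u (T w) ^+ 2 + u (T w') ^+ 2) * (m^-1 * ker (w - w'))); last by ring.
rewrite ler_wpM2r//; have := sqr_ge0 (u (T w) + u (T w')); nra.
Qed.

Lemma energy_chart : exists2 C : R, 0 <= C & forall u : 'rV[R]_n -> R, measurable_fun setT u ->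
  (forall x, ~ Om x -> u x = 0) -> (forall x, rho <= enorm (x - q) -> u x = 0) ->
  (energy sigma half (u \o T) <= (K `^ a)%:E * energy sigma Om u + C%:E * mass Om u)%E.
Proof.
have m0 : 0 < m by rewrite lt_min ltr01 exprn_gt0// divr_gt0.
have [C C0 hC] := @integral_le_ker R n sigma n2 ltac:(by apply/andP).
have c0 : 0 <= 2 / m by rewrite divr_ge0 ?(ltW m0).
exists (2 / m * C); first exact: mulr_ge0.
move=> u mu' uO urho; have [S G] := chart_diffeo ch; have mT := diffeo_measurable G.
have muT : measurable_fun setT (u \o T) by exact: (measurableT_comp mu' mT).
have mh : measurable half by apply: open_measurable_rv; exact: halfspace_open.
pose f x : R := u (T x) ^+ 2.
have mf : measurable_fun setT f by exact: measurable_funX.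
have f0 x : 0 <= f x by exact: sqr_ge0.
have If : (\int[mu]_x (f x)%:E = mass Om u)%E.
  rewrite mass.unlock rst_id// pint2E.
  apply: (diffeo_integral G (f := fun x => (u x ^+ 2)%:E)); last by move=> x; rewrite lee_fin sqr_ge0.
  by apply/measurable_EFinP; exact: measurable_funX.
have mg := measurable_gq sigma mO mu'.
pose F1 (z : 'rV[R]_n * 'rV[R]_n) : R := gq Om u z.1 z.2.
have mTT : measurable_fun setT (fun z : 'rV[R]_n * 'rV[R]_n => (T z.1, T z.2)).
  apply/measurable_fun_pairP; split.
    exact: (measurableT_comp mT measurable_fst).
  exact: (measurableT_comp mT measurable_snd).
pose A z := F1 (T z.1, T z.2).
have mA : measurable_fun setT A by exact: (measurableT_comp mg mTT).
have <- : (\int[mu2]_z (A z)%:E = energy sigma Om u)%E.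
  rewrite energy_gq; apply: (diffeo_integral2 G (F := fun z => (F1 z)%:E)).
    by apply/measurable_EFinP; exact: mg.
  by move=> z; rewrite lee_fin gq_ge0.
rewrite -If energy_gq.
exact: (hC (fun z => gq half (u \o T) z.1 z.2) A f (K `^ a) (2 / m)
  (measurable_gq sigma mh muT) mA mf (fun z => gq_ge0 _ _ _ _ _) (fun z => gq_ge0 _ _ _ _ _)
  f0 (powR_ge0 _ _) c0 (fun z => chart_pointwise z.1 z.2 uO urho)).
Qed.

Lemma lpow_chart (u : 'rV[R]_n -> R) : measurable_fun setT u -> (forall x, ~ Om x -> u x = 0) ->
  (forall x, rho <= enorm (x - q) -> u x = 0) ->
  lpow sigma half (u \o T) = lpow sigma Om u.
Proof.
move=> mu' uO urho; have [S G] := chart_diffeo ch.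
have vO z : ~ half z -> (u \o T) z = 0.
  move=> nz /=; have [OT|nOT] := pselect (Om (T z)); last exact: uO.
  apply: urho; rewrite leNgt; apply/negP => /ltW h; apply: nz.
  by have [] := chart_cover ch OT h.
rewrite lpow.unlock (rst_id uO) (rst_id vO).
apply: (diffeo_integral G (f := fun x => (`|u x| `^ p)%:E)); last by move=> x; rewrite lee_fin powR_ge0.
by apply/measurable_EFinP; exact: measurable_pw.
Qed.

Lemma chart_C1c u : C1c Om u -> (forall x, rho <= enorm (x - q) -> u x = 0) ->
  C1c half (u \o T).
Proof.
move=> [uC [L [cL LO uL]]] urho; have [S G] := chart_diffeo ch; split; first exact: diffeo_C1 G _ uC.
(* [chart_cover] speaks only of points within [rho] of [q], so the support is cut there before it is
   carried to the half-space; [u] vanishes beyond. *)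
pose L' := L `&` [set x | enorm (x - q) <= rho].
exists (S @` L'); split.
- apply: continuous_compact.
    by apply: continuous_subspaceT; exact: diffeo_continuous G.
  apply: (subclosed_compact _ cL); last by move=> x [].
  apply: closedI; last exact: closed_eball.
  by apply: compact_closed => //; exact: norm_hausdorff.
- move=> _ [x [Lx xr] <-].
  have TS : T (S x) = x by exact: diffeoVK G _.
  have OT : Om (T (S x)) by rewrite TS; exact: LO.
  have Tr : enorm (T (S x) - q) <= rho by rewrite TS.
  by case: (chart_cover ch OT Tr).
- move=> z nz /=; have [LT|nLT] := pselect (L (T z)); last exact: uL.
  apply: urho; rewrite leNgt; apply/negP => /ltW h; apply: nz.
  by exists (T z); [split|exact: diffeoK G _].
Qed.

Lemma local_ineq (S1 : R) : 0 < S1 -> (S1%:E <= Sconst sigma half)%E ->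
  exists2 C : R, 0 <= C & forall u, C1c Om u -> (forall x, rho <= enorm (x - q) -> u x = 0) ->
  (energy sigma Om u < +oo)%E -> (mass Om u < +oo)%E ->
  S1 * fine (lpow sigma Om u) `^ (2 / p) <=
    K `^ a * fine (energy sigma Om u) + C * fine (mass Om u).
Proof.
move=> S10 S1h; have [C C0 hC] := energy_chart; exists C => // u uC urho Ef Mf.
have mu' := C1c_measurable uC.
have uO x : ~ Om x -> u x = 0.
  by move=> nO; have [_ [L [_ LO]]] := uC; apply => /LO.
have mh : measurable half by apply: open_measurable_rv; exact: halfspace_open.
have [f1 f2] := Sconst_le n2 s0 s1 mh S10 S1h (chart_C1c uC urho).
rewrite lpow_chart// => /le_trans; apply.
have := hC u mu' uO urho.
by rewrite -(energy_fineK f1) -(energy_fineK Ef) -(mass_fineK Mf) -!EFinM -EFinD lee_fin.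
Qed.

End LocalInequality.

(** * The global inequality *)

Section GlobalInequality.
Context {R : realType} (n : nat) (sigma : R).
Hypothesis (n2 : (2 <= n)%N) (s0 : 0 < sigma) (s1 : sigma < 1).
Local Notation p := (pstar n sigma).
Local Notation a := (n%:R + 2 * sigma).
Local Notation mu := (leb n).
Local Notation mu2 := ((leb n \x leb n)%E).
Local Notation ker := (ker sigma).
Local Notation gq := (gq sigma).
Local Notation half := (@halfspace R n).
Context (Om : set 'rV[R]_n) (B : R).
Hypotheses (oO : open Om) (OB : forall x, Om x -> enorm x <= B) (bO : C1_boundary Om).
Let mO : measurable Om := open_measurable_rv oO.

Lemma closure_bounded x : closure Om x -> enorm x <= B.
Proof.
move=> /closureP_eball cx; rewrite leNgt; apply/negP => gt.
have d0 : 0 < enorm x - B by rewrite subr_gt0.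
have [y /OB yB yx] := cx _ d0.
have := ler_enormD (x - y) y; rewrite subrK enormBC; lra.
Qed.

Lemma compact_closure : compact (closure Om).
Proof. by apply: (@compact_enorm _ _ _ B); [exact: closed_closure|exact: closure_bounded]. Qed.

Lemma C1lip_C1 (D : set 'rV[R]_n) f : C1lip D f -> C1 f.
Proof. by case=> h _; exact/C1P. Qed.

(** The squares of the [eta j] sum to 1 at both points, so the localized squares sum to
    [(u x - u y)^2] plus [u x * u y] times the sum of [(eta j x - eta j y)^2]. The bounds of [C1lip]
    make the latter sum at most a multiple of [min(1, |x - y|^2)], the numerator of [ker]. *)
Lemma sum_gq_le (N : nat) (eta : 'I_N -> 'rV[R]_n -> R) :
  (forall j, C1lip Om (eta j)) -> (forall x, Om x -> \sum_(j < N) eta j x ^+ 2 = 1) ->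
  exists2 C : R, 0 <= C & forall u x y,
  \sum_(j < N) gq Om (fun z => eta j z * u z) x y <=
    gq Om u x y + C * ((u x ^+ 2 + u y ^+ 2) * ker (x - y)).
Proof.
move=> eL e1.
have sq (t c : R) : `|t| <= c -> t ^+ 2 <= c ^+ 2.
  by move=> h; rewrite -[t ^+ 2]real_normK ?num_real// ler_sqr ?nnegrE// (le_trans _ h).
have eM j : exists M : R, 0 <= M /\ forall x y, Om x -> Om y ->
    (eta j x - eta j y) ^+ 2 <= M * Num.min 1 (enorm (x - y) ^+ 2).
  have [_ [M M0 hM]] := eL j; exists (4 * M ^+ 2); split; first by rewrite mulr_ge0 ?sqr_ge0.
  move=> x y Ox Oy; have [h1 h2] := hM x y Ox Oy; have [h3 _] := hM y x Oy Ox.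
  have M2 : 0 <= M ^+ 2 by exact: sqr_ge0.
  have [_|_] := leP 1 (enorm (x - y) ^+ 2).
    have : `|eta j x - eta j y| <= 2 * M by apply: le_trans (ler_normB _ _) _; lra.
    by move=> /sq; rewrite mulr1 exprMn (_ : 2 ^+ 2 = 4)// expr2; ring.
  apply: le_trans (sq _ _ h2) _; rewrite exprMn ler_wpM2r ?sqr_ge0//; lra.
have [M hM] := choice eM.
have MS : 0 <= \sum_j M j by apply: sumr_ge0 => j _; case: (hM j).
exists (\sum_j M j) => // u x y.
have rhs0 : 0 <= (\sum_j M j) * ((u x ^+ 2 + u y ^+ 2) * ker (x - y)).
  by rewrite mulr_ge0// mulr_ge0 ?ker_ge0// addr_ge0 ?sqr_ge0.
have [Ox|nO] := pselect (Om x); last first.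
  by rewrite big1 ?gq_out ?add0r// => j _; rewrite gq_out.
have [Oy|nO] := pselect (Om y); last first.
  have g0 w : gq Om w x y = 0 by rewrite gqC gq_out.
  by rewrite big1 ?g0 ?add0r// => j _; exact: g0.
rewrite gq_in//; under eq_bigr do rewrite gq_in//.
have E : \sum_j (eta j x * u x - eta j y * u y) ^+ 2 =
    (u x - u y) ^+ 2 + u x * u y * \sum_j (eta j x - eta j y) ^+ 2.
  have -> : \sum_j (eta j x - eta j y) ^+ 2 = 2 - 2 * \sum_j (eta j x * eta j y).
    transitivity (\sum_j (eta j x ^+ 2 + eta j y ^+ 2 + (- 2) * (eta j x * eta j y))).
      by apply: eq_bigr => j _; ring.
    by rewrite !big_split /= !e1// -mulr_sumr mulNr.
  transitivity (\sum_j (eta j x ^+ 2 * u x ^+ 2 + eta j y ^+ 2 * u y ^+ 2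
      + (- 2 * u x * u y) * (eta j x * eta j y))).
    by apply: eq_bigr => j _; ring.
  by rewrite !big_split /= -!mulr_suml -mulr_sumr !e1//; ring.
rewrite -mulr_suml E mulrDl lerD2l /ker mulrA mulrA ler_wpM2r ?invr_ge0 ?powR_ge0//.
have le : \sum_j (eta j x - eta j y) ^+ 2 <= (\sum_j M j) * Num.min 1 (enorm (x - y) ^+ 2).
  by rewrite mulr_suml; apply: ler_sum => j _; case: (hM j) => _ ->.
have S0 : 0 <= \sum_j (eta j x - eta j y) ^+ 2 by apply: sumr_ge0 => j _; exact: sqr_ge0.
apply: (@le_trans _ _ ((u x ^+ 2 + u y ^+ 2) * \sum_j (eta j x - eta j y) ^+ 2)).
  rewrite ler_wpM2r//; have := sqr_ge0 (u x - u y); have := sqr_ge0 (u x); have := sqr_ge0 (u y); nra.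
rewrite [leRHS](_ : _ = (u x ^+ 2 + u y ^+ 2) * ((\sum_j M j) * Num.min 1 (enorm (x - y) ^+ 2))); last by ring.
by rewrite ler_wpM2l ?addr_ge0 ?sqr_ge0.
Qed.

Lemma sum_energy_le (N : nat) (eta : 'I_N -> 'rV[R]_n -> R) :
  (forall j, C1lip Om (eta j)) -> (forall x, Om x -> \sum_(j < N) eta j x ^+ 2 = 1) ->
  exists2 C : R, 0 <= C & forall u, C1c Om u ->
  (\sum_(j < N) energy sigma Om (fun z => eta j z * u z)%R <=
    energy sigma Om u + C%:E * mass Om u)%E.
Proof.
move=> eL e1; have [C C0 hC] := sum_gq_le eL e1.
have [C' C'0 hC'] := @integral_le_ker R n sigma n2 ltac:(by apply/andP).
exists (C * C'); first exact: mulr_ge0.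
move=> u uC; have mu' := C1c_measurable uC.
have uO x : ~ Om x -> u x = 0.
  by move=> nO; have [_ [L [_ LO]]] := uC; apply => /LO.
have meu j : measurable_fun setT (fun z => eta j z * u z).
  apply: measurable_funM => //.
  exact: continuous_measurable_rv (C1_continuous (C1lip_C1 (eL j))).
pose G j (z : 'rV[R]_n * 'rV[R]_n) : R := gq Om (fun w => eta j w * u w) z.1 z.2.
have mG j : measurable_fun setT (G j) by exact: (measurable_gq sigma mO (meu j)).
have G0 j z : 0 <= G j z by exact: gq_ge0.
have mG' j : measurable_fun setT (fun z => (G j z)%:E) by apply/measurable_EFinP.
have G0' j z : (0 <= (G j z)%:E)%E by rewrite lee_fin.
have -> : (\sum_(j < N) energy sigma Om (fun z => eta j z * u z)%R =
    \int[mu2]_z (\sum_(j < N) G j z)%:E)%E.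
  under [RHS]eq_integral do rewrite -sumEFin.
  rewrite (ge0_integral_sum mu2 measurableT mG' (fun j z _ => G0' j z)).
  by apply: eq_bigr => j _; rewrite energy_gq.
have -> : (mass Om u = \int[mu]_x (u x ^+ 2)%:E)%E by rewrite mass.unlock rst_id// pint2E.
rewrite energy_gq -[(\int[mu2]_z _)%E in leRHS]mul1e.
have mS : measurable_fun setT (fun z => \sum_(j < N) G j z) by exact: measurable_sum.
have SG0 z : 0 <= \sum_(j < N) G j z by apply: sumr_ge0 => j _; exact: G0.
have SG z : \sum_(j < N) G j z <= 1 * gq Om u z.1 z.2 + C * ((u z.1 ^+ 2 + u z.2 ^+ 2) * ker (z.1 - z.2)).
  by rewrite mul1r; exact: hC.
exact: (hC' (fun z => \sum_(j < N) G j z) (fun z => gq Om u z.1 z.2) (fun x => u x ^+ 2) 1 C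
  mS (measurable_gq sigma mO mu') (measurable_funX 2 mu') SG0 (fun z => gq_ge0 _ _ _ _ _)
  (fun x => sqr_ge0 _) ler01 C0 SG).
Qed.

Lemma domain_measure : exists c : R, (mu Om <= c%:E)%E.
Proof.
have [/eqP O0|/set0P[x0 Ox0]] := boolP (Om == set0); last first.
  have B0 : 0 <= B by apply: le_trans (OB Ox0); exact: enorm_ge0.
  exists ((2 * (B + 1)) ^+ n).
  apply: (@le_trans _ _ (mu (eball 0 (B + 1)))).
    apply: le_measure; rewrite ?inE//; first exact: measurable_eball.
    by move=> x /OB xB; rewrite /eball /= subr0; lra.
  by apply: leb_eball_le; lra.
by exists 0; rewrite O0 measure0.
Qed.

Lemma chart_at (K : R) (q : 'rV[R]_n) : 1 < K -> closure Om q ->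
  exists rho, 0 < rho /\ exists T z0 s, 0 < s /\ chart Om q K rho T z0 s.
Proof.
move=> K1 cq; have [Oq|nOq] := pselect (Om q).
  by apply: interior_chart => //; exact: ltW.
exact: boundary_chart.
Qed.

Lemma global_ineq (S S1 S2 : R) : 0 < S -> (S%:E <= Sconst sigma Om)%E ->
  0 < S2 -> S2 < S1 -> (S1%:E <= Sconst sigma half)%E ->
  exists2 C : R, 0 <= C & forall u, C1c Om u ->
    S2 * fine (lpow sigma Om u) `^ (2 / p) <=
    1 * fine (energy sigma Om u) + C * fine (mass Om u).
Proof.
move=> Sgt0 SO S20 S21 S1h; have [c muO] := domain_measure.
have S10 : 0 < S1 := lt_trans S20 S21.
have a0 : 0 < a by rewrite ltr_wpDl// mulr_gt0.
(* The loss [K^a] of a chart is set equal to the room between [S1] and [S2]. *)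
pose K := (S1 / S2) `^ (a^-1).
have Ka : K `^ a = S1 / S2.
  by rewrite /K -powRrM mulVf ?gt_eqF// powRr1// divr_ge0// ltW.
have K1 : 1 < K.
  have one : 1 `^ a^-1 = 1 :> R by rewrite powR1.
  rewrite -[X in X < _]one /K; apply: gt0_ltr_powR.
  - by rewrite invr_gt0.
  - by rewrite nnegrE.
  - by rewrite nnegrE divr_ge0// ltW.
  - by rewrite ltr_pdivlMr ?mul1r.
(* Radius and constant are fixed at each point of the closure before compactness selects finitely
   many points; [(0, 0)] is a dummy value outside the closure. *)
have ex q : exists rC : R * R, closure Om q -> [/\ 0 < rC.1, 0 <= rC.2 &
    forall u, C1c Om u -> (forall x, rC.1 <= enorm (x - q) -> u x = 0) ->
    (energy sigma Om u < +oo)%E -> (mass Om u < +oo)%E ->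
    S1 * fine (lpow sigma Om u) `^ (2 / p) <=
      K `^ a * fine (energy sigma Om u) + rC.2 * fine (mass Om u)].
  have [cq|ncq] := pselect (closure Om q); last by exists (0, 0).
  have [rho [rho0 [T [z0 [s [sgt0 ch]]]]]] := chart_at K1 cq.
  have [C C0 hC] := local_ineq n2 s0 s1 mO sgt0 (ltW K1) ch S10 S1h.
  by exists (rho, C).
have [rC hrC] := choice ex.
have [N [q [eta [qK eL e0 e1]]]] := partition_of_unity OB compact_closure
  (rad := fun q => (rC q).1) (fun q cq => let: And3 h _ _ := hrC q cq in h).
have eta1 x : Om x -> \sum_(j < N) eta j x ^+ 2 = 1.
  by move=> Ox; apply: e1; exact: subset_closure.
have [C C0 hC] := sum_energy_le eL eta1.
have Cq0 : 0 <= \sum_j (rC (q j)).2 by apply: sumr_ge0 => j _; case: (hrC _ (qK j)).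
have Ka0 : 0 < K `^ a by rewrite Ka divr_gt0.
exists (C + (K `^ a)^-1 * \sum_j (rC (q j)).2).
  by rewrite addr_ge0// mulr_ge0// invr_ge0 ltW.
move=> u uC; have mu' := C1c_measurable uC.
pose v j x := eta j x * u x.
have vC j : C1c Om (v j) by apply: C1cM => //; exact: C1lip_C1 (eL j).
have mv j := C1c_measurable (vC j).
have [Eu Lu _] := Sconst_le n2 s0 s1 mO Sgt0 SO uC.
have Mu := mass_fin n2 s0 s1 mO muO mu' Lu.
have Ev j : (energy sigma Om (v j) < +oo)%E by case: (Sconst_le n2 s0 s1 mO Sgt0 SO (vC j)).
have Lv j : (lpow sigma Om (v j) < +oo)%E by case: (Sconst_le n2 s0 s1 mO Sgt0 SO (vC j)).
have Mv j := mass_fin n2 s0 s1 mO muO (mv j) (Lv j).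
have Mle j : fine (mass Om (v j)) <= fine (mass Om u).
  rewrite -lee_fin !mass_fineK// mass.unlock; apply: le_pint => //; [exact: measurable_rst..|].
  move=> x; rewrite /rst indicE; have [Ox|nO] := pselect (Om x); last first.
    by rewrite memNset// !mul0r.
  rewrite mem_set// !mul1r /v normrM ler_piMl//.
  have : eta j x ^+ 2 <= 1.
    rewrite -(eta1 x Ox) (bigD1 j)//= lerDl; apply: sumr_ge0 => i _; exact: sqr_ge0.
  by rewrite -[eta j x ^+ 2]real_normK ?num_real// expr_le1.
(* On [Om], [u^2] is the sum of the [v j ^+ 2], so Minkowski in [L^(p/2)] applies. *)
have Lsum : fine (lpow sigma Om u) `^ (2 / p) <= \sum_j fine (lpow sigma Om (v j)) `^ (2 / p).
  have p2 : 2 <= p by apply: ltW; exact: pstar_gt2.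
  have h : (psq mu p (rst Om u) <= \sum_j psq mu p (rst Om (v j)))%E.
    apply: psq_sum => //; [exact: measurable_rst|by move=> j; exact: measurable_rst|].
    move=> x; rewrite /rst indicE; have [Ox|nO] := pselect (Om x); last first.
      by rewrite memNset// mul0r expr0n sumr_ge0// => j _; exact: sqr_ge0.
    rewrite mem_set// mul1r; under eq_bigr do rewrite mul1r /v exprMn.
    by rewrite -mulr_suml eta1// mul1r.
  have pE w : (lpow sigma Om w < +oo)%E -> psq mu p (rst Om w) =
      (fine (lpow sigma Om w) `^ (2 / p))%:E.
    by move=> wf; rewrite -poweR_EFin lpow_fineK// lpow.unlock.
  by rewrite pE// in h; rewrite -lee_fin -sumEFin; apply: le_trans h _; apply: lee_sum => j _; rewrite pE.
have Esum : \sum_j fine (energy sigma Om (v j)) <= fine (energy sigma Om u) + C * fine (mass Om u).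
  rewrite -lee_fin -sumEFin EFinD EFinM energy_fineK// mass_fineK//.
  by under eq_bigr do rewrite energy_fineK//; exact: hC.
have : S1 * fine (lpow sigma Om u) `^ (2 / p) <=
    K `^ a * (fine (energy sigma Om u) + C * fine (mass Om u)) +
    (\sum_j (rC (q j)).2) * fine (mass Om u).
  apply: (@le_trans _ _ (\sum_j S1 * fine (lpow sigma Om (v j)) `^ (2 / p))).
    by rewrite -mulr_sumr ler_wpM2l// ltW.
  apply: (@le_trans _ _ (\sum_j (K `^ a * fine (energy sigma Om (v j)) +
      (rC (q j)).2 * fine (mass Om u)))).
    apply: ler_sum => j _; have [_ h2 h3] := hrC _ (qK j).
    apply: le_trans (h3 (v j) (vC j) _ (Ev j) (Mv j)) _.
      by move=> x xq; rewrite /v e0// mul0r.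
    by rewrite lerD2l ler_wpM2l.
  by rewrite big_split /= -mulr_sumr -mulr_suml lerD2r ler_wpM2l// ltW.
set X := fine (lpow _ _ _) `^ _; set Y := fine (energy _ _ _); set Z := fine (mass _ _).
set D := \sum_j _ => h.
(* Dividing by [K^a = S1 / S2] turns [S1] into [S2] and restores the coefficient 1 of the energy. *)
have -> : S2 = (K `^ a)^-1 * S1 by rewrite Ka; field; rewrite !gt_eqF.
rewrite -mulrA ler_pdivrMl// mul1r; apply: le_trans h _.
move: (K `^ a) Ka0 => k k0; rewrite le_eqVlt; apply/orP; left; apply/eqP.
by field; rewrite gt_eqF.
Qed.

End GlobalInequality.

(** * Compactness in L^2 *)

Section Subsequences.

Lemma homo_ge_id (psi : nat -> nat) : {homo psi : i j / (i < j)%N} -> forall k, (k <= psi k)%N.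
Proof. by move=> h; elim=> // k IH; apply: leq_ltn_trans IH (h _ _ _). Qed.

Lemma homo_step (psi : nat -> nat) : (forall k, psi k < psi k.+1)%N ->
  {homo psi : i j / (i < j)%N}.
Proof. by move=> h; apply: homo_ltn => //; exact: ltn_trans. Qed.

Lemma extract (P : nat -> Prop) : (forall N, exists k, (N <= k)%N /\ P k) ->
  exists psi : nat -> nat, {homo psi : i j / (i < j)%N} /\ forall i, P (psi i).
Proof.
move=> /choice[f hf]; pose psi := fix psi i := if i is j.+1 then f (psi j).+1 else f 0%N.
exists psi; split; first by apply: homo_step => k /=; have [] := hf (psi k).+1.
by case=> [|i] /=; [have [] := hf 0%N|have [] := hf (psi i).+1].
Qed.

Lemma pigeonhole (T : finType) (f : nat -> T) :
  exists t, forall N, exists k, (N <= k)%N /\ f k = t.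
Proof.
apply: contrapT => /forallNP h.
have /choice[M hM] : forall t, exists N, forall k, (N <= k)%N -> f k <> t.
  move=> t; have /existsNP[N hN] := h t; exists N => k Nk ft.
  by apply: hN; exists k.
have := hM (f (\max_t M t)%N) (\max_t M t)%N; apply=> //.
exact: (leq_bigmax (f (\max_t M t)%N)).
Qed.

(** Values are rounded to multiples of [del], which leaves finitely many labels per coordinate; by
    the pigeonhole principle one family of labels recurs infinitely often. *)
Lemma bounded_subsequence {R : realType} (T : finType) (c : nat -> T -> R) (W del : R) :
  0 < del -> (forall k t, `|c k t| <= W) ->
  exists psi : nat -> nat, {homo psi : i j / (i < j)%N} /\
    forall i j t, `|c (psi i) t - c (psi j) t| <= del.
Proof.
move=> d0 cW; pose M := Num.truncn (2 * W / del).
pose l k t : nat := Num.truncn ((c k t + W) / del).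
have l0 k t : 0 <= (c k t + W) / del.
  by rewrite divr_ge0 ?(ltW d0)//; have := cW k t; rewrite ler_norml; lra.
have lM k t : (l k t < M.+1)%N.
  rewrite ltnS; apply: le_truncn; rewrite ler_pM2r ?invr_gt0//.
  by have := cW k t; rewrite ler_norml; lra.
pose f k : {ffun T -> 'I_M.+1} := [ffun t => Ordinal (lM k t)].
have [t0 /extract[psi [hpsi fpsi]]] := pigeonhole f.
exists psi; split=> // i j t.
have /ffunP/(_ t) : f (psi i) = f (psi j) by rewrite !fpsi.
rewrite !ffunE => /(congr1 val) /= e.
have /andP[a1 a2] := truncn_itv (l0 (psi i) t).
have /andP[b1 b2] := truncn_itv (l0 (psi j) t).
move: a1 a2 b1 b2; rewrite -/(l (psi i) t) -/(l (psi j) t) e.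
rewrite !ler_pdivlMr// !ltr_pdivrMr// -natr1 mulrDl mul1r.
by rewrite ler_norml => *; apply/andP; split; lra.
Qed.

(** Cantor's diagonal: each [phi k] refines the previous sequence so that all its pairs satisfy
    [D k], and from index [k] on the diagonal runs through values of [phi k]. *)
Lemma diagonal_subsequence (D : nat -> nat -> nat -> Prop) :
  (forall m (phi : nat -> nat), {homo phi : i j / (i < j)%N} ->
    exists psi : nat -> nat, {homo psi : i j / (i < j)%N} /\
      forall i j, D m (phi (psi i)) (phi (psi j))) ->
  exists theta : nat -> nat, {homo theta : i j / (i < j)%N} /\
    forall k i j, (k <= i)%N -> (k <= j)%N -> D k (theta i) (theta j).
Proof.
move=> h.
have /choice[f hf] : forall mphi : nat * (nat -> nat), exists psi : nat -> nat,
    {homo mphi.2 : i j / (i < j)%N} -> {homo psi : i j / (i < j)%N} /\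
      forall i j, D mphi.1 (mphi.2 (psi i)) (mphi.2 (psi j)).
  move=> [m phi] /=; have [hp|hp] := pselect {homo phi : i j / (i < j)%N}.
    by have [psi hpsi] := h m phi hp; exists psi.
  by exists id => /hp.
pose st m phi : nat -> nat := phi \o f (m, phi).
pose phi := fix phi k : nat -> nat := if k is j.+1 then st k (phi j) else st 0%N id.
have hst m ph : {homo ph : i j / (i < j)%N} -> {homo st m ph : i j / (i < j)%N}.
  by move=> hp i j ij; have [h1 _] := hf (m, ph) hp; exact: hp (h1 _ _ ij).
have hphi k : {homo phi k : i j / (i < j)%N}.
  by elim: k => [|k IH] /=; apply: hst.
have Dphi k i j : D k (phi k i) (phi k j).
  by case: k => [|k]; [have [_] := hf (0%N, id) (fun i j => id)|have [_] := hf (k.+1, phi k) (hphi k)]; apply.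
have sub k m x : exists y, phi (k + m)%N x = phi k y.
  elim: m x => [|m IH] x; first by exists x; rewrite addn0.
  by rewrite addnS /= /st /=; exact: IH.
exists (fun k => phi k k); split=> [|k i j ki kj].
  apply: homo_step => k /=; have [h1 _] := hf (k.+1, phi k) (hphi k).
  by apply: hphi; exact: homo_ge_id h1 k.+1.
have [x xi] := sub k (i - k)%N i; have [y yj] := sub k (j - k)%N j.
by rewrite subnKC// in xi; rewrite subnKC// in yj; rewrite xi yj; exact: Dphi.
Qed.

End Subsequences.

(** * Approximation by constants on cells *)

Section Cells.
Context {R : realType} (n : nat).
Local Notation mu := (leb n).
Local Notation mu2 := ((leb n \x leb n)%E).
Implicit Types (u w : 'rV[R]_n -> R) (Q Om : set 'rV[R]_n).

(** Integrated over [z.1] with [z.2] fixed in [Q], this is the mass on [Q] of [u] minus the constant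
    [u z.2]. *)
Definition osc Q u (z : 'rV[R]_n * 'rV[R]_n) : R := \1_Q z.2 * (\1_Q z.1 * (u z.1 - u z.2)) ^+ 2.

Lemma osc_ge0 Q u z : 0 <= osc Q u z.
Proof. by rewrite mulr_ge0 ?sqr_ge0// indicE ler0n. Qed.

Lemma measurable_osc Q u : measurable Q -> measurable_fun setT u ->
  measurable_fun setT (osc Q u).
Proof.
move=> mQ mu'.
have m1 : measurable_fun setT (fun z : 'rV[R]_n * 'rV[R]_n => (\1_Q z.1 : R)).
  exact: (measurableT_comp (measurable_indic mQ) measurable_fst).
have m2 : measurable_fun setT (fun z : 'rV[R]_n * 'rV[R]_n => (\1_Q z.2 : R)).
  exact: (measurableT_comp (measurable_indic mQ) measurable_snd).
have u1 : measurable_fun setT (fun z : 'rV[R]_n * 'rV[R]_n => u z.1).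
  exact: (measurableT_comp mu' measurable_fst).
have u2 : measurable_fun setT (fun z : 'rV[R]_n * 'rV[R]_n => u z.2).
  exact: (measurableT_comp mu' measurable_snd).
apply: measurable_funM => //; apply: measurable_funX.
by apply: measurable_funM => //; exact: measurable_funB.
Qed.

Lemma massE Q w : mass Q w = (\int[mu]_x ((rst Q w x) ^+ 2)%:E)%E.
Proof. by rewrite mass.unlock pint2E. Qed.

(* Some value of [u] on [Q] is a nearly optimal constant approximation of [u]. *)
Lemma cell_const Q u (v G eta : R) : measurable Q -> measurable_fun setT u ->
  0 < v -> mu Q = v%:E -> 0 < eta -> (\int[mu2]_z (osc Q u z)%:E <= G%:E)%E ->
  exists c : R, (mass Q (fun x => u x - c)%R <= ((G + eta) / v)%:E)%E.
Proof.
move=> mQ mu' v0 Qv eta0 hG; apply: contrapT => /forallNP hc.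
have mo := measurable_osc mQ mu'.
pose F (z : 'rV[R]_n * 'rV[R]_n) : \bar R := (osc Q u z)%:E.
have mF : measurable_fun setT F by apply/measurable_EFinP.
have F0 z : (0 <= F z)%E by rewrite lee_fin osc_ge0.
have G0 : 0 <= G by rewrite -lee_fin; apply: le_trans hG; exact: integralT_ge0.
have GG : 0 <= (G + eta) / v by rewrite divr_ge0 ?(ltW v0)// addr_ge0// ltW.
(* Otherwise each constant [u y] with [y] in [Q] fails; integrating the failure over [Q], of measure
   [v], gives [G + eta <= G]. *)
have : (\int[mu]_y (((G + eta) / v)%:E * (\1_Q y)%:E) <= \int[mu2]_z F z)%E.
  rewrite (fubini_tonelli2 F mF F0); apply: integralT_le.
  - by apply: measurable_funeM; apply/measurable_EFinP; exact: measurable_indic.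
  - exact: (measurable_fun_fubini_tonelli_G F mF).
  - by move=> y; rewrite mule_ge0 ?lee_fin.
  move=> y; have [Qy|nQ] := pselect (Q y); last first.
    by rewrite indicE memNset// mule0; exact: integralT_ge0.
  rewrite indicE mem_set// mule1; have /negP := hc (u y); rewrite -ltNge => /ltW.
  move=> /le_trans; apply; rewrite massE le_eqVlt; apply/orP; left; apply/eqP.
  by apply: eq_integral => x _; rewrite /F /osc /= indicE mem_set// mul1r.
have mI : measurable_fun setT (fun x => (\1_Q x : R)%:E).
  by apply/measurable_EFinP; exact: measurable_indic.
rewrite (integralT_Z mu GG mI); last by move=> x; rewrite lee_fin.
have -> : (\int[mu]_x (\1_Q x)%:E = v%:E)%E by rewrite -Qv; exact: (integral_indicT mu mQ).
rewrite -EFinM divfK ?gt_eqF// => /le_trans/(_ hG).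
by rewrite lee_fin; lra.
Qed.

Lemma mass_mono A Om u : measurable A -> measurable Om -> A `<=` Om ->
  measurable_fun setT u -> (mass A u <= mass Om u)%E.
Proof.
move=> mA mO AO mu'; rewrite mass.unlock; apply: le_pint => //; [exact: measurable_rst..|].
move=> x; rewrite /rst !indicE; have [Ax|nA] := pselect (A x).
  by rewrite !mem_set//; exact: AO.
by rewrite memNset// mul0r normr0.
Qed.

Lemma massD3_le Q u w f : measurable Q -> measurable_fun setT u -> measurable_fun setT w ->
  measurable_fun setT f ->
  (mass Q (fun x => u x + w x + f x)%R <= 3%:E * mass Q u + 3%:E * mass Q w + 3%:E * mass Q f)%E.
Proof.
move=> mQ mu' mw mf; rewrite !massE.
have m g : measurable_fun setT g -> measurable_fun setT (fun x => (rst Q g x ^+ 2)%:E).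
  by move=> mg; apply/measurable_EFinP; apply: measurable_funX; exact: measurable_rst.
have z g x : (0 <= (rst Q g x ^+ 2)%:E)%E by rewrite lee_fin sqr_ge0.
have t0 : 0 <= 3 :> R by [].
have z3 g x : (0 <= 3%:E * (rst Q g x ^+ 2)%:E)%E by rewrite mule_ge0.
have m3 g : measurable_fun setT g -> measurable_fun setT (fun x => 3%:E * (rst Q g x ^+ 2)%:E)%E.
  by move=> mg; exact: measurable_funeM (m _ mg).
rewrite -(integralT_Z mu t0 (m _ mu') (z u)) -(integralT_Z mu t0 (m _ mw) (z w)).
rewrite -(integralT_Z mu t0 (m _ mf) (z f)).
rewrite -(integralT_D mu (m3 _ mu') (m3 _ mw) (z3 u) (z3 w)).
have m6 := emeasurable_funD (m3 _ mu') (m3 _ mw).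
have z6 x : (0 <= 3%:E * (rst Q u x ^+ 2)%:E + 3%:E * (rst Q w x ^+ 2)%:E)%E := adde_ge0 (z3 u x) (z3 w x).
rewrite -(integralT_D mu m6 (m3 _ mf) z6 (z3 f)).
apply: integralT_le.
- by apply: m; apply: measurable_funD => //; exact: measurable_funD.
- exact: (emeasurable_funD m6 (m3 _ mf)).
- exact: z.
move=> x; rewrite -!EFinM -!EFinD lee_fin /rst; case: (indic01 Q x) => ->.
  by rewrite !mul0r !expr0n/= !mulr0 !addr0.
rewrite !mul1r; have := sqr_ge0 (u x - w x); have := sqr_ge0 (u x - f x).
by have := sqr_ge0 (w x - f x); nra.
Qed.

End Cells.

Section TotalBoundedness.
Context {R : realType} (n : nat) (sigma : R).
Hypothesis (s0 : 0 < sigma).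
Local Notation a := (n%:R + 2 * sigma).
Local Notation mu := (leb n).
Local Notation mu2 := ((leb n \x leb n)%E).
Local Notation gq := (gq sigma).
Context (Om : set 'rV[R]_n) (B c0 : R).
Hypotheses (oO : open Om) (OB : forall x, Om x -> enorm x <= B) (muO : (mu Om <= c0%:E)%E).
Let mO : measurable Om := open_measurable_rv oO.

(** Half-open, so that distinct cells are disjoint; a point of [Om] lies in exactly one of them once
    [M] steps of length [h] cover [[-B, B]]. *)
Definition cell (h : R) (M : nat) (J : {ffun 'I_n -> 'I_M}) : set 'rV[R]_n :=
  cube (fun i => `[- B + h * (J i)%:R, - B + h * (J i).+1%:R[%classic).

Section FixedScale.
Context (h : R) (M : nat).
Hypothesis h0 : 0 < h.
Implicit Types J : {ffun 'I_n -> 'I_M}.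

Lemma cellP J x : cell h J x <->
  forall i, h * (J i)%:R <= x ord0 i + B /\ x ord0 i + B < h * (J i)%:R + h.
Proof.
split=> H i; have := H i; rewrite /= in_itv /= -natr1 mulrDr mulr1.
  by move=> /andP[H1 H2]; split; lra.
by move=> [H1 H2]; apply/andP; split; lra.
Qed.

Lemma measurable_cell J : measurable (cell h J).
Proof. by apply: measurable_cube => i; exact: measurable_itv. Qed.

Lemma cell_measure J : mu (cell h J) = (h ^+ n)%:E.
Proof.
apply: leb_cube; [exact: ltW|by move=> i; exact: measurable_itv|move=> i].
rewrite lebesgue_measure_itv /= lte_fin -natr1 mulrDr mulr1.
rewrite (_ : _ < _ = true); last by rewrite ltrD2l ltrDl.
by rewrite -EFinD; congr (_%:E); ring.
Qed.

Lemma cell_cover x : 2 * B / h < M%:R -> Om x -> exists J, cell h J x.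
Proof.
move=> hM Ox; have xB i : `|x ord0 i| <= B.
  by apply: le_trans (OB Ox); exact: ler_coord_enorm.
have l0 i : 0 <= (x ord0 i + B) / h.
  by rewrite divr_ge0 ?(ltW h0)//; have := xB i; rewrite ler_norml; lra.
have lM i : (Num.truncn ((x ord0 i + B) / h) < M)%N.
  rewrite truncn_lt_nat//; apply: le_lt_trans hM; rewrite ler_pM2r ?invr_gt0//.
  by have := xB i; rewrite ler_norml; lra.
exists [ffun i => Ordinal (lM i)]; apply/cellP => i; rewrite ffunE /=.
have /andP[] := truncn_itv (l0 i); set t := Num.truncn _.
by rewrite ler_pdivlMr// ltr_pdivrMr// -natr1 mulrDl mul1r ![h * _]mulrC.
Qed.

Lemma cell_inj J J' x : cell h J x -> cell h J' x -> J = J'.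
Proof.
move=> /cellP H /cellP H'; apply/ffunP => i; apply/val_inj => /=.
have [a1 a2] := H i; have [b1 b2] := H' i.
have k1 : h * (J i)%:R < h * (J' i).+1%:R by rewrite -natr1 mulrDr mulr1; lra.
have k2 : h * (J' i)%:R < h * (J i).+1%:R by rewrite -natr1 mulrDr mulr1; lra.
move: k1 k2; rewrite !ltr_pM2l// !ltr_nat !ltnS => k1 k2.
by apply/eqP; rewrite eqn_leq k1.
Qed.

Lemma cell_diam J x y : cell h J x -> cell h J y -> enorm (x - y) <= n%:R * h.
Proof.
move=> /cellP H /cellP H'; apply: enorm_le_bound; first exact: ltW.
by move=> i; rewrite !mxE; have := H i; have := H' i; rewrite ler_norml; lra.
Qed.

(** Two points of a cell are at distance at most [n h], so [1 <= (n h)^a / |x - y|^a] off the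
    diagonal. Disjoint cells contained in [Om] use disjoint parts of the energy integral, so the sum
    costs nothing. *)
Lemma sum_osc_le (u : 'rV[R]_n -> R) : measurable_fun setT u ->
  (\sum_(J : {ffun 'I_n -> 'I_M} | `[< cell h J `<=` Om >]) \int[mu2]_z (osc (cell h J) u z)%:E <=
   ((n%:R * h) `^ a)%:E * energy sigma Om u)%E.
Proof.
move=> mu'; have mo J := measurable_osc (measurable_cell J) mu'.
have mg := measurable_gq sigma mO mu'.
pose O J (z : 'rV[R]_n * 'rV[R]_n) : \bar R := (osc (cell h J) u z)%:E.
have mOJ J : measurable_fun setT (O J) by apply/measurable_EFinP.
have O0 J z : (0 <= O J z)%E by rewrite lee_fin osc_ge0.
pose A (z : 'rV[R]_n * 'rV[R]_n) : \bar R := (gq Om u z.1 z.2)%:E.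
have mA : measurable_fun setT A by apply/measurable_EFinP.
have A0 z : (0 <= A z)%E by rewrite lee_fin gq_ge0.
pose r := [seq J <- index_enum {ffun 'I_n -> 'I_M} | `[< cell h J `<=` Om >]].
rewrite -big_filter -/r.
have -> : (\sum_(J <- r) \int[mu2]_z (osc (cell h J) u z)%:E =
    \int[mu2]_z \sum_(J <- r) O J z)%E by rewrite (ge0_integral_sum mu2 measurableT mOJ (fun J z _ => O0 J z)).
rewrite energy_gq -(integralT_Z mu2 (powR_ge0 _ _) mA A0); apply: integralT_le.
- by apply: emeasurable_sum => J; exact: mOJ.
- exact: measurable_funeM.
- by move=> z; apply: sume_ge0 => J _; exact: O0.
move=> z; have rhs0 : (0 <= ((n%:R * h) `^ a)%:E * A z)%E by apply: mule_ge0; [rewrite lee_fin powR_ge0|exact: A0].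
have [[J0 J0z]|nJ] := pselect (exists J, cell h J z.2); last first.
  rewrite big1// => J _; rewrite /O /osc indicE memNset ?mul0r//.
  by move=> Jz; apply: nJ; exists J.
have Jz J : J != J0 -> O J z = 0%E.
  move=> JJ; rewrite /O /osc indicE memNset ?mul0r// => Jz.
  by move/eqP: JJ; apply; exact: cell_inj Jz J0z.
rewrite big_filter (big_mkcond (fun J => `[< _ >])) (bigD1 J0)//= big1 ?adde0; last first.
  by move=> J JJ; case: ifP => // _; exact: Jz.
case: ifP => // /asboolP J0O; rewrite /O /A -EFinM lee_fin /osc.
have hg : 0 <= (n%:R * h) `^ a * gq Om u z.1 z.2 by rewrite mulr_ge0 ?powR_ge0 ?gq_ge0.
have [z1|nz1] := pselect (cell h J0 z.1); last first.
  by rewrite [\1_(cell _ _) z.1]indicE memNset// mul0r expr0n mulr0.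
rewrite !indicE !mem_set// !mul1r gq_in; [|exact: J0O..].
have [->|zz] := eqVneq z.1 z.2; first by rewrite subrr expr0n mul0r mulr0.
have d1 : 0 < enorm (z.1 - z.2).
  by rewrite lt_neqAle enorm_ge0 andbT eq_sym enorm_eq0 subr_eq0.
rewrite mulrCA ler_peMr ?sqr_ge0// ler_pdivlMr ?powR_gt0// mul1r.
apply: ge0_ler_powR; rewrite ?nnegrE ?enorm_ge0//.
- by rewrite addr_ge0// mulr_ge0// ltW.
- by rewrite mulr_ge0// ltW.
- exact: cell_diam z1 J0z.
Qed.

End FixedScale.

Definition layer (r : R) : set 'rV[R]_n := [set x | Om x /\ exists2 y, ~ Om y & enorm (x - y) < r].

Lemma measurable_layer r : measurable (layer r).
Proof.
rewrite (_ : layer r = Om `&` \bigcup_(y in ~` Om) eball y r); last first.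
  by apply/seteqP; split=> x [Ox [y nO xy]]; split=> //; exists y.
apply: measurableI => //; apply: open_measurable_rv; apply: bigcup_open => y _.
exact: open_eball.
Qed.

(** The layers decrease to the empty set because [Om] is open, and [Om] has finite measure:
    continuity from above. *)
Lemma layer_measure (e : R) : 0 < e -> exists2 r, 0 < r & (mu (layer r) <= e%:E)%E.
Proof.
move=> e0; pose F k := layer (k.+1%:R^-1).
have mF k : measurable (F k) by exact: measurable_layer.
have F0 : \bigcap_k F k = set0.
  apply/seteqP; split=> // x Fx; have [Ox _] := Fx 0%N I.
  have [d d0 dO] := openP_eball oO Ox.
  have [k hk] : exists k : nat, k.+1%:R^-1 < d.
    have [k _ hk] := near_infty_natSinv_lt (PosNum d0); exists k; exact: hk (leqnn k).
  have [_ [y nO xy]] := Fx k I; apply: nO; apply: dO.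
  by rewrite /eball /= enormBC (lt_trans xy).
have Ffin : (mu (F 0%N) < +oo)%E.
  apply: (@le_lt_trans _ _ (mu Om)); last by apply: le_lt_trans muO _; exact: ltry.
  by apply: le_measure; rewrite ?inE// => x [].
have := @nonincreasing_cvg_mu _ _ _ mu F Ffin mF.
rewrite F0 measure0 => /(_ measurable0) h.
have /(near_lt_cvg0 e0)[N _ hN] : mu (F k) @[k --> \oo] --> 0%E.
  apply: h => k m km; apply/subsetPset => x [Ox [y nO xy]]; split=> //; exists y => //.
  by apply: lt_le_trans xy _; rewrite lef_pV2 ?posrE// ler_nat.
by exists (N.+1%:R^-1) => //; apply/ltW/hN => /=.
Qed.

(** If a cell is not contained in [Om], its points in [Om] belong to the layer, because its diameter
    is below [r]. *)
Lemma mass_split (h r : R) (M : nat) (w : 'rV[R]_n -> R) : 0 < h -> n%:R * h < r -> 2 * B / h < M%:R ->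
  measurable_fun setT w ->
  (mass Om w <= mass (layer r) w +
     \sum_(J : {ffun 'I_n -> 'I_M} | `[< cell h J `<=` Om >]) mass (cell h J) w)%E.
Proof.
move=> h0 hr hM mw.
have m Q : measurable Q -> measurable_fun setT (fun x => (rst Q w x ^+ 2)%:E).
  by move=> mQ; apply/measurable_EFinP; apply: measurable_funX; exact: measurable_rst.
have z Q x : (0 <= (rst Q w x ^+ 2)%:E)%E by rewrite lee_fin sqr_ge0.
pose O (J : {ffun 'I_n -> 'I_M}) x := ((rst (cell h J) w x ^+ 2)%:E : \bar R).
have mOJ J : measurable_fun setT (O J) by apply: m; exact: measurable_cell.
pose s := [seq J <- index_enum {ffun 'I_n -> 'I_M} | `[< cell h J `<=` Om >]].
rewrite -big_filter -/s.
have -> : (\sum_(J <- s) mass (cell h J) w = \int[mu]_x \sum_(J <- s) O J x)%E.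
  rewrite (ge0_integral_sum mu measurableT mOJ (fun J x _ => z _ x)).
  by apply: eq_bigr => J _; rewrite massE.
have mS : measurable_fun setT (fun x => \sum_(J <- s) O J x)%E.
  by apply: emeasurable_sum => J; exact: mOJ.
have S0 x : (0 <= \sum_(J <- s) O J x)%E by apply: sume_ge0 => J _; exact: z.
rewrite !massE -(integralT_D mu (m _ (measurable_layer r)) mS (z _) S0).
apply: integralT_le; [exact: m|exact: (emeasurable_funD (m _ (measurable_layer r)) mS)|exact: z|].
move=> x; have rhs0 := adde_ge0 (z (layer r) x) (S0 x).
have [Ox|nO] := pselect (Om x); last first.
  by rewrite /rst indicE memNset// mul0r expr0n.
have [J Jx] := cell_cover h0 hM Ox.
rewrite {1}/rst indicE mem_set// mul1r.
have [JO|nJO] := pselect (cell h J `<=` Om).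
  rewrite big_filter (bigD1 J) /=; last exact/asboolP.
  rewrite addeC -addeA; apply: (@le_trans _ _ (O J x)).
    by rewrite /O /rst indicE mem_set// mul1r.
  by rewrite leeDl// adde_ge0//; apply: sume_ge0 => K _; exact: z.
have [y Jy nOy] : exists2 y, cell h J y & ~ Om y.
  by apply: contrapT => H; apply: nJO => y Jy; apply: contrapT => nOy; apply: H; exists y.
have xl : layer r x.
  by split=> //; exists y => //; apply: le_lt_trans hr; exact: cell_diam Jx Jy.
by rewrite [rst (layer r) w x]/rst indicE mem_set// mul1r leeDl.
Qed.

End TotalBoundedness.

Section Compactness.
Context {R : realType} (n : nat) (sigma : R).
Hypothesis (n2 : (2 <= n)%N) (s0 : 0 < sigma) (s1 : sigma < 1).
Local Notation p := (pstar n sigma).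
Local Notation a := (n%:R + 2 * sigma).
Local Notation mu := (leb n).
Local Notation mu2 := ((leb n \x leb n)%E).
Context (Om : set 'rV[R]_n) (B c0 : R).
Hypotheses (oO : open Om) (OB : forall x, Om x -> enorm x <= B) (muO : (mu Om <= c0%:E)%E).
Let mO : measurable Om := open_measurable_rv oO.

Lemma layer_small (L e : R) : 0 <= L -> 0 < e -> exists2 r : R, 0 < r &
  forall w : 'rV[R]_n -> R, measurable_fun setT w -> (lpow sigma Om w <= L%:E)%E ->
    (mass (layer Om r) w <= e%:E)%E.
Proof.
move=> L0 e0; have p2 := pstar_gt2 n2 s0 s1.
have e1 : 0 < e / 2 / (L + 1) by rewrite !divr_gt0//; lra.
(* The exponent inverts [(2 - p) / 2]: the coefficient of the L^p term in [mass_le] becomes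
   [e / 2 / (L + 1)]. The layer is then taken thin enough to pay for [tau]. *)
pose tau := (e / 2 / (L + 1)) `^ (2 / (2 - p)).
have t0 : 0 < tau by exact: powR_gt0.
have tE : tau `^ ((2 - p) / 2) = e / 2 / (L + 1).
  have E1 : 2 / (2 - p) * ((2 - p) / 2) = 1 by field; rewrite lt_eqF// subr_lt0.
  by rewrite /tau -powRrM E1 powRr1// ltW.
have [r r0 hr] := layer_measure oO muO (divr_gt0 (divr_gt0 e0 (ltr0n R 2)) t0).
exists r => // w mw wL; have ml := measurable_layer oO r.
apply: le_trans (mass_le n2 s0 s1 mO ml mw _ t0) _; first by move=> x [].
rewrite tE; apply: (@le_trans _ _ (tau%:E * (e / 2 / tau)%:E + (e / 2 / (L + 1))%:E * L%:E)%E).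
  by apply: leeD; apply: lee_wpmul2l => //; rewrite lee_fin ltW.
rewrite -!EFinM -EFinD lee_fin mulrC divfK ?gt_eqF//.
have : e / 2 / (L + 1) * L <= e / 2.
  rewrite mulrAC ler_pdivrMr; last by lra.
  nra.
lra.
Qed.

(** On cells inside [Om] a function is replaced by a constant, with an error governed by the energy;
    on the layer the L^p bound is enough. The constants stay in a bounded set of finite dimension,
    so a subsequence has them all within [del] of one another. *)
Lemma total_bounded (E L e : R) (U : nat -> 'rV[R]_n -> R) :
  (forall k, measurable_fun setT (U k)) -> (forall k, (energy sigma Om (U k) <= E%:E)%E) ->
  (forall k, (lpow sigma Om (U k) <= L%:E)%E) -> 0 < e ->
  exists psi : nat -> nat, {homo psi : i j / (i < j)%N} /\
    forall i j, (mass Om (fun x => U (psi i) x - U (psi j) x)%R <= e%:E)%E.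
Proof.
move=> mU hE hL e0.
have E0 : 0 <= E by rewrite -lee_fin (le_trans _ (hE 0%N))// energy_ge0.
have L0 : 0 <= L by rewrite -lee_fin (le_trans _ (hL 0%N))// lpow_ge0.
have c00 : 0 <= c0 by rewrite -lee_fin (le_trans _ muO).
have [L' L'0 hL'] := lpowB_bound n2 s0 s1 L mO.
have e2 : 0 < e / 2 by rewrite divr_gt0.
have [r r0 hr] := layer_small L'0 e2.
have n0 : 0 < n%:R :> R by rewrite ltr0n; exact: ltn_trans n2.
have a0 : 0 < a by rewrite ltr_wpDl// mulr_gt0.
(* 24 is four times 6, the total weight that [massD3_le] gives to the errors of two functions; these
   errors then take at most [e / 4]. *)
pose D := 24 * n%:R `^ a * (E + 1).
have D0 : 0 < D by rewrite !mulr_gt0 ?powR_gt0//; lra.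
(* The first bound gives cells a diameter below [r], as [mass_split] requires; the second makes the
   error on inner cells small through [D * h^(2 sigma) <= e]. *)
pose h := Num.min (r / (2 * n%:R)) ((e / D) `^ ((2 * sigma)^-1)).
have h0 : 0 < h by rewrite lt_min powR_gt0 ?divr_gt0// mulr_gt0.
have hn : n%:R * h < r.
  have : h <= r / (2 * n%:R) by rewrite ge_min lexx.
  rewrite ler_pdivlMr ?mulr_gt0//; have := mulr_gt0 n0 h0; lra.
have hs : D * h `^ (2 * sigma) <= e.
  rewrite mulrC -ler_pdivlMr//.
  apply: (@le_trans _ _ (((e / D) `^ ((2 * sigma)^-1)) `^ (2 * sigma))).
    apply: ge0_ler_powR; rewrite ?nnegrE ?powR_ge0 ?(ltW h0)//.
      by rewrite mulr_ge0// ltW.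
    by rewrite ge_min lexx orbT.
  by rewrite -powRrM mulVf ?powRr1 ?gt_eqF ?mulr_gt0// ltW// divr_gt0.
have v0 : 0 < h ^+ n by exact: exprn_gt0.
(* Dividing the factor of [sum_osc_le] by the cell volume [h^n] leaves the positive power
   [h^(2 sigma)]: a small scale gives a small error. *)
have scal : (n%:R * h) `^ a = n%:R `^ a * h `^ (2 * sigma) * h ^+ n.
  rewrite powRM ?(ltW n0) ?(ltW h0)// -mulrA -(powR_mulrn n (ltW h0)) -powRD; last by rewrite (gt_eqF h0) implybT.
  by rewrite [2 * sigma + _]addrC.
pose M := (Num.truncn (2 * B / h)).+1.
have hM : 2 * B / h < M%:R.
  have [B0|B0] := leP 0 (2 * B / h); first by have /andP[] := truncn_itv B0.
  by apply: lt_le_trans B0 _.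
pose T : finType := {ffun 'I_n -> 'I_M}.
pose Q (J : T) := cell B h J; pose good J := `[< Q J `<=` Om >].
have mQ J : measurable (Q J) by exact: measurable_cell.
have Qv J : mu (Q J) = (h ^+ n)%:E by exact: cell_measure.
pose N : R := #|T|%:R; have N0 : 0 <= N by exact: ler0n.
have Ncst (x : R) : 0 <= x -> \sum_(J | good J) x <= x * N.
  move=> x0; rewrite big_mkcond /=; apply: (@le_trans _ _ (\sum_(J : T) x)).
    by apply: ler_sum => J _; case: ifP.
  by rewrite sumr_const /N mulr_natr.
pose X := (n%:R * h) `^ a; have X0 : 0 < X by rewrite powR_gt0 ?mulr_gt0.
(* The slack of [cell_const], which adds up to at most [X] over all cells. *)
pose eta := X / (N + 1); have eta0 : 0 < eta by rewrite divr_gt0//; lra.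
have etaN : eta * N <= X by rewrite /eta mulrAC ler_pdivrMr; [nra|lra].
pose Io k J := (\int[mu2]_z (osc (Q J) (U k) z)%:E)%E.
have Io0 k J : (0 <= Io k J)%E by apply: integralT_ge0 => z; rewrite lee_fin osc_ge0.
have Isum k : (\sum_(J | good J) Io k J <= (X * E)%:E)%E.
  apply: (le_trans (@sum_osc_le R n sigma s0 Om B oO h M h0 (U k) (mU k))); rewrite EFinM.
  by apply: lee_wpmul2l; rewrite ?lee_fin ?powR_ge0.
have Ile k J : good J -> (Io k J <= (X * E)%:E)%E.
  move=> gJ; apply: le_trans (Isum k); rewrite (bigD1 J)//= leeDl//.
  by apply: sume_ge0 => K _; exact: Io0.
pose G k J := fine (Io k J).
have GE k J : good J -> (G k J)%:E = Io k J.
  by move=> gJ; rewrite /G fineK// ge0_fin_numE// (le_lt_trans (Ile k J gJ)) ?ltry.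
have G0 k J : 0 <= G k J by exact: fine_ge0.
have Gsum k : \sum_(J | good J) G k J <= X * E.
  by rewrite -lee_fin -sumEFin (eq_bigr _ (GE k)).
have Gle k J : good J -> G k J <= X * E by move=> gJ; rewrite -lee_fin GE//; exact: Ile.
have ex (kJ : nat * T) : exists c : R, good kJ.2 ->
    (mass (Q kJ.2) (fun x => U kJ.1 x - c)%R <= ((G kJ.1 kJ.2 + eta) / h ^+ n)%:E)%E.
  case: kJ => k J /=; have [gJ|nJ] := boolP (good J); last by exists 0.
  have [c hc] := @cell_const R n (Q J) (U k) (h ^+ n) (G k J) eta (mQ J) (mU k) v0 (Qv J) eta0 ltac:(by rewrite GE).
  by exists c.
have [cc hcc] := choice ex.
(* Cells not contained in [Om] get the constant 0, so that one bound holds for the whole family. *)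
pose c k J := if good J then cc (k, J) else 0.
have hc k J : good J -> (mass (Q J) (fun x => U k x - c k J)%R <= ((G k J + eta) / h ^+ n)%:E)%E.
  by move=> gJ; rewrite /c gJ; exact: (hcc (k, J)).
have mass_cst J (d : R) : mass (Q J) (cst d) = (d ^+ 2 * h ^+ n)%:E.
  rewrite massE (_ : (fun x => _) = fun x => ((d ^+ 2)%:E * (\1_(Q J) x)%:E)%E).
    have mI : measurable_fun setT (fun x => (\1_(Q J) x : R)%:E).
      by apply/measurable_EFinP; exact: measurable_indic.
    have I0 x : (0 <= (\1_(Q J) x : R)%:E)%E by rewrite lee_fin.
    rewrite (integralT_Z mu (sqr_ge0 d) mI I0).
    have -> : (\int[mu]_x (\1_(Q J) x)%:E = (h ^+ n)%:E)%E by rewrite -(Qv J); exact: (integral_indicT mu (mQ J)).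
    by rewrite -EFinM.
  apply/funext => x; rewrite -EFinM /rst; case: (indic01 (Q J) x) => ->.
    by rewrite mul0r expr0n mulr0.
  by rewrite mul1r mulr1.
have mUc k d : measurable_fun setT (fun x => U k x - d) by exact: measurable_funB.
(* From [c = U - (U - c)], the mass [c^2 h^n] of the constant is at most three times that of [U]
   plus three times the error. Hence [c^2 <= W], and [|c| <= W + 1]. *)
pose W := (3 * (c0 + L) + 3 * ((X * E + eta) / h ^+ n)) / h ^+ n.
have cW k J : `|c k J| <= W + 1.
  have XE : 0 <= X * E by rewrite mulr_ge0// ltW.
  have W1 : 0 <= (X * E + eta) / h ^+ n by rewrite divr_ge0 ?(ltW v0)// addr_ge0// ltW.
  have W0 : 0 <= W by rewrite divr_ge0 ?(ltW v0)//; lra.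
  have [gJ|nJ] := boolP (good J); last by rewrite /c (negbTE nJ) normr0; lra.
  have QO : Q J `<=` Om by exact/asboolP.
  have m1 : (mass (Q J) (U k) <= (c0 + L)%:E)%E.
    apply: le_trans (mass_mono (mQ J) mO QO (mU k)) _.
    apply: le_trans (mass_le n2 s0 s1 mO mO (mU k) (@subset_refl _ _) ltr01) _.
    by rewrite mul1e powR1 mul1e EFinD; apply: leeD.
  have m2 : (mass (Q J) (fun x => - 1 * (U k x - c k J))%R <= ((X * E + eta) / h ^+ n)%:E)%E.
    have -> : mass (Q J) (fun x => - 1 * (U k x - c k J))%R = mass (Q J) (fun x => U k x - c k J)%R.
      by rewrite !massE; apply: eq_integral => x _; rewrite rstZ mulN1r sqrrN.
    apply: le_trans (hc k J gJ) _; rewrite lee_fin ler_pM2r ?invr_gt0// lerD2r; exact: Gle.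
  have mN : measurable_fun setT (fun x => - 1 * (U k x - c k J)) by exact: measurable_funM.
  have := massD3_le (mQ J) (mU k) mN (measurable_cst (0 : R)).
  rewrite (_ : (fun x => _) = cst (c k J)); last by apply/funext => x /=; ring.
  rewrite !mass_cst expr0n mul0r mule0 adde0 => h3.
  have : c k J ^+ 2 * h ^+ n <= 3 * (c0 + L) + 3 * ((X * E + eta) / h ^+ n).
    rewrite -lee_fin; apply: le_trans h3 _.
    apply: (@le_trans _ _ (3%:E * (c0 + L)%:E + 3%:E * ((X * E + eta) / h ^+ n)%:E)%E).
      by apply: leeD; apply: lee_wpmul2l.
    by rewrite -!EFinM -EFinD.
  rewrite -ler_pdivlMr// -/W => cW.
  rewrite -ler_sqr ?nnegrE ?normr_ge0 ?addr_ge0// real_normK ?num_real//.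
  by apply: le_trans cW _; nra.
(* The differences of constants, summed over at most [N] cells, take the remaining [e / 4]. *)
pose del := Num.min 1 (e / (12 * h ^+ n * (N + 1))).
have N1 : 0 < N + 1 by lra.
have del0 : 0 < del by rewrite lt_min ltr01 divr_gt0// !mulr_gt0.
have delN : 3 * (del ^+ 2 * h ^+ n) * N <= e / 4.
  have d1 : del <= 1 by rewrite ge_min lexx.
  have : del <= e / (12 * h ^+ n * (N + 1)) by rewrite ge_min lexx orbT.
  rewrite ler_pdivlMr ?mulr_gt0// => d2.
  apply: (@le_trans _ _ (3 * (del * h ^+ n) * (N + 1))); last by lra.
  apply: ler_pM; rewrite ?mulr_ge0 ?sqr_ge0 ?(ltW v0) ?(ltW del0)//; last by lra.
  by rewrite ler_pM2l// ler_pM2r// expr2 ler_piMl// ltW.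
have [psi [hpsi psiP]] := bounded_subsequence del0 cW.
exists psi; split=> // i j; set k := psi i; set l := psi j.
have mB : measurable_fun setT (fun x => U k x - U l x) by exact: measurable_funB.
apply: le_trans (mass_split oO OB h0 hn hM mB) _.
rewrite (_ : e = e / 2 + e / 2); last by lra.
rewrite EFinD; apply: leeD; first by apply: hr => //; exact: hL'.
pose m k J := (G k J + eta) / h ^+ n.
have msum q : \sum_(J | good J) m q J <= n%:R `^ a * h `^ (2 * sigma) * (E + 1).
  rewrite -mulr_suml ler_pdivrMr// big_split /=.
  rewrite [leRHS](_ : _ = X * E + X); last first.
    by rewrite /X scal; move: (_ `^ a) (h `^ _) (h ^+ n) => x y z; ring.
  apply: lerD; first exact: Gsum.
  by apply: le_trans etaN; exact: Ncst (ltW eta0).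
apply: (@le_trans _ _ (\sum_(J | good J) (3 * m k J + 3 * m l J + 3 * (del ^+ 2 * h ^+ n))%:E)%E).
  apply: lee_sum => J gJ.
  have mN : measurable_fun setT (fun x => - 1 * (U l x - c l J)) by exact: measurable_funM.
  have := massD3_le (mQ J) (mUc k (c k J)) mN (measurable_cst (c k J - c l J)).
  rewrite (_ : (fun x => _ + _ + _) = fun x => U k x - U l x); last by apply/funext => x /=; ring.
  move=> /le_trans; apply.
  apply: (@le_trans _ _ (3%:E * (m k J)%:E + 3%:E * (m l J)%:E + 3%:E * (del ^+ 2 * h ^+ n)%:E)%E);
    last by rewrite -!EFinM -!EFinD.
  apply: leeD; last first.
    apply: lee_wpmul2l => //; rewrite mass_cst lee_fin ler_pM2r//.
    rewrite -[(_ - _) ^+ 2]real_normK ?num_real// ler_sqr ?nnegrE ?(ltW del0)//; exact: psiP.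
  apply: leeD; apply: lee_wpmul2l => //; first exact: hc.
  have -> : mass (Q J) (fun x => - 1 * (U l x - c l J))%R = mass (Q J) (fun x => U l x - c l J)%R.
    by rewrite !massE; apply: eq_integral => x _; rewrite rstZ mulN1r sqrrN.
  exact: hc.
rewrite sumEFin lee_fin !big_split /= -3!mulr_sumr.
have := msum k; have := msum l.
have : 3 * \sum_(J | good J) (del ^+ 2 * h ^+ n) <= e / 4.
  apply: le_trans delN; rewrite -[leRHS]mulrA ler_pM2l//.
  by apply: Ncst; rewrite mulr_ge0 ?sqr_ge0// ltW.
have : 24 * (n%:R `^ a * h `^ (2 * sigma) * (E + 1)) <= e.
  by apply: le_trans hs; rewrite /D le_eqVlt; apply/orP; left; apply/eqP; ring.
by lra.
Qed.

End Compactness.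

(** * Almost everywhere convergent subsequences *)

Section AlmostEverywhere.
Context {R : realType} (n : nat) (sigma : R).
Hypothesis (n2 : (2 <= n)%N) (s0 : 0 < sigma) (s1 : sigma < 1).
Local Notation mu := (leb n).
Context (Om : set 'rV[R]_n) (B c0 : R).
Hypotheses (oO : open Om) (OB : forall x, Om x -> enorm x <= B) (muO : (mu Om <= c0%:E)%E).
Let mO : measurable Om := open_measurable_rv oO.

Lemma sum_half_le (N : nat) : \sum_(0 <= k < N) (2^-1 : R) ^+ k <= 2.
Proof.
have E : \sum_(0 <= k < N) (2^-1 : R) ^+ k = 2 - 2 * 2^-1 ^+ N.
  elim: N => [|N IH]; first by rewrite big_geq// expr0; lra.
  by rewrite big_nat_recr//= IH exprS; lra.
by rewrite E gerBl mulr_ge0 ?exprn_ge0.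
Qed.

(** With [d] the size of the k-th step, [d <= 2^-k + 2^k d^2] by the arithmetic-geometric
    inequality, so the steps are absolutely summable. *)
Lemma cvg_of_steps (u : nat -> R) (G : R) :
  (forall N, \sum_(0 <= k < N) (2 ^+ k * (u k.+1 - u k) ^+ 2) <= G) -> cvgn u.
Proof.
move=> hG.
have h : cvgn [normed series (telescope u)].
  apply: nondecreasing_is_cvgn.
    apply/nondecreasing_seqP => N.
    rewrite -[X in X <= _]/(\sum_(0 <= k < N) `|telescope u k|).
    by rewrite -[X in _ <= X]/(\sum_(0 <= k < N.+1) `|telescope u k|) big_nat_recr//= lerDl.
  exists (2 + G) => _ [N _ <-]; rewrite /series /=.
  apply: (@le_trans _ _ (\sum_(0 <= k < N) (2^-1 ^+ k + 2 ^+ k * (u k.+1 - u k) ^+ 2))); last first.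
    by rewrite big_split /=; apply: lerD; [exact: sum_half_le|exact: hG].
  apply: ler_sum => k _; rewrite /telescope.
  have t0 : 0 < 2 ^+ k :> R by rewrite exprn_gt0.
  rewrite exprVn -[(u k.+1 - u k) ^+ 2]real_normK ?num_real//.
  set d := `|_|; have d0 : 0 <= d by exact: normr_ge0.
  have -> : (2 ^+ k)^-1 + 2 ^+ k * d ^+ 2 = (1 + (2 ^+ k * d) ^+ 2) / 2 ^+ k.
    by field; rewrite gt_eqF.
  rewrite ler_pdivlMr//; have := sqr_ge0 (2 ^+ k * d - 1); have := mulr_ge0 (ltW t0) d0.
  nra.
have := normed_cvg h; rewrite telescopeK => h1.
rewrite (_ : u = (fun k => (u k - u 0%N) + u 0%N)); last by apply/funext => k; rewrite subrK.
by apply: is_cvgD => //; exact: is_cvg_cst.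
Qed.

Lemma pint_fatou d (T : measurableType d) (nu : {measure set T -> \bar R}) (q : R)
    (g : nat -> T -> R) (w : T -> R) (M : R) : 0 < q ->
  (forall k, measurable_fun setT (g k)) -> measurable_fun setT w ->
  (forall k, (pint nu q (g k) <= M%:E)%E) -> {ae nu, forall x, g k x @[k --> \oo] --> w x} ->
  (pint nu q w <= M%:E)%E.
Proof.
move=> q0 mg mw gM gw; pose f k x : \bar R := (`|g k x| `^ q)%:E.
have mf k : measurable_fun setT (f k) by apply/measurable_EFinP; exact: measurable_pw.
have f0 k x : (0 <= f k x)%E by rewrite lee_fin powR_ge0.
have mW : measurable_fun setT (fun x => (`|w x| `^ q)%:E).
  by apply/measurable_EFinP; exact: measurable_pw.
have W0 x : (0 <= (`|w x| `^ q)%:E)%E by rewrite lee_fin powR_ge0.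
have einf_le (u : nat -> \bar R) : (forall k, (u k <= M%:E)%E) -> (limn_einf u <= M%:E)%E.
  move=> uM; rewrite limn_einf_lim; apply: lime_le; first exact: is_cvg_einfs.
  apply: nearW => k; apply: le_trans (uM k); apply: ereal_inf_lbound.
  by exists k => /=.
have einf0 (u : nat -> \bar R) : (forall k, (0 <= u k)%E) -> (0 <= limn_einf u)%E.
  move=> u0; rewrite limn_einf_lim; apply: lime_ge; first exact: is_cvg_einfs.
  by apply: nearW => k; apply: le_ereal_inf_tmp => _ [i _ <-].
have mE : measurable_fun setT (fun x => limn_einf (f^~ x)).
  rewrite (_ : (fun x => _) = fun x => (- limn_esup (fun k => - f k x))%E).
    apply: measurableT_comp => //; apply: measurable_fun_limn_esup => k.
    exact: measurableT_comp.
  apply/funext => x; rewrite -limn_einfN; congr limn_einf.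
  by apply/funext => k; rewrite -[LHS]oppeK.
have -> : pint nu q w = (\int[nu]_x limn_einf (f^~ x))%E.
  apply: (ge0_ae_eq_integral measurableT mW mE (fun x _ => W0 x)
    (fun x _ => einf0 _ (fun k => f0 k x))).
  apply: filterS gw => x gx _.
  have h : f k x @[k --> \oo] --> (`|w x| `^ q)%:E.
    by apply: cvg_EFin; [exact: nearW|exact: powR_cvg q0 gx].
  by rewrite (cvg_limn_einf_sup h).1.
apply: le_trans (fatou nu measurableT mf (fun k x _ => f0 k x)) _.
exact: einf_le.
Qed.

Lemma ae_subsequence (E L : R) (U : nat -> 'rV[R]_n -> R) :
  (forall k, measurable_fun setT (U k)) -> (forall k, (energy sigma Om (U k) <= E%:E)%E) ->
  (forall k, (lpow sigma Om (U k) <= L%:E)%E) ->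
  exists theta : nat -> nat, {homo theta : i j / (i < j)%N} /\
  exists v : 'rV[R]_n -> R, [/\ measurable_fun setT v, forall x, ~ Om x -> v x = 0,
    {ae mu, forall x, rst Om (U (theta k)) x @[k --> \oo] --> v x} &
    forall k, (mass Om (fun x => U (theta k) x - v x)%R <= (4^-1 ^+ k)%:E)%E].
Proof.
move=> mU hE hL.
have [theta [htheta hD]] : exists theta : nat -> nat, {homo theta : i j / (i < j)%N} /\
    forall k i j, (k <= i)%N -> (k <= j)%N ->
    (mass Om (fun x => U (theta i) x - U (theta j) x)%R <= (4^-1 ^+ k)%:E)%E.
  apply: (diagonal_subsequence
    (D := fun k i j => (mass Om (fun x => U i x - U j x)%R <= (4^-1 ^+ k)%:E)%E)).
  move=> m phi hphi; have e0 : 0 < (4^-1 : R) ^+ m by rewrite exprn_gt0.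
  have [psi [h1 h2]] := total_bounded n2 s0 s1 oO OB muO (fun k => mU (phi k))
    (fun k => hE (phi k)) (fun k => hL (phi k)) e0.
  by exists psi; split.
exists theta; split=> //.
pose u k := rst Om (U (theta k)).
have mu' k : measurable_fun setT (u k) by exact: measurable_rst.
(* The weight [2^k] against the rate [4^-k] leaves a summable series of integrals, so the sum of the
   [d k] is finite almost everywhere and [cvg_of_steps] applies there. *)
pose d k x : \bar R := (2 ^+ k * (u k.+1 x - u k x) ^+ 2)%:E.
have md k : measurable_fun setT (d k).
  apply/measurable_EFinP; apply: measurable_funM => //.
  by apply: measurable_funX; exact: measurable_funB.
have d0 k x : (0 <= d k x)%E by rewrite lee_fin mulr_ge0 ?sqr_ge0// exprn_ge0.
pose g x := (\sum_(0 <= k <oo) d k x)%E.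
have mg : measurable_fun setT g by apply: ge0_emeasurable_sum.
have g0 x : (0 <= g x)%E by exact: nneseries_ge0.
have Ig : (\int[mu]_x g x <= 2%:E)%E.
  rewrite (integral_nneseries mu measurableT md (fun k x _ => d0 k x)).
  have h12 : 0 < (2^-1 : R) < 1 by apply/andP; split; lra.
  apply: (@le_trans _ _ (\sum_(0 <= k <oo) (1 * 2^-1 ^+ k)%:E)%E).
    apply: lee_nneseries => [k _ _|k _]; first exact: integralT_ge0.
    have t0 : 0 <= 2 ^+ k :> R by rewrite exprn_ge0.
    have mB : measurable_fun setT (fun x => ((u k.+1 x - u k x) ^+ 2)%:E).
      by apply/measurable_EFinP; apply: measurable_funX; exact: measurable_funB.
    have B0 x : (0 <= ((u k.+1 x - u k x) ^+ 2)%:E)%E by rewrite lee_fin sqr_ge0.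
    have -> : (\int[mu]_x d k x = (2 ^+ k)%:E * \int[mu]_x ((u k.+1 x - u k x) ^+ 2)%:E)%E.
      by rewrite -(integralT_Z mu t0 mB B0); apply: eq_integral => x _; rewrite /d EFinM.
    have -> : (\int[mu]_x ((u k.+1 x - u k x) ^+ 2)%:E =
        mass Om (fun x => U (theta k.+1) x - U (theta k) x)%R)%E.
      by rewrite massE rstB.
    apply: (@le_trans _ _ ((2 ^+ k)%:E * (4^-1 ^+ k)%:E)%E).
      by apply: lee_wpmul2l; [rewrite lee_fin|exact: hD].
    by rewrite -EFinM lee_fin mul1r -exprMn (_ : 2 * 4^-1 = 2^-1)//; lra.
  apply: le_trans (nneseries_geometric_le ler01 h12) _; rewrite lee_fin.
  by rewrite ler_pdivrMr; lra.
have intg : mu.-integrable setT g.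
  apply/integrableP; split=> //; apply: (@le_lt_trans _ _ 2%:E); last exact: ltry.
  by under eq_integral do rewrite gee0_abs//.
have aeg := integrable_ae measurableT intg.
pose A : set 'rV[R]_n := [set x | g x \is a fin_num].
have mA : measurable A.
  by rewrite -[A]setTI; exact: emeasurable_fin_num.
have cA x : A x -> cvgn (fun k => u k x).
  move=> Ax; apply: (@cvg_of_steps _ (fine (g x))) => N.
  rewrite -lee_fin fineK// -sumEFin.
  exact: (@nneseries_lim_ge _ (fun k => d k x) predT 0%N N (fun k _ _ => d0 k x)).
(* Multiplying by the indicator of [A] forces convergence at every point, so that the limit is a
   measurable function defined everywhere. *)
pose V k x := \1_A x * u k x.
have cV x : cvgn (fun k => V k x).
  have [Ax|nA] := pselect (A x).
    by rewrite (_ : (fun _ => _) = fun k => u k x); [exact: cA|apply/funext => k; rewrite /V indicE mem_set// mul1r].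
  rewrite (_ : (fun _ => _) = fun k => 0); first exact: is_cvg_cst.
  by apply/funext => k; rewrite /V indicE memNset// mul0r.
pose v x := limn (fun k => V k x).
have mv : measurable_fun setT v.
  apply: (@measurable_fun_cvg _ _ _ _ V) => [k|x _].
    by apply: measurable_funM => //; exact: measurable_indic.
  exact: cV.
have v0 x : ~ Om x -> v x = 0.
  move=> nO; rewrite /v (_ : (fun _ => _) = fun=> 0) ?lim_cst//.
  by apply/funext => k; rewrite /V /u /rst indicE [\1_Om x]indicE (memNset nO) mul0r mulr0.
have aev : {ae mu, forall x, u k x @[k --> \oo] --> v x}.
  apply: filterS aeg => x /(_ I) Ax; rewrite /v.
  have -> : (fun k => V k x) = fun k => u k x.
    by apply/funext => k; rewrite /V indicE mem_set// mul1r.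
  exact: cA.
exists v; split=> // k; rewrite mass.unlock rstB (rst_id v0).
apply: (@pint_fatou _ _ mu 2 (fun j x => u k x - u (j + k)%N x)).
- by [].
- by move=> j; exact: (measurable_funB (mu' k) (mu' (j + k)%N)).
- exact: (measurable_funB (mu' k) mv).
- by move=> j; have := hD k k (j + k)%N (leqnn k) (leq_addl _ _); rewrite mass.unlock rstB.
- apply: filterS aev => x ux; apply: cvgB; first exact: cvg_cst.
  by have := ux; rewrite -(cvg_shiftn k).
Qed.

End AlmostEverywhere.

(** * Weak limits of minimizing sequences *)

Section WeakLimits.
Context {R : realType} (n : nat) (sigma : R).
Hypothesis (n2 : (2 <= n)%N) (s0 : 0 < sigma) (s1 : sigma < 1).
Local Notation p := (pstar n sigma).
Local Notation mu := (leb n).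
Local Notation mu2 := ((leb n \x leb n)%E).
Context (Om : set 'rV[R]_n) (S c0 : R).
Hypotheses (mO : measurable Om) (muO : (mu Om <= c0%:E)%E)
  (S0 : 0 < S) (SO : (S%:E <= Sconst sigma Om)%E).

Lemma ae_product (P : 'rV[R]_n -> Prop) : {ae mu, forall x, P x} ->
  {ae mu2, forall z, P z.1 /\ P z.2}.
Proof.
move=> [N [mN N0 hN]]; have mNT : measurable (N `*` [set: 'rV[R]_n]) by exact: measurableX.
have mTN : measurable ([set: 'rV[R]_n] `*` N) by exact: measurableX.
have n1 : mu2.-negligible (N `*` [set: 'rV[R]_n]).
  exists (N `*` setT); split=> //; transitivity (0 * mu [set: 'rV[R]_n])%E; last by rewrite mul0e.
  by rewrite -N0; exact: product_measure1E.
have n3 : mu2.-negligible ([set: 'rV[R]_n] `*` N).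
  exists (setT `*` N); split=> //; transitivity (mu [set: 'rV[R]_n] * 0)%E; last by rewrite mule0.
  by rewrite -N0; exact: product_measure1E.
apply: negligibleS (negligibleU n1 n3).
move=> z nPz; apply: contrapT => /not_orP[h1 h2]; apply: nPz; split; apply: contrapT => h.
  by apply: h1; split=> //; exact: hN.
by apply: h2; split=> //; exact: hN.
Qed.

(** The quotient is supported on pairs of points of [Om], so almost everywhere convergence of the
    restrictions, which is all that is available, passes to it. *)
Lemma gag_rst u z : gag sigma Om u z = gag sigma Om (rst Om u) z.
Proof.
rewrite /gag /rst; case: (indic01 Om z.1) => ->; case: (indic01 Om z.2) => ->;
  by rewrite ?mul0r ?mulr0 ?mul0r ?mul1r.
Qed.

Lemma ae_gag (u : nat -> 'rV[R]_n -> R) v : 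
  {ae mu, forall x, rst Om (u k) x @[k --> \oo] --> rst Om v x} ->
  {ae mu2, forall z, gag sigma Om (u k) z @[k --> \oo] --> gag sigma Om v z}.
Proof.
move=> /ae_product; apply: filterS => z [h1 h2].
rewrite gag_rst; apply: eq_cvg_ext (fun k => esym (gag_rst (u k) z)) _.
rewrite /gag; apply: cvgMr; apply: cvgMl; exact: cvgB.
Qed.

Context (G : nat -> 'rV[R]_n -> R) (M : R).
Hypotheses (mG : forall k, measurable_fun setT (G k))
  (EG : forall k, (energy sigma Om (G k) <= M%:E)%E)
  (LG : forall k, (lpow sigma Om (G k) <= M%:E)%E)
  (G0 : {ae mu, forall x, rst Om (G k) x @[k --> \oo] --> 0}).

Lemma brezis_lieb_lpow w : measurable_fun setT w -> (lpow sigma Om w < +oo)%E ->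
  fine (lpow sigma Om (fun x => w x + G k x)) - fine (lpow sigma Om (G k)) @[k --> \oo] -->
  fine (lpow sigma Om w).
Proof.
have LG' := LG; move: LG'; rewrite lpow.unlock => LG' mw fw.
have h := @brezis_lieb _ _ _ mu p (rst Om w) (fun k => rst Om (G k)) M
  (pstar_gt0 n2 s0 s1) (measurable_rst mO mw) (fun k => measurable_rst mO (mG k)) fw LG' G0.
by apply: eq_cvg_ext h => k; rewrite rstD.
Qed.

Lemma brezis_lieb_energy w : measurable_fun setT w -> (energy sigma Om w < +oo)%E ->
  fine (energy sigma Om (fun x => w x + G k x)) - fine (energy sigma Om (G k)) @[k --> \oo] -->
  fine (energy sigma Om w).
Proof.
have EG' := EG; move: EG'; rewrite energy.unlock => EG' mw fw.
have g0 : {ae mu2, forall z, gag sigma Om (G k) z @[k --> \oo] --> 0}.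
  have r0 : {ae mu, forall x, rst Om (G k) x @[k --> \oo] --> rst Om (fun=> 0) x}.
    by apply: filterS G0 => x; rewrite [rst Om (fun=> 0) x]/rst mulr0.
  have := ae_gag r0.
  by apply: filterS => z; rewrite {2}/gag subrr mul0r mulr0.
have h := @brezis_lieb _ _ _ mu2 2 (gag sigma Om w) (fun k => gag sigma Om (G k)) M
  (ltr0Sn R 1) (measurable_gag sigma mO mw) (fun k => measurable_gag sigma mO (mG k)) fw EG' g0.
by apply: eq_cvg_ext h => k; rewrite gagD.
Qed.

Lemma M_ge0 : 0 <= M.
Proof. by rewrite -lee_fin; apply: le_trans (EG 0%N); exact: energy_ge0. Qed.

(* Banach-Saks: since [|f + G k|^2 ~ |f|^2 + |G k|^2] for large [k], suitable sums of [N]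
   terms have energy [O(N)], so that their averages tend to 0 strongly. *)
Lemma banach_saks_sum v : (forall k, H0 sigma Om (fun x => G k x + v x)) ->
  forall N : nat, exists f, [/\ measurable_fun setT f,
    (energy sigma Om f <= (N.+1%:R * (M + 1))%:E)%E, (lpow sigma Om f <= (N.+1%:R * (M + 1))%:E)%E &
    H0 sigma Om (fun x => f x + N.+1%:R * v x)].
Proof.
move=> GH; elim=> [|N [f [mf Ef Lf fH]]].
  exists (G 0%N); split=> //.
  - by apply: le_trans (EG 0%N) _; rewrite lee_fin; lra.
  - by apply: le_trans (LG 0%N) _; rewrite lee_fin; lra.
  - by rewrite (_ : (fun x => _) = fun x => G 0%N x + v x)//; apply/funext => x; rewrite mul1r.
have Eff : (energy sigma Om f < +oo)%E by apply: le_lt_trans Ef _; exact: ltry.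
have Lff : (lpow sigma Om f < +oo)%E by apply: le_lt_trans Lf _; exact: ltry.
have GEf k : (energy sigma Om (G k) < +oo)%E by apply: le_lt_trans (EG k) _; exact: ltry.
have GLf k : (lpow sigma Om (G k) < +oo)%E by apply: le_lt_trans (LG k) _; exact: ltry.
have hE := brezis_lieb_energy mf Eff; have hL := brezis_lieb_lpow mf Lff.
have /cvgrPdist_le/(_ 1 ltr01) hE1 := hE; have /cvgrPdist_le/(_ 1 ltr01) hL1 := hL.
have [k [k1 k2]] : exists k,
    `|fine (energy sigma Om f) - (fine (energy sigma Om (fun x => f x + G k x)) - fine (energy sigma Om (G k)))| <= 1 /\
    `|fine (lpow sigma Om f) - (fine (lpow sigma Om (fun x => f x + G k x)) - fine (lpow sigma Om (G k)))| <= 1.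
  have [K _ hK] := filterI hE1 hL1; exists K; exact: (hK K (leqnn K)).
have mfG : measurable_fun setT (fun x => f x + G k x) by exact: measurable_funD.
exists (fun x => f x + G k x); split=> //.
- have fin := energyD_fin mO mf (mG k) Eff (GEf k).
  rewrite -(energy_fineK fin) lee_fin.
  have := EG k; have := Ef; rewrite -(energy_fineK Eff) -(energy_fineK (GEf k)) !lee_fin.
  by move: k1; rewrite ler_norml -natr1 mulrDl mul1r => /andP[]; lra.
- have fin := lpowD_fin n2 s0 s1 mO mf (mG k) Lff (GLf k).
  rewrite -(lpow_fineK fin) lee_fin.
  have := LG k; have := Lf; rewrite -(lpow_fineK Lff) -(lpow_fineK (GLf k)) !lee_fin.
  by move: k2; rewrite ler_norml -natr1 mulrDl mul1r => /andP[]; lra.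
have := H0D n2 s0 s1 mO fH (GH k).
rewrite (_ : (fun x => _ + _) = fun x => f x + G k x + N.+2%:R * v x)//.
by apply/funext => x; rewrite -[N.+2%:R]natr1; ring.
Qed.

(** The average [a N] is in [H0], being a multiple of the element [f + (N+1) v] of
    [banach_saks_sum]. Moreover [a N - v = f / (N+1)], and since the energy scales with power 2 and
    the L^p integral with [p >= 2], bounds of order [N+1] on [f] become [(M + 1) / (N+1)]. *)
Lemma weak_limit_H0 v : measurable_fun setT v -> (forall k, H0 sigma Om (fun x => G k x + v x)) ->
  H0 sigma Om v.
Proof.
move=> mv GH; have [f hf] := choice (banach_saks_sum GH).
have mf N : measurable_fun setT (f N) by case: (hf N).
have p2 := pstar_gt2 n2 s0 s1; have M0 := M_ge0.
pose a N x := N.+1%:R^-1 * (f N x + N.+1%:R * v x).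
have aE N x : a N x - v x = N.+1%:R^-1 * f N x.
  by rewrite /a mulrDr mulKf ?addrK// pnatr_eq0.
have inv0 : ((M + 1) * N.+1%:R^-1)%:E @[N --> \oo] --> (0%E : \bar R).
  apply: cvg_EFin; first exact: nearW.
  by rewrite -[X in _ --> X](mulr0 (M + 1)); apply: cvgMr; exact: cvg_harmonic.
have i0 N : 0 < N.+1%:R^-1 :> R by rewrite invr_gt0.
have i1 N : N.+1%:R^-1 <= 1 :> R by rewrite invf_le1// ler1n.
have key N (t : R) : 0 <= t -> t <= N.+1%:R^-1 ^+ 2 -> t * (N.+1%:R * (M + 1)) <= (M + 1) * N.+1%:R^-1.
  move=> t0 tN; rewrite mulrCA mulrA [leRHS]mulrC.
  apply: (@le_trans _ _ (N.+1%:R * N.+1%:R^-1 ^+ 2 * (M + 1))).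
    rewrite ler_wpM2r ?ler_wpM2l ?ler0n//; lra.
  by rewrite expr2 mulVKf ?pnatr_eq0.
apply: (H0_closed n2 s0 s1 mO (U := a)) => //.
- by move=> N; apply: H0Z => //; case: (hf N).
- apply: squeeze0 inv0 => N; first exact: energy_ge0.
  rewrite (_ : (fun x => _) = fun x => N.+1%:R^-1 * f N x); last exact/funext/aE.
  rewrite energyZ//; case: (hf N) => _ Ef _ _.
  apply: (@le_trans _ _ ((N.+1%:R^-1 ^+ 2)%:E * (N.+1%:R * (M + 1))%:E)%E).
    by apply: lee_wpmul2l => //; rewrite lee_fin sqr_ge0.
  by rewrite -EFinM lee_fin key ?sqr_ge0.
- apply: squeeze0 inv0 => N; first exact: lpow_ge0.
  rewrite (_ : (fun x => _) = fun x => N.+1%:R^-1 * f N x); last exact/funext/aE.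
  rewrite lpowZ//; case: (hf N) => _ _ Lf _.
  apply: (@le_trans _ _ ((`|N.+1%:R^-1| `^ p)%:E * (N.+1%:R * (M + 1))%:E)%E).
    by apply: lee_wpmul2l => //; rewrite lee_fin powR_ge0.
  rewrite -EFinM lee_fin key ?powR_ge0// ger0_norm ?(ltW (i0 N))//.
  by rewrite -powR_mulrn ?(ltW (i0 N))//; apply: ger_powR; [rewrite i0 i1|exact: ltW].
Qed.

End WeakLimits.

Lemma cvg_subseq (T : topologicalType) (u : nat -> T) (l : T) (theta : nat -> nat) :
  {homo theta : i j / (i < j)%N} -> u k @[k --> \oo] --> l -> u (theta k) @[k --> \oo] --> l.
Proof.
move=> h ul A /ul[N _ hN]; exists N => // k /= Nk; apply: hN => /=.
exact: leq_trans Nk (homo_ge_id h k).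
Qed.

(** * Compactness of minimizing sequences *)

Section MinimizingSequences.
Context {R : realType} (n : nat) (sigma : R).
Hypothesis (n2 : (2 <= n)%N) (s0 : 0 < sigma) (s1 : sigma < 1).
Local Notation p := (pstar n sigma).
Local Notation mu := (leb n).
Context (Om : set 'rV[R]_n) (B S : R).
Hypotheses (oO : open Om) (OB : forall x, Om x -> enorm x <= B) (bO : C1_boundary Om)
  (S0 : 0 < S) (SO : Sconst sigma Om = S%:E)
  (Shalf : (S%:E < Sconst sigma (@halfspace R n))%E).
Let mO : measurable Om := open_measurable_rv oO.
Let SOle : (S%:E <= Sconst sigma Om)%E. Proof. by rewrite SO. Qed.
Let p0 : 0 < p := pstar_gt0 n2 s0 s1.

(** The ratios [x / (x + y)] and [y / (x + y)] lie in [[0, 1]], where an exponent at most 1 does not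
    decrease them; the two resulting bounds add up. It is used with [e = 2 / p]. *)
Lemma powR_subadd (e x y : R) : 0 <= e <= 1 -> 0 <= x -> 0 <= y ->
  (x + y) `^ e <= x `^ e + y `^ e.
Proof.
move=> /andP[e0 e1] x0 y0; have [xy0|xy] := leP (x + y) 0.
  have -> : x = 0 by lra.
  have -> : y = 0 by lra.
  by rewrite addr0 lerDl powR_ge0.
have key t : 0 <= t -> t <= x + y -> (x + y) `^ e * (t / (x + y)) <= t `^ e.
  move=> t0 txy; have [->|tn] := eqVneq t 0; first by rewrite mul0r mulr0 powR_ge0.
  have tp : 0 < t by rewrite lt_neqAle eq_sym tn.
  have q1 : t / (x + y) <= 1 by rewrite ler_pdivrMr// mul1r.
  have q0 : 0 < t / (x + y) by rewrite divr_gt0.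
  apply: (@le_trans _ _ ((x + y) `^ e * (t / (x + y)) `^ e)); last first.
    by rewrite -powRM ?(ltW xy) ?(ltW q0)// mulrC divfK ?gt_eqF.
  rewrite ler_wpM2l ?powR_ge0// -{1}[t / (x + y)]powRr1 ?(ltW q0)//.
  by apply: ger_powR; rewrite ?q0.
have := key x x0 ltac:(lra); have := key y y0 ltac:(lra).
have : (x + y) `^ e * (x / (x + y)) + (x + y) `^ e * (y / (x + y)) = (x + y) `^ e.
  by rewrite -mulrDr -mulrDl divff ?gt_eqF// mulr1.
lra.
Qed.

Lemma lpow_Rquot u : H0 sigma Om u -> energy sigma Om u = 1%E ->
  fine (lpow sigma Om u) `^ (2 / p) = (Rquot sigma Om u)^-1.
Proof.
move=> uH E1; have mu' := H0_measurable n2 s0 s1 mO uH.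
by rewrite /Rquot IgagE// LintE// E1 two_div_pstar// /= mul1r invrK.
Qed.

Lemma minimizing_sequence_compact (U : nat -> 'rV[R]_n -> R) :
  (forall k, H0 sigma Om (U k)) -> (forall k, energy sigma Om (U k) = 1%E) ->
  Rquot sigma Om (U k) @[k --> \oo] --> S ->
  exists theta : nat -> nat, {homo theta : i j / (i < j)%N} /\
  exists v, [/\ H0 sigma Om v, energy sigma Om (fun x => U (theta k) x - v x) @[k --> \oo] --> 0%E,
    (0 < lpow sigma Om v)%E & Rquot sigma Om v = S].
Proof.
move=> UH UE UQ; have [c muO] := domain_measure oO OB.
have p2 := pstar_gt2 n2 s0 s1.
have q0 : 0 < 2 / p by rewrite divr_gt0.
have q1 : 2 / p <= 1 by rewrite ler_pdivrMr// mul1r ltW.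
have mU k := H0_measurable n2 s0 s1 mO (UH k).
have ULf k : (lpow sigma Om (U k) < +oo)%E by case: (H0_fin n2 s0 s1 mO S0 SOle (UH k)).
(* At energy 1 the quotient is [L^(-2/p)], so [L] tends to the [l] with [l^(2/p) = 1 / S]. *)
pose l := S^-1 `^ (p / 2).
have Si0 : 0 < S^-1 by rewrite invr_gt0.
have lS : l `^ (2 / p) = S^-1.
  by rewrite /l -powRrM (_ : p / 2 * (2 / p) = 1) ?powRr1 ?ltW//; field; rewrite gt_eqF.
have back x : 0 <= x -> (x `^ (2 / p)) `^ (p / 2) = x.
  move=> x0; rewrite -powRrM (_ : 2 / p * (p / 2) = 1) ?powRr1//.
  by field; rewrite gt_eqF.
have l0 : 0 < l by exact: powR_gt0.
have Ulim : fine (lpow sigma Om (U k)) @[k --> \oo] --> l.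
  have h1 : (Rquot sigma Om (U k))^-1 @[k --> \oo] --> S^-1 by apply: cvgV => //; rewrite gt_eqF.
  have p20 : 0 < p / 2 by rewrite divr_gt0.
  have h2 := powR_cvg p20 h1; rewrite gtr0_norm// in h2.
  apply: eq_cvg_ext h2 => k; rewrite -lpow_Rquot// ger0_norm ?powR_ge0// back//.
  by apply: fine_ge0; exact: lpow_ge0.
(* [l] is also the largest value that the Sobolev inequality allows at energy 1, hence a bound for
   every term. *)
have Ul k : (lpow sigma Om (U k) <= l%:E)%E.
  rewrite -lpow_fineK// lee_fin.
  have := H0_Sconst n2 s0 s1 mO muO S0 SOle (UH k); rewrite UE /= -ler_pdivlMl// mulr1 -lS => h.
  have x0 : 0 <= fine (lpow sigma Om (U k)) by apply: fine_ge0; exact: lpow_ge0.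
  rewrite -(back _ (ltW l0)) -(back _ x0).
  have p20 : 0 <= p / 2 by rewrite divr_ge0// ltW.
  by apply: ge0_ler_powR => //; rewrite nnegrE powR_ge0.
have UE1 k : (energy sigma Om (U k) <= 1%:E)%E by rewrite UE.
have [theta [htheta [v [mv v0 aev Mv]]]] := ae_subsequence n2 s0 s1 oO OB muO mU UE1 Ul.
exists theta; split=> //; exists v.
pose W k := U (theta k); pose G k x := W k x - v x.
have mG k : measurable_fun setT (G k) := measurable_funB (mU (theta k)) mv.
have rv : rst Om v = v by exact: rst_id.
have Ev : (energy sigma Om v <= 1%:E)%E.
  rewrite energy.unlock; apply: (pint_fatou (ltr0Sn R 1)
    (fun k => measurable_gag sigma mO (mU (theta k))) (measurable_gag sigma mO mv)).
    by move=> k; have := UE1 (theta k); rewrite energy.unlock.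
  by apply: ae_gag; rewrite rv.
have Lv : (lpow sigma Om v <= l%:E)%E.
  rewrite lpow.unlock; apply: (pint_fatou p0
    (fun k => measurable_rst mO (mU (theta k))) (measurable_rst mO mv)).
    by move=> k; have := Ul (theta k); rewrite lpow.unlock.
  by rewrite rv.
have Evf : (energy sigma Om v < +oo)%E by apply: le_lt_trans Ev _; exact: ltry.
have Lvf : (lpow sigma Om v < +oo)%E by apply: le_lt_trans Lv _; exact: ltry.
have [C1 C10 hL] := lpowB_bound n2 s0 s1 l mO.
have [C2 C20 hE] := energyB_bound sigma 1 mO.
pose M := C1 + C2.
have EG k : (energy sigma Om (G k) <= M%:E)%E.
  by apply: le_trans (hE _ _ (mU (theta k)) mv (UE1 _) Ev) _; rewrite lee_fin /M lerDr.
have LG k : (lpow sigma Om (G k) <= M%:E)%E.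
  by apply: le_trans (hL _ _ (mU (theta k)) mv (Ul _) Lv) _; rewrite lee_fin /M lerDl.
have EGf k : (energy sigma Om (G k) < +oo)%E by apply: le_lt_trans (EG k) _; exact: ltry.
have LGf k : (lpow sigma Om (G k) < +oo)%E by apply: le_lt_trans (LG k) _; exact: ltry.
have aeG : {ae mu, forall x, rst Om (G k) x @[k --> \oo] --> 0}.
  apply: filterS aev => x h; rewrite -(subrr (v x)).
  apply: eq_cvg_ext (cvgB h (@cvg_cst _ (v x) _ _ _)) => k.
  by rewrite /G rstB rv.
have GvE k : (fun x => G k x + v x) = W k by apply/funext => x; rewrite /G subrK.
have vGE k : (fun x => v x + G k x) = W k by apply/funext => x; rewrite /G addrC subrK.
have vH : H0 sigma Om v.
  apply: (weak_limit_H0 n2 s0 s1 mO mG EG LG aeG mv) => k.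
  by rewrite GvE; exact: UH.
have GH k : H0 sigma Om (G k).
  have := H0D n2 s0 s1 mO (UH (theta k)) (H0Z n2 s0 s1 mO (- 1) vH).
  by rewrite (_ : (fun x => _ + _) = G k)//; apply/funext => x; rewrite /G mulN1r.
pose a := fine (energy sigma Om v); pose A := fine (lpow sigma Om v).
have a0 : 0 <= a by apply: fine_ge0; exact: energy_ge0.
have A0 : 0 <= A by apply: fine_ge0; exact: lpow_ge0.
have a1 : a <= 1 by rewrite -lee_fin energy_fineK.
have Elim : fine (energy sigma Om (G k)) @[k --> \oo] --> 1 - a.
  have h := brezis_lieb_energy mO mG EG aeG mv Evf.
  have h1 : 1 - (fine (energy sigma Om (fun x => v x + G k x)) - fine (energy sigma Om (G k)))
      @[k --> \oo] --> 1 - a by apply: cvgB => //; exact: cvg_cst.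
  apply: eq_cvg_ext h1 => k.
  by rewrite vGE UE /= opprB addrC subrK.
have Llim : fine (lpow sigma Om (G k)) @[k --> \oo] --> l - A.
  have h := brezis_lieb_lpow n2 s0 s1 mO mG LG aeG mv Lvf.
  have h2 : fine (lpow sigma Om (W k)) @[k --> \oo] --> l by exact: (cvg_subseq htheta Ulim).
  have h1 : fine (lpow sigma Om (W k)) - (fine (lpow sigma Om (fun x => v x + G k x)) -
      fine (lpow sigma Om (G k))) @[k --> \oo] --> l - A by exact: cvgB h2 h.
  apply: eq_cvg_ext h1 => k.
  by rewrite vGE opprB addrC subrK.
have Mlim : fine (mass Om (G k)) @[k --> \oo] --> 0.
  apply: fine_cvg; apply: (squeeze0 _ Mv); first by move=> k; exact: mass_ge0.
  apply: cvg_EFin; [exact: nearW|apply: cvg_expr].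
  by rewrite ger0_norm; lra.
have B0 : 0 <= l - A.
  apply: (ler_cvg_to (@cvg_cst _ (0 : R) _ _ _) Llim).
  by apply: nearW => k; apply: fine_ge0; exact: lpow_ge0.
pose D := (l - A) `^ (2 / p).
have D0 : 0 <= D by exact: powR_ge0.
(* The half-space constant is an extended real, so an infinite value is treated apart. *)
have [S1 [S2 [S12 S2S S1h]]] : exists S1 S2 : R,
    [/\ S2 < S1, S < S2 & (S1%:E <= Sconst sigma (@halfspace R n))%E].
  case: (Sconst sigma (@halfspace R n)) Shalf => [t||]//.
    by rewrite lte_fin => St; exists t, ((S + t) / 2); split; [lra|lra|].
  by move=> _; exists (S + 2), (S + 1); split; [lra|lra|exact: leey].
have [C C0 hC] := global_ineq n2 s0 s1 oO OB bO S0 SOle (lt_trans S0 S2S) S12 S1h.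
have hG k := H0_ineq n2 s0 s1 mO muO S0 SOle hC (GH k).
have ineq : S2 * D <= 1 - a.
  have h1 := powR_cvg q0 Llim; rewrite (ger0_norm B0) -/D in h1.
  have h2 : 1 * fine (energy sigma Om (G k)) + C * fine (mass Om (G k)) @[k --> \oo] --> 1 - a.
    by rewrite -[1 - a]addr0 -[X in _ --> X + _]mul1r -(mulr0 C); apply: cvgD; apply: cvgMr.
  have h3 : S2 * `|fine (lpow sigma Om (G k))| `^ (2 / p) @[k --> \oo] --> S2 * D by apply: cvgMr.
  apply: (ler_cvg_to h3 h2); apply: nearW => k.
  by rewrite ger0_norm ?fine_ge0 ?lpow_ge0//; exact: hG.
have Sv : S * A `^ (2 / p) <= a by exact: (H0_Sconst n2 s0 s1 mO muO S0 SOle vH).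
(* Applied to [l = A + (l - A)] and multiplied by [S], this reads [1 <= S A^(2/p) + S D]; with [Sv]
   and [ineq] it gives [(S2 - S) D <= 0]. *)
have sub : l `^ (2 / p) <= A `^ (2 / p) + D.
  rewrite -{1}[l](subrKC A); apply: powR_subadd => //.
  by rewrite (ltW q0).
rewrite lS -(ler_pM2l S0) mulrDr mulfV ?gt_eqF// in sub.
have Dz : D = 0.
  have : (S2 - S) * D <= 0 by lra.
  by rewrite pmulr_rle0 ?subr_gt0// => D1; apply/eqP; rewrite eq_le D1.
have a11 : a = 1 by move: sub ineq; rewrite Dz !mulr0 => *; lra.
have lA : A = l.
  have /eqP := Dz; rewrite powR_eq0 => /andP[/eqP h _]; lra.
split=> //.
- apply/fine_cvgP; split; last by rewrite a11 subrr in Elim; exact: Elim.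
  by apply: nearW => k; rewrite ge0_fin_numE ?energy_ge0//; exact: EGf.
- by rewrite -(lpow_fineK Lvf) lte_fin -/A lA.
- rewrite /Rquot IgagE// LintE// two_div_pstar// -/a -/A a11 lA lS.
  by rewrite mul1r invrK.
Qed.

End MinimizingSequences.

(** * Existence of a normalized minimizing sequence *)

Section MinimizingSequenceExists.
Context {R : realType} (n : nat) (sigma : R).
Hypothesis (n2 : (2 <= n)%N) (s0 : 0 < sigma) (s1 : sigma < 1).
Local Notation p := (pstar n sigma).
Context (Om : set 'rV[R]_n) (S : R).
Hypotheses (mO : measurable Om) (S0 : 0 < S) (SO : Sconst sigma Om = S%:E).

(** The quotient is invariant under scaling, so near-minimizers can be brought to energy 1 without
    leaving [C1c]. *)
Lemma normalized_minimizing_sequence : exists U : nat -> 'rV[R]_n -> R,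
  [/\ forall k, C1c Om (U k), forall k, energy sigma Om (U k) = 1%E &
    Rquot sigma Om (U k) @[k --> \oo] --> S].
Proof.
have p0 := pstar_gt0 n2 s0 s1.
have ex k : exists u, [/\ C1c Om u, energy sigma Om u = 1%E, S <= Rquot sigma Om u &
    Rquot sigma Om u <= S + k.+1%:R^-1].
  have k0 : 0 < k.+1%:R^-1 :> R by rewrite invr_gt0.
  have : (Sconst sigma Om < (S + k.+1%:R^-1)%:E)%E by rewrite SO lte_fin ltrDl.
  move=> /ereal_inf_lt[_ [u [uC [x ux]] <-]]; rewrite lte_fin => Qu.
  have Su : S <= Rquot sigma Om u.
    by rewrite -lee_fin -SO; apply: ereal_inf_lbound; exists u => //; split=> //; exists x.
  have SOle : (S%:E <= Sconst sigma Om)%E by rewrite SO.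
  have [Ef Lf _] := Sconst_le n2 s0 s1 mO S0 SOle uC.
  have mu := C1c_measurable uC.
  have QE w : measurable_fun setT w ->
      Rquot sigma Om w = fine (energy sigma Om w) / fine (lpow sigma Om w) `^ (2 / p).
    by move=> mw; rewrite /Rquot IgagE// LintE// two_div_pstar.
  pose e := fine (energy sigma Om u); pose l := fine (lpow sigma Om u).
  (* Energy 0 would make the quotient 0, below [S]. *)
  have e0 : 0 < e.
    rewrite lt_neqAle fine_ge0 ?energy_ge0// andbT; apply/eqP => ez.
    by move: Su; rewrite QE// -/e -ez mul0r leNgt S0.
  have l0 : 0 <= l by rewrite fine_ge0 ?lpow_ge0.
  pose c := (Num.sqrt e)^-1; have c0 : 0 < c by rewrite invr_gt0 sqrtr_gt0.
  have c2 : c ^+ 2 = e^-1 by rewrite exprVn sqr_sqrtr// ltW.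
  have Ew : energy sigma Om (fun x => c * u x) = 1%E.
    by rewrite energyZ// c2 -(energy_fineK Ef) -EFinM mulVf// gt_eqF.
  have Lw : fine (lpow sigma Om (fun x => c * u x)) `^ (2 / p) = e^-1 * l `^ (2 / p).
    rewrite lpowZ// -(lpow_fineK Lf) -EFinM /= powRM ?powR_ge0// -powRrM.
    rewrite (_ : p * (2 / p) = 2); last by field; rewrite gt_eqF.
    by rewrite ger0_norm ?(ltW c0)// powR_mulrn ?(ltW c0)// c2.
  have Qw : Rquot sigma Om (fun x => c * u x) = Rquot sigma Om u.
    rewrite (QE (fun x => c * u x)); last exact: measurable_funM.
    by rewrite (QE u)// Ew Lw /= invfM invrK mul1r.
  exists (fun x => c * u x); split; [exact: C1cZ|exact: Ew|by rewrite Qw|].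
  by rewrite Qw; exact: ltW.
have [U hU] := choice ex; exists U; split=> [k|k|]; [by case: (hU k)..|].
have lim : S + k.+1%:R^-1 @[k --> \oo] --> S.
  by rewrite -[X in _ --> X]addr0; apply: cvgD; [exact: cvg_cst|exact: cvg_harmonic].
apply: (squeeze_cvgr _ (@cvg_cst _ S _ _ _) lim).
by apply: nearW => k; have [_ _ -> ->] := hU k.
Qed.

End MinimizingSequenceExists.

Theorem theorem1p4 (R : realType) (n : nat) (sigma : R) (Om : set 'rV[R]_n) :
  (2 <= n)%N -> 1 / 2 <= sigma -> sigma < 1 ->
  open Om -> bounded_Rn Om -> C1_boundary Om ->
  (0 < Sconst sigma Om)%E ->
  (Sconst sigma Om < Sconst sigma (@halfspace R n))%E ->
  (forall u : nat -> 'rV[R]_n -> R,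
     (forall k, H0 sigma Om (u k)) ->
     (forall k, H0_nonzero sigma Om (u k)) ->
     (forall k, Igag sigma Om (u k) = 1%E) ->
     (fun k => (Rquot sigma Om (u k))%:E) @ \oo --> Sconst sigma Om ->
     forall phi : nat -> nat, {homo phi : a b / (a < b)%N} ->
     exists psi : nat -> nat, {homo psi : a b / (a < b)%N} /\
     exists v : 'rV[R]_n -> R, H0 sigma Om v /\
       (fun j => Igag sigma Om (u (phi (psi j)) - v)) @ \oo --> 0%E)
  /\
  (exists u : 'rV[R]_n -> R,
     [/\ H0 sigma Om u, H0_nonzero sigma Om u & (Rquot sigma Om u)%:E = Sconst sigma Om]).
Proof.
move=> n2 sh s1 oO [B OB] bO Spos Slt.
have s0 : 0 < sigma by lra.
have mO := open_measurable_rv oO.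
(* The strict comparison with the half-space excludes the value [+oo]. *)
have [S SO] : exists S : R, Sconst sigma Om = S%:E.
  move: Spos Slt; case: (Sconst sigma Om) => [t _ _||]; first by exists t.
    by move=> _; rewrite ltNge leey.
  by rewrite ltNge leNye.
rewrite SO lte_fin in Spos; rewrite SO in Slt.
split.
- move=> u uH _ uI uQ phi hphi.
  have mu k := H0_measurable n2 s0 s1 mO (uH k).
  have uE k : energy sigma Om (u k) = 1%E by rewrite -IgagE.
  have uQ' : Rquot sigma Om (u k) @[k --> \oo] --> S.
    by rewrite SO in uQ; exact: (fine_cvg uQ).
  (* Relative compactness is expressed by subsequences: the result is applied to [u] along [phi],
     which is again a minimizing sequence of energy 1. *)
  have [psi [hpsi [v [vH vE _ _]]]] := minimizing_sequence_compact n2 s0 s1 oO OB bO Spos SO Slt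
    (fun k => uH (phi k)) (fun k => uE (phi k)) (cvg_subseq hphi uQ').
  exists psi; split=> //; exists v; split=> //.
  have mv := H0_measurable n2 s0 s1 mO vH.
  apply: eq_cvg_ext vE => k; rewrite IgagE//; exact: (measurable_funB (mu (phi (psi k))) mv).
- have [U [UC UE UQ]] := normalized_minimizing_sequence n2 s0 s1 mO Spos SO.
  have [psi [_ [v [vH _ vL vQ]]]] := minimizing_sequence_compact n2 s0 s1 oO OB bO Spos SO Slt
    (fun k => H0_C1c n2 s0 s1 mO (UC k)) UE UQ.
  exists v; split=> //; last by rewrite vQ SO.
  by rewrite /H0_nonzero LintE//; exact: (H0_measurable n2 s0 s1 mO vH).
Qed.
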